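(* Let $\Gamma$ be a sofic group, let $n\ge 1$, and let $A\in M_n(\overline{\mathbb{Q}}\Gamma)$, acting on $(\ell^2\Gamma)^{\oplus n}$ by left convolution, where $\overline{\mathbb{Q}}$ is the field of algebraic numbers. Write $A=\sum_{g\in\Gamma}A_g\,g$ with coefficient matrices $A_g\in M_n(\overline{\mathbb{Q}})$. Let $(\phi_{F,\epsilon})$ be a family of sofic approximations of $\Gamma$ indexed by the directed set of pairs $(F,\epsilon)$, as specified in the context. Then: (i) All eigenvalues of $A$ (acting on $(\ell^2\Gamma)^{\oplus n}$) are algebraic numbers. (ii) If all entries of the coefficient matrices are rational, then for every eigenvalue of $A$ all its Galois conjugates are also eigenvalues of $A$, and the corresponding eigenspaces have the same von Neumann dimension. (iii) If all entries of the coefficient matrices are algebraic integers, then the eigenvalues of $A$ are algebraic integers. (iv) For all $\lambda\in\mathbb{C}$, the approximation formula holds: $$\dim_{L\Gamma}\ker(\lambda\cdot\mathrm{id}-A)=\lim_{(F,\epsilon)\to\infty}\frac{\dim_{\mathbb{C}}\ker(\lambda\cdot\mathrm{id}-\phi_{F,\epsilon}(A))}{n_{F,\epsilon}}.$$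
   Context: $\Gamma$ is a discrete group. For $\sigma\in S_m$ let $\#_1\sigma$ denote the number of fixed points of $\sigma$. $\Gamma$ is called sofic if for every real $0<\epsilon<1$ and every finite subset $F\subseteq\Gamma$ there exist a natural number $m$ and a map $\phi\colon\Gamma\to S_m$ such that: (1) $\#_1\big(\phi(g)\phi(h)\phi(gh)^{-1}\big)\ge(1-\epsilon)m$ for all $g,h\in F$; (2) $\phi(e)=e$; (3) $\#_1\phi(g)\le\epsilon m$ for all $e\ne g\in F$. When $F$ is symmetric ($F^{-1}=F$) one may moreover assume $\phi(g^{-1})=\phi(g)^{-1}$ for $g\in F$. Pairs $(F,\epsilon)$ of a finite symmetric subset $F\subset\Gamma$ and a real number $0<\epsilon<1$ are directed by $(F,\epsilon)\le(F',\epsilon')$ iff $F\subset F'$ and $\epsilon\ge\epsilon'$. For each $(F,\epsilon)$ fix a map $\phi_{F,\epsilon}\colon\Gamma\to S_{n_{F,\epsilon}}$ satisfying (1)-(3) for $(F,\epsilon)$ and $\phi_{F,\epsilon}(g^{-1})=\phi_{F,\epsilon}(g)^{-1}$ for $g\in F$. Composing with the representation of $S_m$ by permutation matrices and extending linearly gives a linear map $\phi_{F,\epsilon}\colon\mathbb{C}\Gamma\to M_{n_{F,\epsilon}}(\mathbb{C})$; applied entrywise it gives $\phi_{F,\epsilon}\colon M_n(\mathbb{C}\Gamma)\to M_n(M_{n_{F,\epsilon}}(\mathbb{C}))=M_{n\cdot n_{F,\epsilon}}(\mathbb{C})$. The limit is the limit of the net over the directed set of pairs. $\ell^2\Gamma$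 is the Hilbert space with orthonormal basis $\Gamma$; $L\Gamma$ is the von Neumann algebra of bounded operators on $\ell^2\Gamma$ commuting with the right convolution action of $\Gamma$, with trace $\tau(T)=\langle T\delta_e,\delta_e\rangle$. The von Neumann dimension $\dim_{L\Gamma}V$ of a closed right-$\Gamma$-invariant subspace $V\subseteq(\ell^2\Gamma)^{\oplus n}$ is $\sum_{i=1}^n\tau(P_{ii})$, where $P=(P_{ij})\in M_n(L\Gamma)$ is the orthogonal projection onto $V$. The Galois conjugates of an algebraic number are the complex roots of its minimal polynomial over $\mathbb{Q}$. *)

(* Defs.v *)
From HB Require Import structures.
From mathcomp Require Import all_boot all_order all_algebra all_fingroup finmap.
From mathcomp Require Import all_classical all_reals all_analysis.
From mathcomp Require Import complex.
From mathcomp Require summability.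

Set Implicit Arguments.
Unset Strict Implicit.
Unset Printing Implicit Defensive.

Import Order.TTheory GRing.Theory Num.Theory.
Import numFieldNormedType.Exports.

Local Open Scope classical_set_scope.
Local Open Scope ring_scope.

(* Algebraic numbers are the elements of C = R[i] that are algebraic over Q;
   thus algQ is the field \overline{Q}, seen inside C. *)
Section algebraic_numbers.
Variable R : realType.
Implicit Types x y : R[i].

Definition rational_number x := exists q : rat, x = ratr q.

Definition algebraic_number x := algebraicOver (ratr : rat -> R[i]) x.

Definition algebraic_integer x := integralOver (intr : int -> R[i]) x.

Definition minimal_polynomial (p : {poly rat}) x :=
  [/\ p \is monic, root (map_poly ratr p) x &
    forall q : {poly rat}, q != 0 -> root (map_poly ratr q) x ->
      (size p <= size q)%N].

Definition galois_conjugate x y :=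
  exists2 p : {poly rat}, minimal_polynomial p x & root (map_poly ratr p) y.

End algebraic_numbers.

(* The product and perm_mx below are those of MathComp, where (s * t) x is
   t (s x) and perm_mx s has a 1 at (i, s i).  Via s |-> s^-1 (as functions)
   this is the usual composition of functions together with the usual
   permutation matrices e_x |-> e_(s x); numbers of fixed points agree. *)
Section sofic.
Variables (R : realType) (G : groupType).
Implicit Types (F : {fset G}) (eps : R).

Definition nfix m (s : 'S_m) : nat := #|[set x | s x == x]%SET|.

(* 0 < m is part of the definition: the degenerate case of S_0 would satisfy
   the other clauses for every group. *)
Definition sofic_approximation F eps m (phi : G -> 'S_m) : Prop :=
  [/\ (0 < m)%N,
      forall g h, g \in F -> h \in F ->
        (1 - eps) * m%:R <= (nfix (phi g * phi h * (phi (g * h))^-1)%g)%:R,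
      phi 1%g = 1%g &
      forall g, g \in F -> g != 1%g -> (nfix (phi g))%:R <= eps * m%:R].

Definition sofic : Prop := forall eps F, 0 < eps < 1 ->
  exists m (phi : G -> 'S_m), sofic_approximation F eps phi.

Record sofic_index := SoficIndex {
  idx_set : {fset G};
  idx_eps : R;
  idx_sym : [fset (g^-1)%g | g in idx_set]%fset = idx_set;
  idx_eps_bound : 0 < idx_eps < 1 }.

Definition sofic_index_le (p q : sofic_index) : Prop :=
  (idx_set p `<=` idx_set q)%fset /\ idx_eps q <= idx_eps p.

Definition sofic_net : set_system sofic_index :=
  filter_from setT (fun p => [set q | sofic_index_le p q]).

Global Instance sofic_net_filter : ProperFilter sofic_net.
Proof.
have half01 : 0 < (2^-1 : R) < 1 by rewrite invr_gt0 ltr0n invf_lt1 ?ltr1n.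
have sym0 : [fset (g^-1)%g | g in (fset0 : {fset G})]%fset = fset0.
  by apply/fsetP => x; rewrite inE; apply/negP => /imfsetP[y /=]; rewrite inE.
apply: filter_from_proper; last first.
  by move=> p _; exists p; split; [exact: fsubset_refl | exact: lexx].
apply: filter_fromT_filter; first by exists (SoficIndex sym0 half01).
move=> p q.
have eps_bound : 0 < Num.min (idx_eps p) (idx_eps q) < 1.
  have /andP[p0 p1] := idx_eps_bound p; have /andP[q0 _] := idx_eps_bound q.
  by rewrite lt_min p0 q0 /= gt_min p1.
have sym : [fset (g^-1)%g | g in (idx_set p `|` idx_set q)%fset]%fset
    = (idx_set p `|` idx_set q)%fset.
  rewrite -[in RHS](idx_sym p) -[in RHS](idx_sym q).
  apply/fsetP => x; rewrite in_fsetU; apply/imfsetP/orP => /=.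
    by move=> [y]; rewrite in_fsetU => /orP[yp|yq] ->; [left|right];
      apply/imfsetP; exists y.
  by move=> [] /imfsetP[y /= yp ->]; exists y => //; rewrite in_fsetU yp ?orbT.
exists (SoficIndex sym eps_bound) => r [/=].
rewrite fsubUset => /andP[sp sq]; rewrite le_min => /andP[ep eq].
by split; split.
Qed.

Definition sofic_family (N : sofic_index -> nat)
    (phi : forall p, G -> 'S_(N p)) : Prop :=
  forall p, sofic_approximation (idx_set p) (idx_eps p) (phi p) /\
    forall g, g \in idx_set p -> phi p (g^-1)%g = ((phi p g)^-1)%g.

End sofic.

Section group_ring.
Variables (R : realType) (G : groupType).

Definition group_ring := {fsfun G -> R[i] with 0}.

Definition group_ring_perm m (phi : G -> 'S_m) (a : group_ring) : 'M[R[i]]_m :=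
  \sum_(g <- finsupp a) a g *: perm_mx (phi g).

Definition matrix_perm n m (phi : G -> 'S_m) (A : 'M[group_ring]_n) :
    'M[R[i]]_(\sum_(i < n) m) :=
  \mxblock_(i < n, j < n) group_ring_perm phi (A i j).

Definition dim_ker k (M : 'M[R[i]]_k) : nat :=
  \dim (lker (linfun (mulmx M : 'cV[R[i]]_k -> 'cV[R[i]]_k))).

(* l^2(G) and l^2(G)^n are the subsets l2 and l2n of the spaces of all
   functions; the unordered sum summability.sum is the limit of the net of
   finite partial sums. *)
Definition l2 : set (G -> R[i]) :=
  [set x | (\esum_(g in [set: G]) (Normc.normc (x g) ^+ 2)%:E < +oo)%E].

Definition l2n n : set ('I_n -> G -> R[i]) := [set x | forall i, l2 (x i)].

Definition inner (x y : G -> R[i]) : R[i] :=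
  summability.sum (fun g => x g * (y g)^* : R[i]^o).

Definition innern n (x y : 'I_n -> G -> R[i]) : R[i] :=
  \sum_(i < n) inner (x i) (y i).

Definition delta (h : G) : G -> R[i] := fun g => (g == h)%:R.

Definition left_conv (a : group_ring) (x : G -> R[i]) : G -> R[i] :=
  fun g => \sum_(h <- finsupp a) a h * x (h^-1 * g)%g.

Definition matrix_conv n (A : 'M[group_ring]_n) (x : 'I_n -> G -> R[i]) :
    'I_n -> G -> R[i] :=
  fun i => \sum_(j < n) left_conv (A i j) (x j).

Definition l2_eigenspace n (A : 'M[group_ring]_n) (lam : R[i]) :
    set ('I_n -> G -> R[i]) :=
  [set x | l2n x /\ lam *: x - matrix_conv A x = 0].

Definition is_eigenvalue n (A : 'M[group_ring]_n) (lam : R[i]) : Prop :=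
  exists2 x, l2_eigenspace A lam x & x != 0.

(* The value 0 is used only where no orthogonal projection of x exists, which
   does not occur for V a closed subspace and x in l^2(G)^n. *)
Definition orth_proj n (V : set ('I_n -> G -> R[i])) (x : 'I_n -> G -> R[i]) :
    'I_n -> G -> R[i] :=
  xget 0 [set v | V v /\ forall w, V w -> innern (x - v) w = 0].

Definition op_entry n (T : ('I_n -> G -> R[i]) -> ('I_n -> G -> R[i]))
    (i j : 'I_n) : (G -> R[i]) -> (G -> R[i]) :=
  fun x => T (fun k => if k == j then x else 0) i.

Definition vN_trace (T : (G -> R[i]) -> (G -> R[i])) : R[i] :=
  inner (T (delta 1%g)) (delta 1%g).

(* For V closed and invariant under right translations, the entries P_ij of
   the projection P onto V lie in the von Neumann algebra of G. *)
Definition vN_dim n (V : set ('I_n -> G -> R[i])) : R[i] :=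
  \sum_(i < n) vN_trace (op_entry (orth_proj V) i i).

End group_ring.

(* Main.v *)
From HB Require Import structures.
Require Import Defs.
From mathcomp Require Import all_boot all_order all_algebra all_fingroup finmap.
From mathcomp Require Import all_classical all_reals all_analysis.
From mathcomp Require Import separable complex.
From mathcomp Require summability.
From mathcomp Require Import lra ring.

Set Implicit Arguments.
Unset Strict Implicit.
Unset Printing Implicit Defensive.

Import Order.TTheory GRing.Theory Num.Theory.
Import numFieldNormedType.Exports.

(** Everything rests on the approximation formula for kernel dimensions. Once it
    is known, an eigenvalue of A is an eigenvalue of some finite matrix phi(A),
    because the von Neumann dimension of a nonzero eigenspace is nonzero
    ([not_eigenvalue_vN_dim]): this gives algebraicity and integrality of the
    eigenvalues. For rational A the ranks of lam - phi(A) and mu - phi(A) agree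
    when lam and mu are conjugate ([rank_galois]), hence so do their limits.

    For the formula, put B = lam - A and S = 1 - kap B^* B, with kap > 0 small
    enough that the matrices S_p = 1 - kap phi_p(B)^* phi_p(B) have all their
    eigenvalues in [0, 1]; kernels of B are the eigenspaces of S for 1.
    On the side of the group, the traces of the powers S^k decrease to the
    dimension of ker B: the columns of S^k converge in l^2 to the orthogonal
    projections of the basis vectors onto ker B ([orth_proj_basis],
    [vN_dim_conv_ker]). For each fixed k, soficity says that the normalized
    trace of S_p^k tends to the trace of S^k ([trace_cvg]); the traces of the S^k
    inherit from this their positivity and monotonicity. Finally, the normalized
    trace of S_p^k is at least dim ker phi_p(B) / n_p, and the difference of the
    two is small for large k, uniformly in p, as soon as phi_p(B)^* phi_p(B) has
    few eigenvalues in ]0, delta] for small delta, uniformly in p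
    ([trS_le_dim_ker]).

    That last, arithmetic, statement does not involve the group: it holds for
    all sums of matrices X_b tensored with arbitrary permutation matrices
    ([few_small_eigenvalues]).

    If lam is algebraic, all matrices involved take values in Z[eta] up to a
    bounded denominator. The product of the nonzero eigenvalues of
    phi_p(B)^* phi_p(B) is a coefficient of its characteristic polynomial, its
    conjugates are bounded exponentially in the size, and the product of all
    these conjugates is a nonzero integer: so the product is bounded below
    exponentially, and few factors can be small
    ([few_small_eigenvalues_algebraic]).

    If lam is transcendental, the pigeonhole principle gives an integer
    polynomial q whose value at lam is tiny compared with its size on the disc
    that contains all eigenvalues ([small_int_poly]). The argument above applied
    to q(phi_p(A)) shows that few eigenvalues of phi_p(A) are close to lam
    ([few_near_eigenvalues]). As phi_p(A) is not normal, this must be transferred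
    to singular values: after triangularization, replacing the few small
    diagonal entries of lam - phi_p(A) by 1 is a perturbation of small rank, and
    produces a matrix with large determinant ([few_small_gram]). *)

Local Open Scope ring_scope.
Local Open Scope sesquilinear_scope.

(** * Lowest coefficients of products of linear factors *)

Section LowestCoefficient.
Variable C : numClosedFieldType.

(** The zeros among the e i contribute a power of X, which shifts the constant
    coefficient of the remaining product. *)
Lemma norm_low_coef_prod_XsubC N (e : 'I_N -> C) :
  `|(\prod_(i < N) ('X - (e i)%:P))`_#|[pred i | e i == 0]| |
  = \prod_(i < N | e i != 0) `|e i|.
Proof.
rewrite (bigID (fun i => e i == 0)) /=.
rewrite (eq_bigr (fun=> 'X : {poly C})); last by move=> i /eqP->; rewrite subr0.
rewrite prodr_const coefXnM ltnn subnn -horner_coef0 horner_prod normr_prod.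
by apply: eq_bigr => i _; rewrite hornerXsubC sub0r normrN.
Qed.

Lemma norm_coef_prod_XsubC_le N (e : 'I_N -> C) K r :
  0 <= K -> (forall i, `|e i| <= K) ->
  `|(\prod_(i < N) ('X - (e i)%:P))`_r| <= (1 + K) ^+ N.
Proof.
move=> K0 eK; elim: N e eK r => [|N IHN] e eK r.
  by rewrite big_ord0 coef1 expr0; case: (r == 0%N); rewrite ?normr1 ?normr0 ?ler01.
rewrite big_ord_recl mulrBl coefB coefXM coefCM exprS mulrDl mul1r.
apply: le_trans (ler_normB _ _) _; apply: lerD; last first.
  by rewrite normrM ler_pM // IHN.
by case: r => [|r] /=; rewrite ?normr0 ?exprn_ge0 ?addr_ge0 // IHN.
Qed.

End LowestCoefficient.

(** * Polynomials of a matrix and triangularization *)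

Section PolyOfMatrix.

(** A version of [horner_mx] for matrices of arbitrary, possibly zero, size. *)
Definition polymx (R : comNzRingType) N (A : 'M[R]_N) (q : {poly R}) : 'M[R]_N :=
  \sum_(i < size q) q`_i *: A ^+ i.

Lemma map_mxX (R S : comNzRingType) (f : {rmorphism R -> S}) N (A : 'M[R]_N) k :
  map_mx f (A ^+ k) = (map_mx f A) ^+ k.
Proof. by elim: k => [|k IH]; rewrite ?map_mx1 // !exprS map_mxM IH. Qed.

Lemma polymxE (R : comNzRingType) N (A : 'M[R]_N) (q : {poly R}) n : (size q <= n)%N ->
  polymx A q = \sum_(i < n) q`_i *: A ^+ i.
Proof.
move=> le; rewrite /polymx (big_ord_widen _ (fun i => q`_i *: A ^+ i) le).
rewrite big_mkcond; apply: eq_bigr => i _; case: ltnP => // /(nth_default 0) ->.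
by rewrite scale0r.
Qed.

Lemma map_polymx (R S : comNzRingType) (f : {rmorphism R -> S}) N (A : 'M[R]_N) q :
  map_mx f (polymx A q) = polymx (map_mx f A) (map_poly f q).
Proof.
rewrite (polymxE (q := map_poly f q) _ (n := size q)) ?size_poly // raddf_sum /=.
by apply: eq_bigr => i _; rewrite map_mxZ map_mxX coef_map.
Qed.

Lemma trigmxM (R : pzRingType) N (A B : 'M[R]_N) : is_trig_mx A -> is_trig_mx B ->
  is_trig_mx (A *m B) /\ forall i, (A *m B) i i = A i i * B i i.
Proof.
move=> /is_trig_mxP tA /is_trig_mxP tB; split.
  apply/is_trig_mxP => i j ij; rewrite mxE big1 // => k _.
  have [ik|ki] := ltnP i k; first by rewrite tA ?mul0r.
  by rewrite tB ?mulr0 // (leq_ltn_trans ki).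
move=> i; rewrite mxE (bigD1 i) //= big1 ?addr0 // => k; rewrite neq_ltn => /orP[ki|ik].
  by rewrite (tB k i) ?mulr0.
by rewrite (tA i k) ?mul0r.
Qed.

Lemma trigmxX (R : pzRingType) N (A : 'M[R]_N) k : is_trig_mx A ->
  is_trig_mx (A ^+ k) /\ forall i, (A ^+ k) i i = A i i ^+ k.
Proof.
move=> tA; elim: k => [|k [IH1 IH2]].
  by split=> [|i]; rewrite expr0 ?scalar_mx_is_trig // mxE eqxx.
rewrite exprS; have [t d] := trigmxM tA IH1; split=> // i.
by rewrite d IH2 exprS.
Qed.

Lemma trig_polymx (R : comNzRingType) N (A : 'M[R]_N) q : is_trig_mx A ->
  is_trig_mx (polymx A q) /\ forall i, (polymx A q) i i = q.[A i i].
Proof.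
move=> tA; split=> [|i].
  apply/is_trig_mxP => i j ij; rewrite summxE big1 // => k _.
  by rewrite mxE; have [/is_trig_mxP->//] := trigmxX k tA; rewrite mulr0.
rewrite summxE horner_coef; apply: eq_bigr => k _; rewrite mxE.
by have [_ ->] := trigmxX k tA.
Qed.

Lemma char_poly_conj (F : fieldType) N (P A : 'M[F]_N) : P \in unitmx ->
  char_poly (invmx P *m A *m P) = char_poly A.
Proof.
move=> uP; pose Q := map_mx (@polyC F) P.
have uQ : map_mx polyC (invmx P) *m Q = 1%:M by rewrite -map_mxM mulVmx // map_mx1.
rewrite /char_poly /char_poly_mx !map_mxM /=.
have -> : 'X%:M - map_mx polyC (invmx P) *m map_mx polyC A *m map_mx polyC P
   = map_mx polyC (invmx P) *m ('X%:M - map_mx polyC A) *m Q.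
  by rewrite mulmxBr mulmxBl mul_mx_scalar -scalemxAl uQ scalemx1.
by rewrite !det_mulmx mulrAC -det_mulmx uQ det1 mul1r.
Qed.

Lemma polymx_conj (F : fieldType) N (P A : 'M[F]_N) q : P \in unitmx ->
  polymx (invmx P *m A *m P) q = invmx P *m polymx A q *m P.
Proof.
move=> uP; rewrite /polymx mulmx_sumr mulmx_suml; apply: eq_bigr => i _.
rewrite -scalemxAr -scalemxAl; congr (_ *: _).
elim: {i}(i : nat) => [|k IH]; first by rewrite !expr0 mulmx1 mulVmx.
by rewrite !exprS IH -!mulmxE !mulmxA mulmxK.
Qed.

Lemma Schur_trig (C : numClosedFieldType) N (A : 'M[C]_N) :
  exists P T : 'M[C]_N, [/\ P \is unitarymx, is_trig_mx T & A = invmx P *m T *m P].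
Proof.
case: N A => [|N] A.
  exists 1%:M, 0; split; last by apply/matrixP => -[].
    by apply/unitarymxP; rewrite trmx1 map_mx1 mulmx1.
  exact: mx0_is_trig.
have [P Pu tP] := Schur A (ltn0Sn N).
exists P, (conjmx P A); split=> //; rewrite conjumx ?unitarymx_unit //.
by rewrite !mulmxA mulVmx ?unitarymx_unit // mul1mx mulmxKV ?unitarymx_unit.
Qed.

Lemma char_poly_polymx_trig (C : numClosedFieldType) N (P T A : 'M[C]_N) q :
  P \is unitarymx -> is_trig_mx T -> A = invmx P *m T *m P ->
  char_poly (polymx A q) = \prod_(i < N) ('X - (q.[T i i])%:P).
Proof.
move=> uP tT ->; rewrite polymx_conj ?char_poly_conj ?unitarymx_unit //.
have [tq dq] := trig_polymx q tT; rewrite char_poly_trig //.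
by apply: eq_bigr => i _; rewrite dq.
Qed.

Lemma char_poly_polymx (C : numClosedFieldType) N (A : 'M[C]_N) :
  exists e : 'I_N -> C, forall q,
    char_poly (polymx A q) = \prod_(i < N) ('X - (q.[e i])%:P).
Proof.
have [P [T [uP tT eA]]] := Schur_trig A; exists (fun i => T i i) => q.
exact: char_poly_polymx_trig eA.
Qed.

Lemma polymxX (R : comNzRingType) N (A : 'M[R]_N) : polymx A 'X = A.
Proof.
by rewrite /polymx size_polyX big_ord_recr big_ord1 !coefX /= scale0r add0r scale1r expr1.
Qed.

End PolyOfMatrix.

(** * Liouville's inequality *)

Section Liouville.
Variable C : numClosedFieldType.

Lemma unique_prod_XsubC N (e f : 'I_N -> C) (q : {poly C}) :
  \prod_(i < N) ('X - (e i)%:P) = \prod_(i < N) ('X - (f i)%:P) ->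
  \prod_(i < N | q.[e i] != 0) `|q.[e i]| = \prod_(i < N | q.[f i] != 0) `|q.[f i]|.
Proof.
move=> ef; have pe : perm_eq [seq e i | i <- enum 'I_N] [seq f i | i <- enum 'I_N].
  apply: prod_XsubC_eq; by rewrite !big_map -enumT !big_enum.
have red (g : 'I_N -> C) : \prod_(i < N | q.[g i] != 0) `|q.[g i]| =
    \prod_(x <- [seq g i | i <- enum 'I_N] | q.[x] != 0) `|q.[x]|.
  by rewrite big_map big_enum_cond.
by rewrite !red (perm_big _ pe).
Qed.

(** The characteristic polynomial of c evaluated at the companion matrix of p
    has integer coefficients, and its lowest nonzero coefficient is, up to
    sign, the product of the nonzero c(r s). *)
Lemma prod_poly_roots_ge1 (p c : {poly int}) D (r : 'I_D -> C) :
  p \is monic -> map_poly intr p = \prod_(s < D) ('X - (r s)%:P) ->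
  1 <= \prod_(s < D | (map_poly intr c).[r s] != 0) `|(map_poly intr c).[r s]|.
Proof.
move=> pm pr; set cC := map_poly intr c.
have sz : size p = D.+1.
  rewrite -(size_map_inj_poly (@intr_inj C)) // pr size_prod_XsubC.
  by rewrite -[index_enum _]enumT size_enum_ord.
have eD : (size p).-1 = D by rewrite sz.
move: (companionmxK pm); move: (companionmx p); rewrite eD => Q chQ.
have [e eq] := char_poly_polymx (map_mx intr Q : 'M[C]_D).
have ee : \prod_(i < D) ('X - (e i)%:P) = \prod_(i < D) ('X - (r i)%:P).
  rewrite -pr -chQ map_char_poly /= -[in RHS](polymxX (map_mx intr Q)) eq.
  by apply: eq_bigr => i _; rewrite hornerX.
rewrite -(unique_prod_XsubC cC ee) -(norm_low_coef_prod_XsubC (fun i => cC.[e i])).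
rewrite -eq -map_polymx -map_char_poly coef_map /= -intr_norm; set z := (_)`_ _.
rewrite ler1z -gtz0_ge1 normr_gt0; apply/eqP => z0.
have : `|(\prod_(i < D) ('X - (cC.[e i])%:P))`_#|[pred i | cC.[e i] == 0]| | = 0.
  by rewrite -eq -map_polymx -map_char_poly coef_map /= -/z z0 normr0.
rewrite norm_low_coef_prod_XsubC => /eqP; apply/negP/prodf_neq0 => i.
by rewrite normr_eq0.
Qed.

(** All other factors of the product are at most K, so that none of them can
    be very small. *)
Lemma liouville (p c : {poly int}) D (r : 'I_D -> C) s0 K :
  p \is monic -> map_poly intr p = \prod_(s < D) ('X - (r s)%:P) ->
  1 <= K -> (forall s, `|(map_poly intr c).[r s]| <= K) ->
  (map_poly intr c).[r s0] != 0 ->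
  1 <= `|(map_poly intr c).[r s0]| * K ^+ D.
Proof.
move=> pm pr K1 cK c0; apply: le_trans (prod_poly_roots_ge1 c pm pr) _.
have K0 : 0 <= K by exact: le_trans K1.
rewrite (bigD1 s0) //= ler_wpM2l //.
apply: (@le_trans _ _ (\prod_(s < D | ((map_poly intr c).[r s] != 0) && (s != s0)) K)).
  by apply: ler_prod => i _; rewrite normr_ge0 cK.
rewrite prodr_const; apply: ler_weXn2l => //.
by rewrite -[leqRHS]card_ord max_card.
Qed.

End Liouville.

(** * Row sums and eigenvalues *)

Section RowSum.
Variable C : numClosedFieldType.

Definition rowsum_le m n (M : 'M[C]_(m, n)) K := forall i, \sum_j `|M i j| <= K.

Lemma rowsum_leD m n (A B : 'M[C]_(m, n)) a b :
  rowsum_le A a -> rowsum_le B b -> rowsum_le (A + B) (a + b).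
Proof.
move=> hA hB i; apply: le_trans (lerD (hA i) (hB i)).
by rewrite -big_split; apply: ler_sum => j _; rewrite mxE ler_normD.
Qed.

Lemma rowsum_le0 m n : rowsum_le (0 : 'M[C]_(m, n)) 0.
Proof. by move=> i; rewrite big1 // => j _; rewrite mxE normr0. Qed.

Lemma rowsum_leZ m n (A : 'M[C]_(m, n)) a x :
  rowsum_le A a -> rowsum_le (x *: A) (`|x| * a).
Proof.
move=> hA i; under eq_bigr do rewrite mxE normrM.
by rewrite -mulr_sumr ler_wpM2l.
Qed.

Lemma rowsum_le_sum m n (I : finType) (A : I -> 'M[C]_(m, n)) (a : I -> C) :
  (forall i, rowsum_le (A i) (a i)) -> rowsum_le (\sum_i A i) (\sum_i a i).
Proof.
move=> h; apply: (big_ind2 (fun (X : 'M[C]_(m, n)) x => rowsum_le X x)) => //.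
  exact: rowsum_le0.
by move=> X1 x1 X2 x2; apply: rowsum_leD.
Qed.

Lemma rowsum_leM m n p (A : 'M[C]_(m, n)) (B : 'M[C]_(n, p)) a b : 0 <= b ->
  rowsum_le A a -> rowsum_le B b -> rowsum_le (A *m B) (a * b).
Proof.
move=> b0 hA hB i; apply: (@le_trans _ _ (\sum_j \sum_k `|A i k| * `|B k j|)).
  apply: ler_sum => j _; rewrite mxE; apply: le_trans (ler_norm_sum _ _ _) _.
  by apply: ler_sum => k _; rewrite normrM.
rewrite exchange_big /=; under eq_bigr do rewrite -mulr_sumr.
apply: (@le_trans _ _ (\sum_k `|A i k| * b)).
  by apply: ler_sum => k _; rewrite ler_wpM2l.
by rewrite -mulr_suml ler_wpM2r.
Qed.

Lemma rowsum_le1 n : rowsum_le (1%:M : 'M[C]_n) 1.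
Proof.
move=> i; rewrite (bigD1 i) //= big1 ?addr0 ?mxE ?eqxx ?normr1 // => j ji.
by rewrite mxE eq_sym (negPf ji) normr0.
Qed.

Lemma rowsum_leX n (A : 'M[C]_n) a k : 0 <= a ->
  rowsum_le A a -> rowsum_le (A ^+ k) (a ^+ k).
Proof.
move=> a0 hA; elim: k => [|k IH]; first by rewrite !expr0; apply: rowsum_le1.
by rewrite !exprS; apply: rowsum_leM => //; rewrite exprn_ge0.
Qed.

Lemma rowsum_le_polymx n (A : 'M[C]_n) a (q : {poly C}) : 0 <= a ->
  rowsum_le A a -> rowsum_le (polymx A q) (\sum_(i < size q) `|q`_i| * a ^+ i).
Proof.
move=> a0 hA; apply: rowsum_le_sum => i; apply: rowsum_leZ.
exact: rowsum_leX.
Qed.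

Lemma rowsum_le_trans m n (A : 'M[C]_(m, n)) a b :
  a <= b -> rowsum_le A a -> rowsum_le A b.
Proof. by move=> ab h i; apply: le_trans ab. Qed.

(** Compare the l^1 norms of the two sides of v A = x v. *)
Lemma eigenvalue_rowsum_le n (A : 'M[C]_n) a x :
  rowsum_le A a -> root (char_poly A) x -> `|x| <= a.
Proof.
move=> hA; rewrite -eigenvalue_root_char => /eigenvalueP[v vA v0].
have s0 : 0 < \sum_j `|v 0 j|.
  rewrite lt_def sumr_ge0 // andbT; apply: contraNneq v0 => /eqP.
  rewrite psumr_eq0 // => /allP h; apply/eqP/rowP => j; rewrite mxE.
  by apply/eqP; rewrite -normr_eq0; apply: h; rewrite mem_index_enum.
rewrite -(ler_pM2r s0) mulr_sumr.
apply: (@le_trans _ _ (\sum_j \sum_k `|v 0 k| * `|A k j|)).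
  apply: ler_sum => j _; rewrite -normrM.
  have -> : x * v 0 j = \sum_k v 0 k * A k j.
    by have := congr1 (fun u : 'rV_n => u 0 j) vA; rewrite !mxE.
  apply: le_trans (ler_norm_sum _ _ _) _.
  by apply: ler_sum => k _; rewrite normrM.
rewrite exchange_big mulrC mulr_suml; apply: ler_sum => k _ /=.
by rewrite -mulr_sumr ler_wpM2l.
Qed.

Definition int_eval (x : C) : {rmorphism {poly int} -> C} :=
  horner_eval x \o map_poly (intr : int -> C).

(** The product of the nonzero eigenvalues of M(eta) is, up to sign, c(eta)
    where c is a coefficient of the characteristic polynomial of M; replacing
    eta by any of its conjugates keeps c bounded because M stays bounded. *)
Lemma prod_eigenvalues_ge (p : {poly int}) D (r : 'I_D -> C) s0 K N
    (M : 'M[{poly int}]_N) (e : 'I_N -> C) :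
  p \is monic -> map_poly intr p = \prod_(s < D) ('X - (r s)%:P) ->
  0 <= K -> (forall s, rowsum_le (map_mx (int_eval (r s)) M) K) ->
  char_poly (map_mx (int_eval (r s0)) M) = \prod_(i < N) ('X - (e i)%:P) ->
  1 <= (\prod_(i < N | e i != 0) `|e i|) * (1 + K) ^+ (N * D).
Proof.
move=> pm pr K0 bM chM; set z := #|[pred i | e i == 0]|.
have evch s : int_eval (r s) (char_poly M)`_z
    = (char_poly (map_mx (int_eval (r s)) M))`_z.
  by rewrite -map_char_poly coef_map.
have nz : \prod_(i < N | e i != 0) `|e i| != 0.
  by apply/prodf_neq0 => i; rewrite normr_eq0.
have E0 : `|int_eval (r s0) (char_poly M)`_z| = \prod_(i < N | e i != 0) `|e i|.
  by rewrite evch chM norm_low_coef_prod_XsubC.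
rewrite -E0 exprM; apply: (liouville pm pr) => [|s|].
- by rewrite exprn_ege1 // lerDl.
- rewrite -[(map_poly _ _).[_]]/(int_eval (r s) _) evch.
  have [f ff] := char_poly_polymx (map_mx (int_eval (r s)) M).
  have chf : char_poly (map_mx (int_eval (r s)) M) = \prod_(i < N) ('X - (f i)%:P).
    by rewrite -[in LHS](polymxX (map_mx _ M)) ff; apply: eq_bigr => i _; rewrite hornerX.
  rewrite chf; apply: norm_coef_prod_XsubC_le => // i.
  apply: eigenvalue_rowsum_le (bM s) _; rewrite chf (bigD1 i) //= rootM.
  by rewrite root_XsubC eqxx.
- by rewrite -[(map_poly _ _).[_]]/(int_eval (r s0) _) -normr_eq0 E0.
Qed.

End RowSum.

(** * Tensor products with permutation matrices *)

Section KroneckerPerm.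

(** The image of the monomial X g of M_n(C Gamma) when g acts by s. *)
Definition kron_perm (R : comNzRingType) n m (X : 'M[R]_n) (s : 'S_m) :
    'M[R]_(\sum_(i < n) m) :=
  \mxblock_(i < n, j < n) (X i j *: perm_mx s).

Lemma kron_permM (R : comNzRingType) n m (X Y : 'M[R]_n) (s t : 'S_m) :
  kron_perm X s *m kron_perm Y t = kron_perm (X *m Y) (s * t)%g.
Proof.
rewrite mul_mxblock; apply: eq_mxblock => i j.
rewrite mxE scaler_suml; apply: eq_bigr => k _.
by rewrite -scalemxAl -scalemxAr scalerA perm_mxM.
Qed.

Lemma kron_perm_scalar (R : comNzRingType) n m (x : R) :
  kron_perm (x%:M : 'M[R]_n) (1 : 'S_m)%g = x%:M.
Proof.
rewrite -mxdiagZ; apply: eq_mxblock => i j; rewrite mxE perm_mx1.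
case: eqP => _; last by rewrite scale0r.
by rewrite mulr1n conform_mx_id scalemx1.
Qed.

Lemma kron_perm_tr (R : comNzRingType) n m (X : 'M[R]_n) (s : 'S_m) :
  (kron_perm X s)^T = kron_perm X^T s^-1%g.
Proof.
by rewrite tr_mxblock; apply: eq_mxblock => i j; rewrite linearZ /= tr_perm_mx mxE.
Qed.

Lemma map_kron_perm (R S : comNzRingType) (f : {rmorphism R -> S}) n m
  (X : 'M[R]_n) (s : 'S_m) : map_mx f (kron_perm X s) = kron_perm (map_mx f X) s.
Proof. by apply/matrixP => i j; rewrite !mxE rmorphM rmorph_nat. Qed.

Lemma kron_permZ (R : comNzRingType) n m x (X : 'M[R]_n) (s : 'S_m) :
  kron_perm (x *: X) s = x *: kron_perm X s.
Proof. by apply/matrixP => i j; rewrite !mxE mulrA. Qed.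

Lemma mxtrace_perm (R : comNzRingType) m (s : 'S_m) :
  \tr (perm_mx s : 'M[R]_m) = #|[set x | s x == x]%SET|%:R.
Proof.
rewrite /mxtrace -sum1_card natr_sum [RHS]big_mkcond; apply: eq_bigr => i _.
by rewrite !mxE inE; case: eqP.
Qed.

Lemma mxtrace_kron_perm (R : comNzRingType) n m (X : 'M[R]_n) (s : 'S_m) :
  \tr (kron_perm X s) = \tr X * #|[set x | s x == x]%SET|%:R.
Proof.
rewrite mxtrace_mxblock [\tr X]/mxtrace mulr_suml; apply: eq_bigr => i _.
by rewrite mxtraceZ mxtrace_perm.
Qed.

Lemma rowsum_kron_perm (C : numClosedFieldType) n m (X : 'M[C]_n) (s : 'S_m) :
  rowsum_le (kron_perm X s) (\sum_i \sum_j `|X i j|).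
Proof.
move=> i; set i1 := tagnat.sig1 i; set i2 : 'I_m := tagnat.sig2 i.
have -> : \sum_k `|kron_perm X s i k|
    = \sum_(j < n) \sum_(l < m) `|X i1 j * perm_mx s i2 l|.
  rewrite sig_big_dep (reindex _ tagnat.sig_bij_on) /=.
  by apply: eq_bigr => k _; rewrite !mxE.
rewrite [leRHS](bigD1 i1) //= ler_wpDr ?sumr_ge0 // => [k _|]; first exact: sumr_ge0.
apply: ler_sum => j _; rewrite (bigD1 (s i2)) //= big1 => [|l ls].
  by rewrite !mxE eqxx mulr1 addr0.
by rewrite !mxE eq_sym (negPf ls) mulr0 normr0.
Qed.

End KroneckerPerm.

(** * Singular values *)

Lemma sqr_parallelogram (R : comNzRingType) (a b : R) :
  a ^+ 2 *+ 2 + b ^+ 2 *+ 2 - (a + b) ^+ 2 = (a - b) ^+ 2.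
Proof. ring. Qed.

Section SingularValues.
Variable C : numClosedFieldType.

Lemma adjM m n p (A : 'M[C]_(m, n)) (B : 'M[C]_(n, p)) : (A *m B)^t* = B^t* *m A^t*.
Proof. by rewrite trmx_mul map_mxM. Qed.

Lemma adj_sum m n (I : finType) (A : I -> 'M[C]_(m, n)) :
  (\sum_i A i)^t* = \sum_i (A i)^t*.
Proof.
apply/matrixP => i j; rewrite !mxE !summxE rmorph_sum.
by apply: eq_bigr => k _; rewrite !mxE.
Qed.

Lemma adjZ m n x (A : 'M[C]_(m, n)) : (x *: A)^t* = x^* *: A^t*.
Proof. by rewrite linearZ /= map_mxZ. Qed.

Definition nrm2 n (v : 'rV[C]_n) : C := \sum_i `|v 0 i| ^+ 2.

Lemma nrm2E n (v : 'rV[C]_n) : nrm2 v = (v *m v^t*) 0 0.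
Proof. by rewrite mxE; apply: eq_bigr => i _; rewrite !mxE normCK. Qed.

Lemma nrm2_ge0 n (v : 'rV[C]_n) : 0 <= nrm2 v.
Proof. by apply: sumr_ge0 => i _; rewrite exprn_ge0. Qed.

Lemma nrm2_eq0 n (v : 'rV[C]_n) : (nrm2 v == 0) = (v == 0).
Proof.
apply/idP/eqP => [|->]; last by rewrite /nrm2 big1 // => i _; rewrite mxE normr0 expr0n.
rewrite psumr_eq0 => [/allP h|i _]; last by rewrite exprn_ge0.
apply/rowP => i; rewrite mxE; apply/eqP.
by have := h i (mem_index_enum _); rewrite sqrf_eq0 normr_eq0.
Qed.

Lemma nrm2_gt0 n (v : 'rV[C]_n) : (0 < nrm2 v) = (v != 0).
Proof. by rewrite lt_def nrm2_eq0 nrm2_ge0 andbT. Qed.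

Lemma nrm2D_le n (u v : 'rV[C]_n) : nrm2 (u + v) <= nrm2 u *+ 2 + nrm2 v *+ 2.
Proof.
rewrite /nrm2 -!sumrMnl -big_split; apply: ler_sum => i _ /=; rewrite mxE.
set a := `|u 0 i|; set b := `|v 0 i|.
have [a0 b0] : 0 <= a /\ 0 <= b by split; apply: normr_ge0.
have ab : `|u 0 i + v 0 i| <= a + b by exact: ler_normD.
apply: (@le_trans _ _ ((a + b) ^+ 2)); first by rewrite ler_pXn2r // ?nnegrE ?addr_ge0.
rewrite -subr_ge0 sqr_parallelogram.
by rewrite real_exprn_even_ge0 // realB // ger0_real.
Qed.

(** Unlike [spectral_diag], which makes a choice, this predicate is stable under
    unitary conjugation and scaling. *)
Definition diagonalizes N (P : 'M[C]_N) (d : 'rV[C]_N) (T : 'M[C]_N) : Prop :=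
  P \is unitarymx /\ T = P^t* *m diag_mx d *m P.

Lemma nrm2_unitary N (P : 'M[C]_N) (v : 'rV[C]_N) :
  P \is unitarymx -> nrm2 (v *m P^t*) = nrm2 v.
Proof.
move=> uP; rewrite !nrm2E adjM trmxCK.
by rewrite mulmxA mulmxKtV.
Qed.

Lemma diag_quadratic N (P : 'M[C]_N) d (M : 'M[C]_N) (y : 'rV[C]_N) :
  diagonalizes P d (M^t* *m M) ->
  nrm2 (y *m M^t*) = \sum_i d 0 i * `|(y *m P^t*) 0 i| ^+ 2.
Proof.
move=> [uP eT]; rewrite nrm2E adjM trmxCK mulmxA -[y *m _ *m M]mulmxA eT !mulmxA.
set z := y *m P^t*.
have -> : z *m diag_mx d *m P *m y^t* = (z *m diag_mx d) *m z^t*.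
  by rewrite -!mulmxA; congr (_ *m _); rewrite adjM trmxCK.
rewrite mxE; apply: eq_bigr => i _; rewrite mul_mx_diag !mxE normCK.
by rewrite mulrA; congr (_ * _); rewrite mulrC.
Qed.

Lemma diagonalize_gram N (M : 'M[C]_N) :
  exists P d, diagonalizes P d (M^t* *m M) /\ forall i, 0 <= d 0 i.
Proof.
have nT : M^t* *m M \is normalmx.
  by apply/normalmxP; rewrite adjM trmxCK.
have [uP eT] := (spectral_unitarymx (M^t* *m M), orthomx_spectralP nT).
set P := spectralmx _ in uP eT; set d := spectral_diag _ in eT.
have dP : diagonalizes P d (M^t* *m M) by split=> //; rewrite {1}eT invmx_unitary.
exists P, d; split=> // i.
have := nrm2_ge0 (row i P *m M^t*); rewrite (diag_quadratic _ dP).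
rewrite -row_mul (unitarymxP uP) (bigD1 i) //= big1 => [|j ji].
  by rewrite !mxE eqxx normr1 expr1n mulr1 addr0.
by rewrite !mxE eq_sym (negPf ji) normr0 expr0n mulr0.
Qed.

Lemma diagonalizes_char_poly N (P : 'M[C]_N) d T : diagonalizes P d T ->
  char_poly T = \prod_(i < N) ('X - (d 0 i)%:P).
Proof.
move=> [uP ->]; rewrite -invmx_unitary // char_poly_conj ?unitarymx_unit //.
rewrite char_poly_trig ?diag_mx_is_trig //.
by apply: eq_bigr => i _; rewrite mxE eqxx mulr1n.
Qed.

Lemma diagonalizes_det N (P : 'M[C]_N) d T : diagonalizes P d T ->
  \det T = \prod_(i < N) d 0 i.
Proof.
move=> [uP ->]; rewrite !det_mulmx mulrAC -det_mulmx -invmx_unitary //.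
by rewrite mulVmx ?unitarymx_unit // det1 mul1r det_diag.
Qed.

Lemma diagonalizes_le N (P : 'M[C]_N) d T K i : diagonalizes P d T ->
  rowsum_le T K -> (forall i, 0 <= d 0 i) -> d 0 i <= K.
Proof.
move=> dT rT d0; rewrite -(ger0_norm (d0 i)); apply: eigenvalue_rowsum_le rT _.
by rewrite (diagonalizes_char_poly dT) (bigD1 i) //= rootM root_XsubC eqxx.
Qed.

Lemma diagonalizes_trX N (P : 'M[C]_N) d T x k : diagonalizes P d T ->
  \tr ((1%:M - x *: T) ^+ k) = \sum_i (1 - x * d 0 i) ^+ k.
Proof.
move=> [uP ->]; have uP' := unitarymx_unit uP.
rewrite -invmx_unitary //.
have -> : 1%:M - x *: (invmx P *m diag_mx d *m P) =
   invmx P *m diag_mx (\row_i (1 - x * d 0 i)) *m P.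
  have -> : diag_mx (\row_i (1 - x * d 0 i)) = 1%:M - x *: diag_mx d.
    apply/matrixP => i j; rewrite !mxE.
    by case: eqP => _; rewrite ?mulr1n ?mulr0n ?mulr0 ?subr0.
  rewrite mulmxBr mulmxBl mulmx1 mulVmx //; congr (_ - _).
  by rewrite -scalemxAr -scalemxAl.
have -> : (invmx P *m diag_mx (\row_i (1 - x * d 0 i)) *m P) ^+ k =
   invmx P *m diag_mx (\row_i (1 - x * d 0 i) ^+ k) *m P.
  elim: k => [|k IH].
    rewrite expr0 (_ : diag_mx _ = 1%:M) ?mulmx1 ?mulVmx //.
    by apply/matrixP => i j; rewrite !mxE expr0.
  rewrite exprS IH -mulmxE !mulmxA mulmxK //; congr (_ *m _).
  rewrite -mulmxA mulmx_diag; congr (_ *m diag_mx _).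
  by apply/rowP => i; rewrite !mxE exprS.
rewrite mxtrace_mulC mulKVmx // mxtrace_diag.
by apply: eq_bigr => i _; rewrite mxE.
Qed.

(** w M^* M = 0 forces the norm of w M^* to vanish. *)
Lemma mxrank_gram N (M : 'M[C]_N) : \rank (M^t* *m M) = \rank M.
Proof.
apply/eqP; rewrite eqn_leq mxrankM_maxr /=.
have -> : \rank M = \rank (M^t*)%R by rewrite mxrank_map mxrank_tr.
pose A := M^t*; pose T := A *m M; rewrite -/A -/T.
have sub : (kermx T <= kermx A)%MS.
  apply/rV_subP => w /sub_kermxP wT; apply/sub_kermxP; apply/eqP.
  rewrite -nrm2_eq0 nrm2E adjM trmxCK mulmxA -(mulmxA w) -/T.
  by rewrite wT mul0mx mxE.
have := mxrankS sub; rewrite !mxrank_ker.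
by rewrite leq_sub2lE ?rank_leq_row // rank_leq_row.
Qed.

Lemma mxrank_diag (F : fieldType) N (d : 'rV[F]_N) :
  \rank (diag_mx d) = (\sum_i nat_of_bool (d 0 i != 0)%R)%N.
Proof.
elim: N d => [|N IH] d; first by rewrite big_ord0 [diag_mx _]flatmx0 mxrank0.
move: d; rewrite -[N.+1]/(1 + N)%N => d; rewrite -[d]hsubmxK diag_mx_row rank_diag_block_mx IH.
rewrite big_split_ord big_ord1 /=; congr (_ + _)%N.
  rewrite row_mxEl; set x := lsubmx _; have [x0|x0] := eqVneq (x 0 0) 0.
    rewrite (_ : diag_mx x = 0) ?mxrank0 //; apply/matrixP => i j.
    by rewrite mxE !ord1 x0 mul0rn mxE.
  by rewrite mxrank_unit // unitmxE det_diag big_ord1 unitfE.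
by apply: eq_bigr => i _; rewrite row_mxEr.
Qed.

Lemma diagonalizes_corank N (P : 'M[C]_N) d T : diagonalizes P d T ->
  (N - \rank T)%N = #|[pred i | d 0 i == 0]|.
Proof.
move=> [uP ->]; have uP' := unitarymx_unit uP.
rewrite mxrankMfree ?row_free_unit // -invmx_unitary //.
rewrite (eqmxMfull _ _) ?row_full_unit ?unitmx_inv // mxrank_diag.
rewrite -[X in (X - _)%N]card_ord -sum1_card -sum1_card big_mkcond [in RHS]big_mkcond /=.
rewrite -sumnB => [|i _]; last by case: eqP.
by apply: eq_bigr => i _; rewrite inE; case: eqP.
Qed.

(** Min-max: on the span of the eigenvectors of M^* M for eigenvalues at most
    delta, cut by the conditions that diag f vanishes and that all components
    along the small eigenvectors of B^* B vanish, M and B agree, so that the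
    quadratic form would be both at most and greater than delta. A dimension
    count makes this intersection trivial. *)
Lemma count_small_perturb N (P P' : 'M[C]_N) d d' (M : 'M[C]_N) (f : 'rV[C]_N)
    (delta : C) :
  let B := M + diag_mx f in
  diagonalizes P d (M^t* *m M) -> (forall i, 0 <= d 0 i) ->
  diagonalizes P' d' (B^t* *m B) -> (forall i, 0 <= d' 0 i) -> 0 <= delta ->
  (#|[pred i | (d 0 i <= delta)%R]| <=
    #|[pred i | (d' 0 i <= delta)%R]| + #|[pred i | (f 0 i != 0)%R]|)%N.
Proof.
move=> B dM d0 dB d'0 delta0.
set g := [pred i | _]; set g' := [pred i | d' 0 i <= delta]; set h := [pred i | f 0 i != 0].
rewrite leqNgt; apply/negP => lt.
(* W spans the small eigenvectors of M^* M, and G collects the two families of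
   linear conditions. *)
pose W := \matrix_(i < #|g|) row (enum_val i) P.
pose G := row_mx (\matrix_(i < #|g|, j < #|g'|) (W *m P'^t*) i (enum_val j))
                 (\matrix_(i < #|g|, j < #|h|) W i (enum_val j)).
have kG : kermx G != 0.
  by rewrite -mxrank_eq0 mxrank_ker subn_eq0 -ltnNge (leq_ltn_trans (rank_leq_col G)).
have [u uG u0] : exists2 u : 'rV_#|g|, u *m G = 0 & u != 0.
  have [i ri] : exists i, row i (kermx G) != 0.
    apply/existsP; apply: contraNT kG; rewrite negb_exists => /forallP h0.
    by apply/eqP/row_matrixP => i; rewrite row0; apply/eqP; rewrite -[_ == _]negbK.
  by exists (row i (kermx G)) => //; rewrite -row_mul mulmx_ker row0.
pose y := u *m W.
have [uP uP'] := (dM.1, dB.1).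
have WP : W *m P^t* = \matrix_(i, j) (j == enum_val i)%:R.
  apply/matrixP => i j; rewrite !mxE.
  transitivity ((P *m P^t*) (enum_val i) j).
    by rewrite mxE; apply: eq_bigr => k _; rewrite !mxE.
  by rewrite (unitarymxP uP) mxE eq_sym.
have yP i : ~~ g i -> (y *m P^t*) 0 i = 0.
  move=> gi; rewrite /y -mulmxA WP mxE big1 // => j _; rewrite !mxE.
  case: eqP => [ij|_]; last by rewrite mulr0.
  by case/negP: gi; have := enum_valP j; rewrite -ij.
have ny : nrm2 y = nrm2 u.
  rewrite -(nrm2_unitary _ uP) /y -mulmxA WP nrm2E.
  have -> : (u *m (\matrix_(i, j) (j == enum_val i)%:R)) *m
     (u *m (\matrix_(i < #|g|, j < N) (j == enum_val i)%:R))^t* = u *m u^t*.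
    rewrite adjM mulmxA -[u *m _ *m _]mulmxA.
    rewrite [X in u *m X](_ : _ = 1%:M) ?mulmx1 //.
    apply/matrixP => i j; rewrite mxE (bigD1 (enum_val i)) //= big1 => [|k ki].
      by rewrite !mxE eqxx mul1r addr0 rmorph_nat (inj_eq enum_val_inj).
    by rewrite !mxE (negPf ki) mul0r.
  by rewrite nrm2E.
have y0 : 0 < nrm2 y by rewrite ny nrm2_gt0.
have yM : nrm2 (y *m M^t*) <= delta * nrm2 y.
  rewrite (diag_quadratic _ dM) -(nrm2_unitary y uP) /nrm2 mulr_sumr.
  apply: ler_sum => i _; have [gi|gi] := boolP (g i); last first.
    by rewrite yP // normr0 expr0n /= !mulr0.
  by rewrite ler_wpM2r ?exprn_ge0.
move: uG; rewrite mul_mx_row => /eqP; rewrite -row_mx0 => /eqP/eq_row_mx[G1 G2].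
have yB : y *m B^t* = y *m M^t*.
  rewrite /B linearD /= map_mxD mulmxDr.
  rewrite [X in _ + X](_ : _ = 0) ?addr0 //.
  apply/rowP => i; rewrite tr_diag_mx map_diag_mx mul_mx_diag !mxE.
  have [hi|/negPn/eqP ->] := boolP (h i); last by rewrite rmorph0 mulr0.
  have /(congr1 (fun v : 'rV_#|h| => v 0 (enum_rank_in hi i))) := G2.
  rewrite !mxE => G2i; rewrite [X in X * _](_ : _ = 0) ?mul0r // -[RHS]G2i.
  by apply: eq_bigr => k _; rewrite !mxE enum_rankK_in.
have yP' i : g' i -> (y *m P'^t*) 0 i = 0.
  move=> gi; have /(congr1 (fun v : 'rV_#|g'| => v 0 (enum_rank_in gi i))) := G1.
  move=> G1i; rewrite !mxE in G1i; rewrite /y -mulmxA mxE -[RHS]G1i.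
  by apply: eq_bigr => k _; rewrite [in RHS]mxE enum_rankK_in.
have : delta * nrm2 y < nrm2 (y *m B^t*).
  rewrite (diag_quadratic _ dB) -(nrm2_unitary y uP') /nrm2 mulr_sumr.
  rewrite -subr_gt0 -sumrB lt_def; apply/andP; split; last first.
    apply: sumr_ge0 => i _; rewrite -mulrBl.
    have [gi|gi] := boolP (g' i); first by rewrite yP' // normr0 expr0n /= mulr0.
    rewrite mulr_ge0 ?exprn_ge0 // subr_ge0.
    by apply: ltW; rewrite real_ltNge ?ger0_real.
  rewrite psumr_eq0 => [|i _]; last first.
    rewrite -mulrBl.
    have [gi|gi] := boolP (g' i); first by rewrite yP' // normr0 expr0n /= mulr0.
    rewrite mulr_ge0 ?exprn_ge0 // subr_ge0.
    by apply: ltW; rewrite real_ltNge ?ger0_real.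
  apply: contraTN y0 => /allP al; rewrite nrm2_gt0 negbK -nrm2_eq0 -(nrm2_unitary y uP') nrm2_eq0.
  apply/eqP/rowP => i; rewrite [RHS]mxE.
  have [gi|gi] := boolP (g' i); first exact: yP'.
  have := al i (mem_index_enum _); rewrite -mulrBl mulf_eq0 sqrf_eq0 normr_eq0.
  rewrite subr_eq0 => /orP[/eqP e|/eqP //]; move: gi; rewrite /g' /= e lexx //.
by rewrite yB real_ltNge ?ger0_real ?nrm2_ge0 ?mulr_ge0 ?nrm2_ge0 // yM.
Qed.

End SingularValues.

(** * Integral generators of number fields *)

Section Generator.
Variable C : numClosedFieldType.
Notation algebraic := (algebraicOver (ratr : rat -> C)).

Lemma primitive_element (xs : seq C) : {in xs, forall x, algebraic x} ->
  exists2 th, algebraic th &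
    {in xs, forall x, exists q : {poly rat}, (map_poly ratr q).[th] = x}.
Proof.
elim: xs => [|x xs IH] alg; first by exists 0 => //; apply: algebraic0.
have [y|y [q q0 qy] gy] := IH; first by move=> yx; apply: alg; rewrite inE yx orbT.
have [p p0 px] := alg x (mem_head _ _).
have [|n [[qx qxE] [qy' qyE]]] := pchar0_PET p0 px q0 qy.
  exact: pchar_num.
exists (y *+ n - x).
  apply: algebraic_sub; last by exists p.
  rewrite -mulr_natr; apply: algebraic_mul; first by exists q.
  by rewrite -(rmorph_nat ratr); apply: algebraic_id.
move=> w; rewrite inE => /orP[/eqP->|wx]; first by exists qx.
have [r <-] := gy _ wx; exists (r \Po qy').
by rewrite map_comp_poly horner_comp qyE.
Qed.

(** Clears the denominators of the argument: a polynomial in z is, up to a power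
    of b, an integer polynomial in b z. *)
Lemma horner_scale_arg (q : {poly int}) (b : int) (z : C) : b != 0 ->
  exists f : {poly int},
   (map_poly intr f).[b%:~R * z] = b%:~R ^+ (size q) * (map_poly intr q).[z].
Proof.
move=> b0; exists (\poly_(i < size q) (q`_i * b ^+ (size q - i))).
rewrite (@horner_coef_wide _ (size q)); last first.
  by apply: leq_trans (size_poly _ _) _; rewrite size_poly.
rewrite (@horner_coef_wide _ (size q) (map_poly _ q)) ?size_poly // mulr_sumr.
apply: eq_bigr => i _; rewrite !coef_map coef_poly ltn_ord /= rmorphM rmorphXn /=.
have -> : b%:~R ^+ size q = b%:~R ^+ (size q - i) * b%:~R ^+ i :> C.
  by rewrite -exprD subnK // ltnW.
by rewrite exprMn; ring.
Qed.

(** If b is the leading coefficient of an integer polynomial of degree d that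
    vanishes at th, multiply its value at th by b ^ (d - 1). *)
Lemma integral_multiple (th : C) : algebraic th ->
  exists b : int, exists2 p : {poly int}, b != 0 &
    p \is monic /\ root (map_poly intr p) (b%:~R * th).
Proof.
move=> [p0 p0n p0th]; have [q [a a0 pq]] := rat_poly_scale p0.
have q0 : q != 0 by apply: contraNneq p0n => q0; rewrite pq q0 rmorph0 scaler0.
have qth : root (map_poly intr q) th.
  move: p0th; rewrite pq linearZ /= rootE hornerZ mulf_eq0 fmorph_eq0 invr_eq0 intr_eq0.
  rewrite (negPf a0) /= -map_poly_comp.
  by rewrite (eq_map_poly (g := intr)) // => z /=; rewrite ratr_int.
have [D sq] : exists D, size q = D.+2.
  case sq: (size q) => [|[|D]]; last by exists D.
    by rewrite -size_poly_eq0 sq in q0.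
  have /size_poly1P[c c0 qc] : size q == 1%N by rewrite sq.
  by move: qth; rewrite qc map_polyC rootC /= intr_eq0 (negPf c0).
set b := lead_coef q; have b0 : b != 0 by rewrite lead_coef_eq0.
pose p : {poly int} := 'X^(D.+1) + \poly_(i < D.+1) (q`_i * b ^+ (D - i)).
exists b, p => //; split.
  by rewrite monicE lead_coefDl ?lead_coefXn // size_polyXn ltnS size_poly.
rewrite rootE /p rmorphD /= map_polyXn hornerD hornerXn.
rewrite (@horner_coef_wide _ D.+1); last first.
  by apply: leq_trans (size_poly _ _) _; rewrite size_poly.
move: qth; rewrite rootE (@horner_coef_wide _ D.+2) -?sq ?size_poly // sq.
rewrite big_ord_recr /= coef_map /= -[q`_D.+1]/(q`_D.+2.-1) -sq -/(lead_coef q) -/b => /eqP e.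
have -> : (b%:~R * th) ^+ D.+1 +
  \sum_(i < D.+1) (map_poly intr (\poly_(i < D.+1) (q`_i * b ^+ (D - i))))`_i *
     (b%:~R * th) ^+ i =
  b%:~R ^+ D * (\sum_(i < D.+1) (map_poly intr q)`_i * th ^+ i + b%:~R * th ^+ D.+1).
  rewrite mulrDr addrC; congr (_ + _); last by rewrite exprMn exprSr; ring.
  rewrite mulr_sumr; apply: eq_bigr => i _.
  rewrite !coef_map coef_poly ltn_ord /= rmorphM rmorphXn /=.
  have -> : b%:~R ^+ D = b%:~R ^+ (D - i) * b%:~R ^+ i :> C.
    by rewrite -exprD subnK // -ltnS.
  by rewrite exprMn; ring.
by rewrite e mulr0.
Qed.

Lemma integral_generator (xs : seq C) : {in xs, forall x, algebraic x} ->
  exists (p : {poly int}) (eta : C) (d : nat),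
  [/\ p \is monic, root (map_poly intr p) eta, (0 < d)%N &
   {in xs, forall x, exists f : {poly int}, d%:R * x = (map_poly intr f).[eta]}].
Proof.
move=> /primitive_element[th /integral_multiple[b [p b0 [pm pth]]] gen].
exists p, (b%:~R * th).
suff [d d0 h] : exists2 d, (0 < d)%N &
  {in xs, forall x, exists f : {poly int}, d%:R * x = (map_poly intr f).[b%:~R * th]}.
  by exists d.
elim: xs gen => [|x xs IH] gen; first by exists 1%N.
have [|d d0 h] := IH; first by move=> y yx; apply: gen; rewrite inE yx orbT.
have [d1 d10 [f1 f1E]] : exists2 d1, (0 < d1)%N &
   exists f : {poly int}, d1%:R * x = (map_poly intr f).[b%:~R * th].
  have [q qx] := gen x (mem_head _ _).
  have [q' [a a0 qq']] := rat_poly_scale q.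
  have [f fE] := horner_scale_arg q' th b0.
  exists `|(a * b ^+ size q') ^+ 2|%N.
    by rewrite absz_gt0 expf_eq0 /= mulf_neq0 // expf_neq0.
  exists ((a * b ^+ size q')%:P * f).
  rewrite rmorphM /= map_polyC hornerM hornerC fE.
  rewrite natr_absz ger0_norm ?sqr_ge0 // -qx qq' linearZ /= hornerZ -map_poly_comp.
  rewrite (eq_map_poly (g := intr)); last by move=> z /=; rewrite ratr_int.
  rewrite fmorphV /= ratr_int !rmorphXn rmorphM /= rmorphXn /=.
  have a0' : a%:~R != 0 :> C by rewrite intr_eq0.
  rewrite [(a * _)%:~R]rmorphM rmorphXn /=; move: (b%:~R ^+ _) => bs; by field.
exists (d * d1)%N; first by rewrite muln_gt0 d0.
move=> y; rewrite inE => /orP[/eqP->|/h[f fE]].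
  exists (d%:Z%:P * f1); rewrite [map_poly _ _]rmorphM /= map_polyC hornerM hornerC -f1E.
  by rewrite natrM mulrA.
exists (d1%:Z%:P * f); rewrite [map_poly _ _]rmorphM /= map_polyC hornerM hornerC -fE.
by rewrite natrM mulrA [d%:R * _]mulrC.
Qed.

Lemma split_monic_int (p : {poly int}) (x : C) : p \is monic ->
  root (map_poly intr p) x ->
  exists D (r : 'I_D -> C) s0,
    map_poly intr p = \prod_(s < D) ('X - (r s)%:P) /\ r s0 = x.
Proof.
move=> pm px; have [rs rsE] := closed_field_poly_normal (map_poly intr p : {poly C}).
move: rsE; rewrite lead_coef_map_inj ?rmorph0 //; last exact: intr_inj.
rewrite (monicP pm) scale1r => rsE.
have xr : x \in rs by rewrite -root_prod_XsubC -rsE.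
have ltx : (index x rs < size rs)%N by rewrite index_mem.
exists (size rs), (fun s => rs`_s), (Ordinal ltx); split; last by rewrite nth_index.
by rewrite rsE (big_nth 0) big_mkord.
Qed.

End Generator.

(** * Integer polynomials with a small value *)

Section Dirichlet.
Variable C : numClosedFieldType.

Lemma grid_cell (a : nat -> C) (t : C) L : (0 < L)%N ->
  t \is Num.real -> (forall i, a i \is Num.real) -> a 0%N <= t <= a L ->
  exists c : 'I_L, a c <= t <= a c.+1.
Proof.
move=> L0 rt ra; elim: L L0 => // L IH _ /andP[a0 aL].
have [tL|Lt] := boolP (t <= a L).
  have [L0|L0] := posnP L.
    by exists ord0; rewrite a0 -[X in a X.+1]L0 aL.
  have [|c hc] := IH L0; first by rewrite a0.
  by exists (widen_ord (leqnSn L) c).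
exists ord_max; rewrite aL andbT; apply: ltW.
by rewrite real_ltNge.
Qed.

Lemma normC_Im_le (z : C) : `|'Im z| <= `|z|.
Proof.
rewrite -(@ler_pXn2r _ 2) ?nnegrE // [leRHS]normC2_Re_Im real_normK ?Creal_Im // lerDr.
by rewrite real_exprn_even_ge0 // Creal_Re.
Qed.

Lemma pigeonhole_complex (P : finType) (f : P -> C) (Y : C) L : (0 < L)%N ->
  (L ^ 2 < #|P|)%N -> 0 <= Y -> (forall p, `|f p| <= Y) ->
  exists p p', p != p' /\ `|f p - f p'| <= Y *+ 4 / L%:R.
Proof.
move=> L0 LP Y0 fY; pose a (j : nat) : C := - Y + Y *+ 2 * j%:R / L%:R.
have Ln0 : L%:R != 0 :> C by rewrite pnatr_eq0 -lt0n.
have rY : Y \is Num.real by exact: ger0_real.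
have ra j : a j \is Num.real.
  by apply: rpredD; rewrite ?rpredN //; apply: rpred_div; rewrite ?rpred_nat //; apply: rpredM; rewrite ?rpred_nat ?rpredMn.
have aS j : a j.+1 - a j = Y *+ 2 / L%:R.
  by rewrite /a -natr1; field.
have cell t : t \is Num.real -> `|t| <= Y -> exists c : 'I_L, a c <= t <= a c.+1.
  move=> rt; rewrite real_ler_norml // => /andP[t1 t2].
  apply: grid_cell => //; rewrite /a mulr0 mul0r addr0 t1 mulfK //.
  by rewrite mulr2n addKr.
have /fin_all_exists2 [c cRe cIm] : forall p, exists2 c : 'I_L * 'I_L,
    a c.1 <= 'Re (f p) <= a c.1.+1 & a c.2 <= 'Im (f p) <= a c.2.+1.
  move=> p; have [|c1 h1] := cell ('Re (f p)) (Creal_Re _).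
    by apply: le_trans (fY p); apply: (leif_normC_Re_Creal _).1.
  have [|c2 h2] := cell ('Im (f p)) (Creal_Im _).
    by apply: le_trans (fY p); apply: normC_Im_le.
  by exists (c1, c2).
have /injectivePn[p [p' pp' cc]] : ~~ injectiveb c.
  apply/negP => /injectiveP/leq_card; rewrite card_prod card_ord.
  by rewrite leqNgt mulnn LP.
exists p, p'; split=> //.
have near (x y : C) (k : 'I_L) : x \is Num.real -> y \is Num.real ->
    a k <= x <= a k.+1 -> a k <= y <= a k.+1 -> `|x - y| <= Y *+ 2 / L%:R.
  move=> rx ry /andP[x1 x2] /andP[y1 y2]; rewrite -(aS k).
  by rewrite real_ler_norml ?rpredB // opprB !lerB.
rewrite [f p - f p']Crect raddfB raddfB /=; apply: le_trans (ler_normD _ _) _.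
rewrite normrM normCi mul1r -[4%N]/(2 + 2)%N mulrnDr mulrDl; apply: lerD.
  by apply: (near _ _ (c p).1); rewrite ?Creal_Re // cc.
by apply: (near _ _ (c p).2); rewrite ?Creal_Im // cc.
Qed.

(** Pigeonhole over the polynomials of degree at most s with coefficients
    below h ^ 2: there are h ^ (2 * s + 2) of them, and their values at x lie
    in a square that is cut into h ^ (2 * s) cells. The degree s and the base h
    are then taken large enough to beat any prescribed power of the sup norm. *)
Lemma small_int_poly (x : C) (K E : nat) : (1 < K)%N -> `|x| <= K%:R ->
  exists (q : {poly int}) (X : C), [/\ q != 0, 1 <= X,
    \sum_(i < size q) `|(q`_i)%:~R : C| * K%:R ^+ i <= X &
    2 * `|(map_poly intr q).[x]| * (1 + X) ^+ E <= 1].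
Proof.
move=> K1 xK; pose s := (2 * E.+1).+1; pose B := (s.+1 * K ^ s)%N.
pose h := (16 * 2 ^ E * B ^ E.+1)%N; pose Y := (h ^ 2 * B)%N.
have B0 : (0 < B)%N by rewrite muln_gt0 expn_gt0 (ltnW K1).
have h1 : (1 < h)%N.
  rewrite /h -mulnA; apply: leq_trans (_ : 16 * 1 <= _)%N => //.
  by rewrite leq_mul2l muln_gt0 !expn_gt0 B0.
have h0 : (0 < h)%N by exact: ltnW.
pose val (p : {ffun 'I_s.+1 -> 'I_(h ^ 2)}) := \sum_i (p i)%:R * x ^+ i.
have bnd (u : 'I_s.+1 -> C) : (forall i, `|u i| <= (h ^ 2)%:R) ->
    \sum_i `|u i| * K%:R ^+ i <= Y%:R.
  move=> hu; have -> : Y%:R = \sum_(i < s.+1) (h ^ 2 * K ^ s)%:R :> C.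
    by rewrite sumr_const card_ord /Y /B mulnCA mulnC natrM mulr_natr.
  apply: ler_sum => i _; rewrite natrM ler_pM ?exprn_ge0 //.
  by rewrite natrX; apply: ler_weXn2l; rewrite ?ler1n ?(ltnW K1) // -ltnS.
have bnd' (u : 'I_s.+1 -> C) : (forall i, `|u i| <= (h ^ 2)%:R) ->
    `|\sum_i u i * x ^+ i| <= Y%:R.
  move=> hu; apply: le_trans (bnd u hu); apply: le_trans (ler_norm_sum _ _ _) _.
  apply: ler_sum => i _; rewrite normrM normrX ler_wpM2l //.
  by rewrite lerXn2r ?nnegrE.
have [||||p [p' [pp' hp]]] := @pigeonhole_complex _ val Y%:R (h ^ s)%N.
- by rewrite expn_gt0 h0.
- rewrite card_ffun !card_ord -expnM -expnM ltn_exp2l //.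
  by rewrite mulnC ltn_mul2l /=.
- by [].
- by move=> p; apply: bnd' => i; rewrite normr_nat ler_nat ltnW.
pose q : {poly int} := \poly_(i < s.+1) ((p (inord i) : nat)%:Z - (p' (inord i) : nat)%:Z).
have qE (i : 'I_s.+1) : (q`_i)%:~R = (p i)%:R - (p' i)%:R :> C.
  by rewrite coef_poly ltn_ord inord_val rmorphB.
have qle (i : 'I_s.+1) : `|(q`_i)%:~R : C| <= (h ^ 2)%:R.
  rewrite qE real_ler_norml ?rpredB ?realn //; apply/andP; split.
    rewrite lerNl opprB lerBlDr -natrD ler_nat.
    by rewrite (leq_trans (ltnW (ltn_ord (p' i)))) // leq_addr.
  rewrite lerBlDr -natrD ler_nat.
  by rewrite (leq_trans (ltnW (ltn_ord (p i)))) // leq_addr.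
exists q, Y%:R; split.
- apply: contraNneq pp' => q0; apply/eqP/ffunP => i; apply: val_inj.
  have := qE i; rewrite q0 coef0 /= => /esym/eqP; rewrite subr_eq0 eqr_nat.
  by move/eqP.
- by rewrite ler1n muln_gt0 expn_gt0 h0.
- apply: le_trans (bnd _ qle).
  rewrite [leRHS](_ : _ = \sum_(i < s.+1 | (i < size q)%N) `|(q`_i)%:~R : C| * K%:R ^+ i).
    by rewrite -(big_ord_widen _ (fun i => `|(q`_i)%:~R : C| * K%:R ^+ i)) // size_poly.
  rewrite [RHS]big_mkcond; apply: eq_bigr => i _; case: ltnP => // /(nth_default 0) ->.
  by rewrite normr0 mul0r.
- have -> : (map_poly intr q).[x] = val p - val p'.
    rewrite (@horner_coef_wide _ s.+1); last first.
      by apply: leq_trans (size_poly _ _) _; rewrite size_poly.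
    by rewrite -sumrB; apply: eq_bigr => i _; rewrite coef_map /= qE mulrBl.
  have Y1 : (1 + Y <= 2 * Y)%N.
    by rewrite mul2n -addnn leq_add2r muln_gt0 expn_gt0 h0.
  apply: (@le_trans _ _ (2 * (Y%:R *+ 4 / (h ^ s)%:R) * ((2 * Y) ^ E)%:R)).
    rewrite ler_pM ?mulr_ge0 ?exprn_ge0 ?addr_ge0 //.
      by rewrite ler_wpM2l.
    have -> : (1 + Y%:R) ^+ E = ((1 + Y) ^ E)%:R :> C by rewrite natrX natrD.
    by rewrite ler_nat; have [->|E0] := posnP E; rewrite ?expn0 ?leq_exp2r.
  have -> : Y%:R *+ 4 = (Y * 4)%:R :> C by rewrite natrM mulr_natr.
  rewrite mulrA mulrAC ler_pdivrMr ?mul1r ?ltr0n ?expn_gt0 ?h0 //.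
  rewrite -!natrM ler_nat.
  rewrite (_ : (2 * (Y * 4) * (2 * Y) ^ E = (8 * 2 ^ E * B ^ E.+1) * h ^ (2 * E.+1))%N).
    rewrite (expnS h (2 * E.+1)) leq_mul2r; apply/orP; right.
    by rewrite /h leq_mul2r leq_mul2r /= !orbT.
  rewrite [(h ^ (2 * _))%N]expnM.
  (* Y = h ^ 2 * B, and the powers of h on the two sides cancel by the choice of s. *)
  have regroup (a b : nat) :
      (2 * (a * b * 4) * (2 * (a * b)) ^ E = 8 * 2 ^ E * b ^ E.+1 * a ^ E.+1)%N.
    rewrite !expnMn !expnS.
    by move: (2 ^ E)%N (a ^ E)%N (b ^ E)%N => u v w; ring.
  exact: regroup.
Qed.

End Dirichlet.

(** * Sums of tensor products with permutation matrices *)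

Section KronSum.

Definition kron_sum (R : comNzRingType) n m (J : finType) (c : J -> 'M[R]_n)
    (sg : J -> 'S_m) : 'M[R]_(\sum_(i < n) m) :=
  \sum_b kron_perm (c b) (sg b).

Lemma eq_kron_sum (R : comNzRingType) n m (J : finType) (c c' : J -> 'M[R]_n)
  (sg : J -> 'S_m) : c =1 c' -> kron_sum c sg = kron_sum c' sg.
Proof. by move=> cc'; apply: eq_bigr => b _; rewrite cc'. Qed.

Lemma map_kron_sum (R S : comNzRingType) (f : {rmorphism R -> S}) n m (J : finType)
  (c : J -> 'M[R]_n) (sg : J -> 'S_m) :
  map_mx f (kron_sum c sg) = kron_sum (fun b => map_mx f (c b)) sg.
Proof. by rewrite raddf_sum /=; apply: eq_bigr => b _; rewrite map_kron_perm. Qed.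

Lemma kron_sumZ (R : comNzRingType) n m (J : finType) x (c : J -> 'M[R]_n)
  (sg : J -> 'S_m) : kron_sum (fun b => x *: c b) sg = x *: kron_sum c sg.
Proof. by rewrite scaler_sumr; apply: eq_bigr => b _; rewrite kron_permZ. Qed.

Lemma kron_sum_tr (R : comNzRingType) n m (J : finType) (c : J -> 'M[R]_n)
  (sg : J -> 'S_m) : (kron_sum c sg)^T = kron_sum (fun b => (c b)^T) (fun b => (sg b)^-1)%g.
Proof. by rewrite raddf_sum /=; apply: eq_bigr => b _; rewrite kron_perm_tr. Qed.

(** Bounds the row sums of [kron_sum c sg], independently of the size m and of
    the permutations. *)
Definition coef_norm (C : numClosedFieldType) n (J : finType) (c : J -> 'M[C]_n) : C :=
  \sum_b \sum_i \sum_j `|c b i j|.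

Lemma coef_norm_ge0 (C : numClosedFieldType) n (J : finType) (c : J -> 'M[C]_n) :
  0 <= coef_norm c.
Proof. by do 3!(apply: sumr_ge0 => ? _). Qed.

Lemma rowsum_kron_sum (C : numClosedFieldType) n m (J : finType) (c : J -> 'M[C]_n)
  (sg : J -> 'S_m) : rowsum_le (kron_sum c sg) (coef_norm c).
Proof. by apply: rowsum_le_sum => b; apply: rowsum_kron_perm. Qed.

Lemma coef_norm_adj (C : numClosedFieldType) n (J : finType) (c : J -> 'M[C]_n) :
  coef_norm (fun b => (c b)^t*) = coef_norm c.
Proof.
apply: eq_bigr => b _; rewrite exchange_big; apply: eq_bigr => i _.
by apply: eq_bigr => j _; rewrite !mxE norm_conjC.
Qed.

Lemma kron_sum_adj (C : numClosedFieldType) n m (J : finType) (c : J -> 'M[C]_n)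
  (sg : J -> 'S_m) : (kron_sum c sg)^t* = kron_sum (fun b => (c b)^t*) (fun b => (sg b)^-1)%g.
Proof. by rewrite kron_sum_tr map_kron_sum. Qed.

End KronSum.

(** * Few small eigenvalues: the algebraic case *)

Section Counting.
Variable C : numClosedFieldType.

Lemma prod_norm_le_small N (e : 'I_N -> C) (P S : pred 'I_N) a B :
  (forall i, S i -> P i) -> 0 <= a -> 1 <= B ->
  (forall i, S i -> `|e i| <= a) -> (forall i, P i -> `|e i| <= B) ->
  \prod_(i | P i) `|e i| <= a ^+ #|[pred i | S i]| * B ^+ N.
Proof.
move=> SP a0 B1 Sa PB; rewrite (bigID S) /=; apply: ler_pM.
- by apply: prodr_ge0.
- by apply: prodr_ge0.
- rewrite -prodr_const; rewrite (eq_bigl S) => [|i]; last first.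
    by rewrite andbC; case Si : (S i) => //=; rewrite SP.
  by apply: ler_prod => i Si; rewrite normr_ge0 Sa.
- apply: (@le_trans _ _ (\prod_(i | P i && ~~ S i) B)).
    by apply: ler_prod => i /andP[Pi _]; rewrite normr_ge0 PB.
  rewrite prodr_const; apply: ler_weXn2l => //.
  by rewrite -[leqRHS]card_ord max_card.
Qed.

Lemma algebraic_conj (x : C) : algebraicOver (ratr : rat -> C) x ->
  algebraicOver (ratr : rat -> C) x^*.
Proof.
move=> [p p0 px]; exists p => //.
pose conj : {rmorphism C -> C} := Num.conj.
have <- : map_poly conj (map_poly ratr p) = map_poly ratr p.
  by apply/polyP => i; rewrite !coef_map; apply: (fmorph_eq_rat (conj \o ratr)).
by rewrite fmorph_root.
Qed.

(** A common presentation of the entries of c and of their complex conjugates: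
    the latter are needed to express the adjoint. *)
Lemma coef_generator n (J : finType) (c : J -> 'M[C]_n) :
  (forall b i j, algebraicOver (ratr : rat -> C) (c b i j)) ->
  exists (p : {poly int}) D (r : 'I_D -> C) s0 (d : nat)
    (F F' : J -> 'M[{poly int}]_n),
  [/\ p \is monic, map_poly intr p = \prod_(s < D) ('X - (r s)%:P), (0 < d)%N,
   forall b, map_mx (int_eval (r s0)) (F b) = d%:R *: c b &
   forall b, map_mx (int_eval (r s0)) (F' b) = d%:R *: (c b)^t*].
Proof.
move=> alg; pose T := (J * ('I_n * 'I_n))%type.
pose xs := [seq c x.1 x.2.1 x.2.2 | x : T] ++ [seq (c x.1 x.2.1 x.2.2)^* | x : T].
have algxs : {in xs, forall x, algebraicOver (ratr : rat -> C) x}.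
  move=> x; rewrite mem_cat => /orP[] /fintype.imageP[[b [i j]] _ ->]; first exact: alg.
  exact/algebraic_conj/alg.
have [p [eta [d [pm peta d0 gen]]]] := integral_generator algxs.
have [D [r [s0 [pr rs0]]]] := split_monic_int pm peta.
have /fin_all_exists[F hF] : forall x : T, exists f, d%:R * c x.1 x.2.1 x.2.2 = int_eval eta f.
  move=> x; apply: gen; rewrite mem_cat; apply/orP; left.
  by apply/fintype.imageP; exists x.
have /fin_all_exists[F' hF'] : forall x : T, exists f, d%:R * (c x.1 x.2.1 x.2.2)^* = int_eval eta f.
  move=> x; apply: gen; rewrite mem_cat; apply/orP; right.
  by apply/fintype.imageP; exists x.
exists p, D, r, s0, d, (fun b => \matrix_(i, j) F (b, (i, j))),
  (fun b => \matrix_(i, j) F' (b, (j, i))).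
split=> // b; apply/matrixP => i j; rewrite mxE rs0 mxE.
  by rewrite -hF mxE.
by rewrite -hF' !mxE.
Qed.

(** Lueck's argument: up to an integer factor, [M^* M] is the value at an algebraic
    integer of a matrix over Z[x], so the product of its nonzero eigenvalues is
    bounded below exponentially in its size. *)
Lemma few_small_eigenvalues_algebraic n (J : finType) (c : J -> 'M[C]_n) :
  (forall b i j, algebraicOver (ratr : rat -> C) (c b i j)) ->
  exists E : nat, forall t : nat, exists2 delta : C, 0 < delta &
    forall m (sg : J -> 'S_m) P d, let M := kron_sum c sg in
      diagonalizes P d (M^t* *m M) -> (forall i, 0 <= d 0 i) ->
      (t * #|[pred i | (0 < d 0 i <= delta)%R]| <= E * m)%N.
Proof.
move=> alg; have [p [D [r [s0 [dn [F [F' [pm pr dn0 FE F'E]]]]]]]] := coef_generator alg.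
exists (n * D.+1)%N => t.
pose kF s := coef_norm (fun b => map_mx (int_eval (r s)) (F b)).
pose kF' s := coef_norm (fun b => map_mx (int_eval (r s)) (F' b)).
pose K : C := 1 + \sum_s kF' s * kF s.
have K1 : 1 <= K.
  by rewrite lerDl; apply: sumr_ge0 => s _; apply: mulr_ge0; apply: coef_norm_ge0.
have K0 : 0 <= K by exact: le_trans K1.
have K2 : 1 < 1 + K by rewrite ltrDl (lt_le_trans ltr01).
have K20 : 0 < 1 + K by exact: lt_trans ltr01 K2.
have dnC : 0 < dn%:R ^+ 2 :> C by rewrite exprn_gt0 ?ltr0n.
exists ((1 + K) ^+ t * dn%:R ^+ 2)^-1; first by rewrite invr_gt0; apply: mulr_gt0; rewrite ?exprn_gt0 ?ltr0n.
move=> m sg P d M dM d0.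
set N := (\sum_(i < n) m)%N in P d M dM d0 *.
(* At eta = r s0, the matrix Q specializes to dn ^ 2 times M^* M. *)
pose Q := kron_sum F' (fun b => (sg b)^-1)%g *m kron_sum F sg.
have QE s : map_mx (int_eval (r s)) Q =
   kron_sum (fun b => map_mx (int_eval (r s)) (F' b)) (fun b => (sg b)^-1)%g *m
   kron_sum (fun b => map_mx (int_eval (r s)) (F b)) sg.
  by rewrite map_mxM !map_kron_sum.
have Qs0 : map_mx (int_eval (r s0)) Q = dn%:R ^+ 2 *: (M^t* *m M).
  rewrite QE (eq_kron_sum _ F'E) (eq_kron_sum _ FE) !kron_sumZ.
  rewrite -scalemxAl -scalemxAr scalerA.
  by rewrite /M kron_sum_adj.
have rQ s : rowsum_le (map_mx (int_eval (r s)) Q) K.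
  rewrite QE; apply: (@rowsum_le_trans _ _ _ _ (kF' s * kF s)).
    rewrite /K (bigD1 s) //= addrCA lerDl addr_ge0 // sumr_ge0 // => i _.
    by apply: mulr_ge0; apply: coef_norm_ge0.
  by apply: rowsum_leM; [exact: coef_norm_ge0|exact: rowsum_kron_sum|exact: rowsum_kron_sum].
pose e i := dn%:R ^+ 2 * d 0 i.
have dQ : diagonalizes P (\row_i e i) (map_mx (int_eval (r s0)) Q).
  split; first exact: dM.1.
  rewrite Qs0 dM.2 (_ : diag_mx (\row_i e i) = dn%:R ^+ 2 *: diag_mx d); last first.
    by apply/matrixP => i j; rewrite !mxE mulrnAr.
  by rewrite -scalemxAr -scalemxAl.
have e0 i : 0 <= e i by rewrite mulr_ge0 // ltW.
have eK i : `|e i| <= 1 + K.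
  rewrite ger0_norm // (le_trans (_ : _ <= K)) ?lerDr ?ler01 //.
  by have := diagonalizes_le i dQ (rQ s0); rewrite mxE; apply=> j; rewrite mxE.
have chQ : char_poly (map_mx (int_eval (r s0)) Q) = \prod_(i < N) ('X - (e i)%:P).
  by rewrite (diagonalizes_char_poly dQ); apply: eq_bigr => i _; rewrite mxE.
have := prod_eigenvalues_ge pm pr K0 rQ chQ.
set S := [pred i | (0 < d 0 i <= _)%R] => low.
have Snz i : S i -> e i != 0.
  by case/andP => di _; rewrite mulf_neq0 ?gt_eqF.
have Se i : S i -> `|e i| <= ((1 + K) ^+ t)^-1.
  case/andP => di; rewrite invfM ler_pdivlMr // => h.
  by rewrite ger0_norm // /e mulrC.
have up : \prod_(i < N | e i != 0) `|e i| <=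
    ((1 + K) ^+ t)^-1 ^+ #|[pred i | S i]| * (1 + K) ^+ N.
  apply: (@prod_norm_le_small _ _ (fun i => e i != 0) S) => //; last exact: ltW.
  by rewrite invr_ge0 exprn_ge0 // ltW.
have : (1 + K) ^+ (t * #|[pred i | S i]|) <= (1 + K) ^+ (N * D.+1).
  have pos : 0 < ((1 + K) ^+ t) ^+ #|[pred i | S i]| by rewrite !exprn_gt0.
  rewrite exprM -[leLHS]mulr1; apply: le_trans (ler_wpM2l (ltW pos) low) _.
  apply: le_trans (ler_wpM2l (ltW pos) (ler_wpM2r _ up)) _.
    by rewrite exprn_ge0 // ltW.
  by rewrite !mulrA exprVn divff ?gt_eqF // mul1r -exprD mulnS.
have NE : N = (n * m)%N by rewrite /N sum_nat_const card_ord.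
rewrite ler_eXn2l // => h; apply: leq_trans h _.
by rewrite [X in (X * _)%N]NE mulnAC.
Qed.

End Counting.

(** * Few small eigenvalues: the transcendental case *)

Section Transcendental.
Variable C : numClosedFieldType.

Lemma horner_norm_le (g : {poly C}) (z : C) K : `|z| <= K ->
  `|g.[z]| <= \sum_(i < size g) `|g`_i| * K ^+ i.
Proof.
move=> zK; rewrite horner_coef; apply: le_trans (ler_norm_sum _ _ _) _.
apply: ler_sum => i _; rewrite normrM normrX ler_wpM2l //.
by rewrite lerXn2r ?nnegrE // (le_trans _ zK).
Qed.

Lemma poly_near (q : {poly C}) (x K : C) : 0 <= K -> q.[x] != 0 ->
  exists2 rho, 0 < rho <= 1 & forall z, `|z| <= K -> `|x - z| < rho ->
    q.[z] != 0 /\ `|q.[z]| <= 2 * `|q.[x]|.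
Proof.
move=> K0 qx0.
have /factor_theorem[g gE] : root (q - q.[x]%:P) x by rewrite rootE !hornerE subrr.
pose G := \sum_(i < size g) `|g`_i| * K ^+ i.
have G0 : 0 <= G by apply: sumr_ge0 => i _; rewrite mulr_ge0 ?exprn_ge0.
have q0 : 0 < `|q.[x]| by rewrite normr_gt0.
have den : 0 < `|q.[x]| + G + 1 by rewrite ltr_wpDl ?addr_ge0.
exists (`|q.[x]| / (`|q.[x]| + G + 1)).
  by rewrite divr_gt0 //= ler_pdivrMr // mul1r -addrA lerDl addr_ge0.
move=> z zK zx.
have diff : `|q.[z] - q.[x]| < `|q.[x]|.
  have -> : q.[z] - q.[x] = g.[z] * (z - x).
    have := congr1 (fun h => h.[z]) gE; rewrite /= hornerM hornerXsubC => <-.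
    by rewrite hornerD hornerN hornerC.
  rewrite normrM distrC -[z]opprK -[- - z]opprK.
  have gG : `|g.[z]| <= G by exact: horner_norm_le.
  rewrite !opprK distrC.
  apply: (@le_lt_trans _ _ (G * (`|q.[x]| / (`|q.[x]| + G + 1)))).
    by apply: ler_pM => //; rewrite distrC ltW.
  rewrite mulrA ltr_pdivrMr // mulrC ltr_pM2l // -addrA addrC -addrA ltrDl.
  by rewrite addr_gt0.
split.
  by apply: contraTneq diff => ->; rewrite sub0r normrN ltxx.
rewrite mulr_natl mulr2n -[q.[z]](subrK q.[x]); apply: le_trans (ler_normD _ _) _.
by rewrite lerD2r ltW.
Qed.

(** Eigenvalues close to x make the value of q small; since the product of the
    nonzero values of q at the eigenvalues is bounded below exponentially,
    there can only be few of them when q(x) is small enough. *)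
Lemma few_near_eigenvalues (p : {poly int}) D (r : 'I_D -> C) s0 (x : C) (K t : nat) :
  p \is monic -> map_poly intr p = \prod_(s < D) ('X - (r s)%:P) ->
  (forall q : {poly int}, q != 0 -> (map_poly intr q).[x] != 0) ->
  (1 < K)%N -> `|x| <= K%:R ->
  exists2 rho, 0 < rho <= 1 &
   forall N (Q : 'M[{poly int}]_N) (P T : 'M[C]_N), P \is unitarymx ->
    is_trig_mx T -> map_mx (int_eval (r s0)) Q = invmx P *m T *m P ->
    (forall s, rowsum_le (map_mx (int_eval (r s)) Q) K%:R) ->
    (t * #|[pred i | (`|x - T i i| < rho)%R]| <= N)%N.
Proof.
move=> pm pr xt K1 xK.
have [q [X [q0 X1 qX small]]] := small_int_poly (D.+1 * t) K1 xK.
pose qC := map_poly intr q : {poly C}.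
have [rho rho01 near] := poly_near (ler0n _ K) (xt q q0).
exists rho => // N Q P T uP tT eQ rQ.
have X0 : 0 <= X by exact: le_trans X1.
have Tle i : `|T i i| <= K%:R.
  apply: eigenvalue_rowsum_le (rQ s0) _.
  rewrite -(polymxX (map_mx _ Q)) (char_poly_polymx_trig _ uP tT eQ) (bigD1 i) //=.
  by rewrite rootM hornerX root_XsubC eqxx.
pose qQ := polymx Q (map_poly polyC q).
have qQE s : map_mx (int_eval (r s)) qQ = polymx (map_mx (int_eval (r s)) Q) qC.
  rewrite map_polymx; congr (polymx _ _); rewrite -map_poly_comp.
  by apply: eq_map_poly => z /=; rewrite map_polyC /horner_eval hornerC.
have szq : size qC = size q by rewrite size_map_inj_poly //; exact: intr_inj.
have coefq : \sum_(i < size qC) `|qC`_i| * K%:R ^+ i <= X.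
  by rewrite szq; under eq_bigr do rewrite coef_map.
have rqQ s : rowsum_le (map_mx (int_eval (r s)) qQ) X.
  rewrite qQE; apply: rowsum_le_trans coefq _.
  exact: rowsum_le_polymx.
have chq : char_poly (map_mx (int_eval (r s0)) qQ) =
    \prod_(i < N) ('X - (qC.[T i i])%:P).
  by rewrite qQE (char_poly_polymx_trig _ uP tT eQ).
have low := prod_eigenvalues_ge pm pr X0 rqQ chq.
set S := [pred i | _].
have nearS i : S i -> qC.[T i i] != 0 /\ `|qC.[T i i]| <= 2 * `|qC.[x]|.
  by move=> Si; apply: near.
have up : \prod_(i < N | qC.[T i i] != 0) `|qC.[T i i]| <=
    (2 * `|qC.[x]|) ^+ #|[pred i | S i]| * (1 + X) ^+ N.
  apply: (@prod_norm_le_small _ _ _ (fun i => qC.[T i i] != 0) S) => [i /nearS[]//||||].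
  - by rewrite mulr_ge0.
  - by rewrite lerDl.
  - by move=> i /nearS[].
  - move=> i _; apply: le_trans (horner_norm_le _ (Tle i)) _.
    by rewrite (le_trans coefq) // lerDr.
have X2 : 1 < 1 + X by rewrite ltrDl (lt_le_trans ltr01).
have X20 : 0 < 1 + X by rewrite (lt_trans ltr01).
set k := #|S|.
have kE : #|[pred i | S i]| = k by [].
have : (1 + X) ^+ (D.+1 * t * k) <= (1 + X) ^+ (N * D.+1).
  have pos : 0 < ((1 + X) ^+ (D.+1 * t)) ^+ k by rewrite !exprn_gt0.
  rewrite exprM -[leLHS]mulr1; apply: le_trans (ler_wpM2l (ltW pos) low) _.
  apply: le_trans (ler_wpM2l (ltW pos) (ler_wpM2r _ up)) _.
    by rewrite exprn_ge0 // ltW.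
  rewrite kE !mulrA -exprMn -mulrA -exprD -mulnS -[leRHS]mul1r.
  apply: ler_pM; rewrite ?exprn_ge0 ?mulr_ge0 ?exprn_ge0 ?(ltW X20) //.
  by rewrite exprn_ile1 ?mulr_ge0 ?exprn_ge0 ?(ltW X20) // mulrC.
rewrite ler_eXn2l // => h.
by rewrite -(@leq_pmul2l D.+1) // mulnA [leqRHS]mulnC.
Qed.

Lemma nrm2_diag_le N (y f : 'rV[C]_N) L : (forall i, `|f 0 i| ^+ 2 <= L) ->
  nrm2 (y *m (diag_mx f)^t*) <= L * nrm2 y.
Proof.
move=> fL; rewrite /nrm2 mulr_sumr; apply: ler_sum => i _.
rewrite tr_diag_mx map_diag_mx mul_mx_diag !mxE normrM exprMn norm_conjC mulrC.
by rewrite ler_wpM2r ?exprn_ge0.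
Qed.

Lemma diagonalizes_le_nrm2 N (P : 'M[C]_N) d (M : 'M[C]_N) L :
  diagonalizes P d (M^t* *m M) ->
  (forall y, nrm2 (y *m M^t*) <= L * nrm2 y) -> forall i, d 0 i <= L.
Proof.
move=> dM ML i; have := ML (row i P).
have rowP : row i P *m P^t* = row i 1%:M by rewrite -row_mul (unitarymxP dM.1).
rewrite (diag_quadratic _ dM) -(nrm2_unitary _ dM.1) rowP /nrm2.
rewrite (bigD1 i) //= big1 => [|j ji]; last first.
  by rewrite !mxE eq_sym (negPf ji) normr0 expr0n mulr0.
rewrite [in leRHS](bigD1 i) //= [in leRHS]big1 => [|j ji]; last first.
  by rewrite !mxE eq_sym (negPf ji) normr0 expr0n.
by rewrite !mxE eqxx normr1 expr1n !mulr1 !addr0 mulr1.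
Qed.

(** Raising the diagonal entries of x - T that are smaller than rho to 1 costs
    a perturbation of small rank, and gives a matrix with large determinant,
    hence with few small singular values. *)
Lemma few_small_gram N (T P : 'M[C]_N) d (x rho L : C) (t : nat) :
  let M := x%:M - T in
  is_trig_mx T -> 0 < rho <= 1 -> diagonalizes P d (M^t* *m M) ->
  (forall i, 0 <= d 0 i <= L) -> 0 <= L ->
  (t * #|[pred i | (d 0 i <= (rho ^+ 2 / (L *+ 2 + 8)) ^+ t)%R]| <=
     N + t * #|[pred i | (`|x - T i i| < rho)%R]|)%N.
Proof.
move=> M tT /andP[rho0 rho1] dM dL L0.
set K := L *+ 2 + 8; set ro := rho ^+ 2 / K; set delta := ro ^+ t.
have K1 : 1 < K by rewrite (@lt_le_trans _ _ 8) ?ltr1n // lerDr mulrn_wge0.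
have K0 : 0 < K by exact: lt_trans K1.
have ro0 : 0 < ro by rewrite divr_gt0 ?exprn_gt0.
have ro1 : ro < 1.
  by rewrite ltr_pdivrMr // mul1r (le_lt_trans _ K1) // exprn_ile1 // ltW.
have delta0 : 0 <= delta by rewrite exprn_ge0 // ltW.
pose f := \row_i (if `|x - T i i| < rho then 1 - (x - T i i) else 0) : 'rV[C]_N.
have [P' [d' [dB d'0]]] := diagonalize_gram (M + diag_mx f).
have d0 i : 0 <= d 0 i by case/andP: (dL i).
have := count_small_perturb dM d0 dB d'0 delta0.
set k := #|[pred i | (d 0 i <= delta)%R]|; set k' := #|_|; set k'' := #|_|.
move=> kk; have k''le : (k'' <= #|[pred i | (`|x - T i i| < rho)%R]|)%N.
  apply: subset_leq_card; apply/fintype.subsetP => i; rewrite !inE mxE.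
  by case: ifP => //; rewrite eqxx.
have fle i : `|f 0 i| ^+ 2 <= 4.
  have -> : 4 = 2 ^+ 2 :> C by rewrite -natrX.
  rewrite lerXn2r ?nnegrE // mxE; case: ifP => h; last by rewrite normr0.
  rewrite (le_trans (ler_normB _ _)) // normr1 -[2]/(1 + 1) lerD2l.
  by rewrite (le_trans (ltW h)).
have d'K i : d' 0 i <= K.
  apply: (diagonalizes_le_nrm2 dB) => y; rewrite linearD /= map_mxD mulmxDr.
  apply: le_trans (nrm2D_le _ _) _; rewrite /K mulrDl; apply: lerD.
    rewrite mulrnAl lerMn2r /= (diag_quadratic _ dM) -(nrm2_unitary y dM.1) /nrm2 mulr_sumr.
    by apply: ler_sum => i' _; rewrite ler_wpM2r ?exprn_ge0 //; case/andP: (dL i').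
  have -> : 8 = 4 *+ 2 :> C by rewrite -mulrnA.
  by rewrite mulrnAl lerMn2r /= nrm2_diag_le.
have tB : is_trig_mx (M + diag_mx f).
  apply/is_trig_mxP => i j ij; rewrite !mxE; move/is_trig_mxP: tT => ->//.
  by rewrite (negPf (_ : i != j)) ?mulr0n ?subrr ?addr0 // neq_ltn ij.
have Bii i : rho <= `|(M + diag_mx f) i i|.
  rewrite !mxE eqxx !mulr1n; have [h|h] := boolP (`|_| < rho).
    by rewrite addrC subrK normr1.
  by rewrite addr0 real_leNgt ?normr_real //; apply: gtr0_real.
have detB : rho ^+ 2 ^+ N <= \prod_(i < N) `|d' 0 i|.
  have -> : \prod_(i < N) `|d' 0 i| = `|\det (M + diag_mx f)| ^+ 2.
    rewrite -normr_prod -(diagonalizes_det dB) det_mulmx normrM expr2.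
    by rewrite det_map_mx det_tr norm_conjC.
  rewrite (det_trig tB) normr_prod -exprM mulnC exprM lerXn2r ?nnegrE ?prodr_ge0 //.
    by rewrite exprn_ge0 // ltW.
  rewrite -[X in _ ^+ X]card_ord -prodr_const; apply: ler_prod => i _.
  by rewrite Bii ltW.
have up : \prod_(i < N) `|d' 0 i| <= delta ^+ k' * K ^+ N.
  apply: (@prod_norm_le_small _ _ (fun i => d' 0 i) xpredT (fun i => d' 0 i <= delta)) => //.
  - exact: ltW.
  - by move=> i di; rewrite ger0_norm.
  - by move=> i _; rewrite ger0_norm.
have : ro ^+ N <= ro ^+ (t * k').
  rewrite exprM exprMn exprVn ler_pdivrMr ?exprn_gt0 //.
  exact: le_trans detB up.
rewrite ler_iXn2l // => tk'.
apply: leq_trans (leq_mul (leqnn t) kk) _; rewrite mulnDr leq_add //.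
by rewrite leq_mul2l k''le orbT.
Qed.

(** Both losses, the rank of the perturbation and the small singular values of
    the perturbed matrix, cost at most a t-th part of the size. *)
Lemma few_small_eigenvalues_transcendental n (J : finType) (c : J -> 'M[C]_n) (x : C) :
  (forall z : C, exists k : nat, `|z| <= k%:R) ->
  (forall b i j, algebraicOver (ratr : rat -> C) (c b i j)) ->
  ~ algebraicOver (ratr : rat -> C) x ->
  forall t : nat, exists2 delta : C, 0 < delta &
    forall m (sg : J -> 'S_m) P d, let M := x%:M - kron_sum c sg in
      diagonalizes P d (M^t* *m M) -> (forall i, 0 <= d 0 i) ->
      (t * #|[pred i | (d 0 i <= delta)%R]| <= 2 * n * m)%N.
Proof.
move=> arch alg xt t.
have [p [D [r [s0 [dn [F [_ [pm pr dn0 FE _]]]]]]]] := coef_generator alg.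
have dnC0 : dn%:R != 0 :> C by rewrite pnatr_eq0 -lt0n.
pose kF s := coef_norm (fun b => map_mx (int_eval (r s)) (F b)).
have kF0 s : 0 <= kF s by apply: coef_norm_ge0.
have [k0 k0E] := arch (\sum_s kF s + `|dn%:R * x|).
have s0' : 0 <= \sum_s kF s by apply: sumr_ge0.
rewrite ger0_norm ?addr_ge0 // in k0E.
pose K := k0.+2.
have k0K : k0%:R <= K%:R :> C by rewrite ler_nat /K -addn2 leq_addr.
have kFK s : kF s <= K%:R.
  apply: le_trans k0K; apply: le_trans k0E; rewrite (bigD1 s) //= -addrA lerDl.
  by rewrite addr_ge0 // sumr_ge0.
have xK : `|dn%:R * x| <= K%:R.
  by apply: le_trans k0K; apply: le_trans k0E; rewrite lerDr.
have xt' (q : {poly int}) : q != 0 -> (map_poly intr q).[dn%:R * x] != 0.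
  move=> q0; apply/eqP => qx; apply: xt.
  have -> : x = dn%:R * x / ratr dn%:R.
    by rewrite rmorph_nat mulrAC divff ?mul1r.
  apply: algebraic_div; last exact: algebraic_id.
  exists (map_poly intr q); first by rewrite map_poly_eq0_id0 // intr_eq0 lead_coef_eq0.
  rewrite -map_poly_comp (eq_map_poly (g := intr)) ?rootE ?qx // => z /=.
  by rewrite ratr_int.
have [rho rho01 near] := few_near_eigenvalues s0 t pm pr xt' (isT : (1 < K)%N) xK.
pose L0 := (`|x| + coef_norm c) * (`|x| + coef_norm c).
pose L := dn%:R ^+ 2 * L0.
have L0ge : 0 <= L0 by rewrite mulr_ge0 ?addr_ge0 ?coef_norm_ge0.
have Lge : 0 <= L by rewrite mulr_ge0 ?exprn_ge0.
have dn2 : 0 < dn%:R ^+ 2 :> C by rewrite exprn_gt0 ?ltr0n.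
have [rho0 rho1] := andP rho01.
exists ((rho ^+ 2 / (L *+ 2 + 8)) ^+ t / dn%:R ^+ 2).
  by rewrite divr_gt0 // exprn_gt0 // divr_gt0 ?exprn_gt0 // ltr_wpDl ?mulrn_wge0.
move=> m sg P d M dM d0.
have NE : (\sum_(i < n) m = n * m)%N by rewrite sum_nat_const card_ord.
pose Q := kron_sum F sg.
have QE : map_mx (int_eval (r s0)) Q = dn%:R *: kron_sum c sg.
  by rewrite map_kron_sum (eq_kron_sum _ FE) kron_sumZ.
have rQ s : rowsum_le (map_mx (int_eval (r s)) Q) K%:R.
  by rewrite map_kron_sum; apply: rowsum_le_trans (kFK s) _; apply: rowsum_kron_sum.
have [P1 [T [uP1 tT eT]]] := Schur_trig (map_mx (int_eval (r s0)) Q).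
have nr := near _ Q P1 T uP1 tT eT rQ.
have dL i : 0 <= d 0 i <= L0.
  rewrite d0 /=; apply: diagonalizes_le dM _ d0.
  have rM y : rowsum_le (y%:M : 'M[C]_(\sum_(i < n) m)) `|y|.
    by rewrite -[X in rowsum_le _ X]mulr1 -scalemx1; apply: rowsum_leZ; apply: rowsum_le1.
  have rk (c' : J -> 'M[C]_n) sg' y :
      rowsum_le (y%:M - kron_sum c' sg' : 'M[C]_(\sum_(i < n) m)) (`|y| + coef_norm c').
    apply: rowsum_leD => //; rewrite -scaleN1r -[coef_norm _]mul1r.
    by have := rowsum_leZ (-1) (rowsum_kron_sum c' sg'); rewrite normrN1.
  apply: rowsum_leM; rewrite ?addr_ge0 ?coef_norm_ge0 //; last exact: rk.
  rewrite linearB /= map_mxB tr_scalar_mx map_scalar_mx.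
  rewrite [X in _ - X](kron_sum_adj c sg) -(coef_norm_adj c) -(norm_conjC x).
  exact: rk.
pose M' := (dn%:R * x)%:M - T.
have M'E : M' = dn%:R *: (P1 *m M *m P1^t*).
  have uP1' := unitarymx_unit uP1.
  rewrite -(invmx_unitary uP1) /M mulmxBr mulmxBl mul_mx_scalar -scalemxAl mulmxV //.
  rewrite scalerBr scalemx1 scale_scalar_mx; congr (_ - _).
  rewrite scalemxAl scalemxAr -QE eT !mulmxA mulmxV // mul1mx mulmxK //.
have dM' : diagonalizes (P *m P1^t*) (dn%:R ^+ 2 *: d) (M'^t* *m M').
  split; first by rewrite mul_unitarymx ?trmxC_unitary // dM.1.
  rewrite M'E adjZ rmorph_nat -scalemxAl -scalemxAr scalerA.
  rewrite !adjM trmxCK -!mulmxA [P1^t* *m (P1 *m _)]mulmxA.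
  have -> : P1^t* *m P1 = 1%:M by rewrite -(invmx_unitary uP1) mulVmx ?unitarymx_unit.
  rewrite mul1mx [M^t* *m (M *m _)]mulmxA dM.2.
  have -> : diag_mx (dn%:R ^+ 2 *: d) = dn%:R ^+ 2 *: diag_mx d by rewrite linearZ.
  by rewrite -expr2 -!scalemxAl -!scalemxAr -?scalemxAl !mulmxA.
have dL' i : 0 <= (dn%:R ^+ 2 *: d) 0 i <= L.
  by rewrite mxE; case/andP: (dL i) => d1 d2; rewrite mulr_ge0 ?(ltW dn2) //= ler_wpM2l // ltW.
have := few_small_gram t tT rho01 dM' dL' Lge.
set delta := _ ^+ t.
rewrite (eq_card (B := [pred i | (d 0 i <= delta / dn%:R ^+ 2)%R])); last first.
  by move=> i; rewrite !inE mxE ler_pdivlMr // mulrC.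
move=> h; apply: leq_trans h _.
by rewrite -mulnA mul2n -addnn -[X in (_ <= X + X)%N]NE leq_add2l.
Qed.

End Transcendental.

(** * Ranks and kernels *)

Section Rank.
Variable F : fieldType.

Lemma dim_lker_mulmx N (M : 'M[F]_N) :
  \dim (lker (linfun (mulmx M : 'cV[F]_N -> 'cV[F]_N))) = (N - \rank M)%N.
Proof.
set f := linfun _; set s := (N - \rank M)%N.
have sE : \rank (kermx M^T) = s by rewrite mxrank_ker mxrank_tr.
pose B : 'M[F]_(s, N) := castmx (sE, erefl) (row_base (kermx M^T)).
have freeB : row_free B by rewrite /B row_free_castmx row_base_free.
have eqB : (B :=: kermx M^T)%MS.
  by apply: eqmx_trans (eqmx_cast _ _) (eq_row_base _).
pose X := [tuple (row i B)^T | i < s].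
have Xsub (k : 'I_s -> F) : \sum_i k i *: X`_i = ((\row_i k i) *m B)^T.
  apply/colP => j; rewrite summxE !mxE; apply: eq_bigr => i _.
  by rewrite -tnth_nth tnth_mktuple !mxE.
have kerE v : (v \in lker f) = (v^T <= kermx M^T)%MS.
  rewrite memv_ker lfunE /=; apply/eqP/sub_kermxP => [Mv|Mv].
    by rewrite -trmx_mul Mv trmx0.
  by apply: trmx_inj; rewrite trmx_mul Mv trmx0.
apply: (size_basis (X := X)); rewrite basisEfree; apply/and3P; split.
- apply/freeP => k; rewrite Xsub => /(congr1 trmx); rewrite trmxK trmx0 => k0 i.
  have /rowP/(_ i) : \row_i k i = 0 by apply: (row_free_inj freeB); rewrite k0 mul0mx.
  by rewrite !mxE.
- apply/span_subvP => v /tnthP[i ->]; rewrite tnth_mktuple kerE trmxK -eqB.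
  exact: row_sub.
- suff sub : (lker f <= <<X>>)%VS by apply: leq_trans (dimvS sub) (dim_span _).
  apply/subvP => v; rewrite kerE -eqB => /submxP[u vu].
  have -> : v = \sum_i u 0 i *: X`_i.
    rewrite Xsub -[v]trmxK vu; congr (_ *m _)^T.
    by apply/rowP => i; rewrite mxE.
  apply: memv_suml => i _; apply: memvZ; apply: memv_span.
  by rewrite -tnth_nth mem_tnth.
Qed.

(** A nonsingular minor of maximal size, written with selection matrices so that
    it commutes with ring morphisms. *)
Lemma rank_minor m N (A : 'M[F]_(m, N)) : exists f g,
  rowsub f 1%:M *m A *m colsub g 1%:M \in (unitmx : {pred 'M[F]_(\rank A)}).
Proof.
pose B := rowsub (maxrankfun A) A.
have fullB : row_full B^T.
  have := maxrowsub_free A; rewrite -/B /row_free /row_full mxrank_tr => /eqP ->.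
  by rewrite eqxx.
exists (maxrankfun A), (fullrankfun fullB).
rewrite -rowsubE -/B -unitmx_tr trmx_mul.
rewrite (_ : (colsub _ _)^T = rowsub (fullrankfun fullB) 1%:M); last first.
  by rewrite -[RHS]trmxK; congr (_^T); apply/matrixP => i j; rewrite !mxE eq_sym.
by rewrite -rowsubE fullrowsub_unit.
Qed.

End Rank.

(** * Integrality of eigenvalues *)

Section Integral.
Variables (A : comNzRingType) (K : fieldType) (f : {rmorphism A -> K}).

Lemma integral_char_poly N (M : 'M[K]_N) :
  (forall i j, integralOver f (M i j)) -> forall i, integralOver f (char_poly M)`_i.
Proof.
move=> intM; pose P (q : {poly K}) := forall i, integralOver f q`_i.
have P0 : P 0 by move=> i; rewrite coef0; apply: mxpoly.integral0.
have PD q1 q2 : P q1 -> P q2 -> P (q1 + q2).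
  by move=> h1 h2 i; rewrite coefD; apply: integral_add.
have PM q1 q2 : P q1 -> P q2 -> P (q1 * q2).
  move=> h1 h2 i; rewrite coefM; apply: (big_ind (integralOver f)).
  - exact: mxpoly.integral0.
  - by move=> x y; apply: integral_add.
  - by move=> j _; apply: integral_mul.
have P1 : P 1 by move=> i; rewrite coef1; apply: integral_nat.
have PN q : P q -> P (- q) by move=> h i; rewrite coefN; apply: integral_opp.
suff : P (char_poly M) by [].
apply: (big_ind P P0 PD) => s _; apply: (PM).
  by elim: (nat_of_bool _) => [|k IH]; rewrite ?expr0 // exprS mulN1r; apply: PN.
apply: (big_ind P P1 PM) => i _; rewrite !mxE.
apply: (PD); last by apply: PN => k; rewrite coefC; case: (k == 0%N) => //; apply: mxpoly.integral0.
by case: (_ == _) => // k; rewrite mulr1n coefX; apply: integral_nat.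
Qed.

Lemma integral_nat_combination (I : Type) (r : seq I) (a : I -> K) (k : I -> nat) :
  (forall i, integralOver f (a i)) -> integralOver f (\sum_(i <- r) a i * (k i)%:R).
Proof.
move=> inta; apply: (big_ind (integralOver f)).
- exact: mxpoly.integral0.
- by move=> x y; apply: integral_add.
- by move=> i _; apply: integral_mul => //; apply: integral_nat.
Qed.

Lemma integral_eigenvalue N (M : 'M[K]_N) x :
  (forall i j, integralOver f (M i j)) -> (\rank (x%:M - M)%R < N)%N -> integralOver f x.
Proof.
move=> intM rk; apply: (integral_root_monic (char_poly_monic M)).
  rewrite -eigenvalue_root_char /eigenvalue /eigenspace kermx_eq0 /row_free.
  by rewrite -opprB -scaleN1r mxrank_scale_nz ?oppr_eq0 ?oner_eq0 // neq_ltn rk.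
by apply/integral_poly; apply: integral_char_poly.
Qed.

End Integral.

(** * Galois conjugation of ranks *)

Section GaloisRank.
Variable C : numFieldType.

(** A minor of x - M is the value at x of a rational polynomial, and it is still
    nonzero at y. *)
Lemma rank_sub_le (x y : C) N (M : 'M[rat]_N) :
  (forall d : {poly rat}, (map_poly ratr d).[x] != 0 -> (map_poly ratr d).[y] != 0) ->
  (\rank (x%:M - map_mx ratr M)%R <= \rank (y%:M - map_mx (ratr : rat -> C) M)%R)%N.
Proof.
move=> h; have [f [g]] := rank_minor (x%:M - map_mx ratr M)%R.
set r := \rank _ => ur.
pose Q : 'M[{poly rat}]_r := rowsub f 1%:M *m char_poly_mx M *m colsub g 1%:M.
pose ev (z : C) : {rmorphism {poly rat} -> C} := horner_eval z \o map_poly ratr.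
have QE z : map_mx (ev z) Q = rowsub f 1%:M *m (z%:M - map_mx ratr M) *m colsub g 1%:M.
  rewrite !map_mxM !map_mxsub !map_mx1; congr (_ *m _ *m _).
  apply/matrixP => i j; rewrite !mxE rmorphB rmorphMn /=.
  by rewrite /horner_eval map_polyX map_polyC hornerX hornerC.
have : map_mx (ev y) Q \in unitmx.
  rewrite unitmxE det_map_mx unitfE; apply: h.
  by move: ur; rewrite -QE unitmxE det_map_mx unitfE.
rewrite QE => /mxrank_unit <-.
by apply: leq_trans (mxrankM_maxl _ _) (mxrankM_maxr _ _).
Qed.

Lemma rank_galois (p : {poly rat}) (x y : C) N (M : 'M[rat]_N) :
  p \is monic -> root (map_poly ratr p) x ->
  (forall q : {poly rat}, q != 0 -> root (map_poly ratr q) x -> (size p <= size q)%N) ->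
  root (map_poly ratr p) y ->
  \rank (x%:M - map_mx ratr M)%R = \rank (y%:M - map_mx (ratr : rat -> C) M)%R.
Proof.
move=> pm px pmin py; have p0 := monic_neq0 pm.
have xy d : (map_poly ratr d).[x] = 0 -> (map_poly (ratr : rat -> C) d).[y] = 0.
  move=> dx; have [r0|r0] := eqVneq (d %% p) 0.
    by rewrite (divp_eq d p) r0 addr0 rmorphM hornerM /= (rootP py) mulr0.
  have : root (map_poly ratr (d %% p)) x.
    have -> : d %% p = d - d %/ p * p by rewrite {2}(divp_eq d p) addrC addKr.
    by rewrite rootE rmorphB rmorphM /= hornerD hornerN hornerM dx (rootP px) mulr0 subr0.
  by move/(pmin _ r0); rewrite leqNgt ltn_modp p0.
have yx d : (map_poly ratr d).[y] = 0 -> (map_poly (ratr : rat -> C) d).[x] = 0.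
  move=> dy; set g := gcdp p d.
  have gy : root (map_poly ratr g) y by rewrite gcdp_map root_gcd py rootE dy eqxx.
  have pE := divpK (dvdp_gcdl p d); rewrite -/g in pE.
  have g0 : g != 0 by rewrite gcdp_eq0 (negPf p0).
  have : root (map_poly ratr (p %/ g)) x || root (map_poly ratr g) x.
    by rewrite -rootM -rmorphM pE.
  case/orP => [qx|]; last by rewrite gcdp_map root_gcd => /andP[_ /rootP].
  have q0 : p %/ g != 0 by apply: contraNneq p0 => q0; rewrite -pE q0 mul0r.
  have := pmin _ q0 qx; rewrite size_divp // leqNgt ltn_subrL size_poly_gt0 p0 andbT.
  rewrite -subn1 subn_gt0 -leqNgt => sg.
  have /size_poly1P[k k0 gk] : size g == 1%N by rewrite eqn_leq sg size_poly_gt0.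
  by move: gy; rewrite gk map_polyC rootC fmorph_eq0 (negPf k0).
apply/eqP; rewrite eqn_leq !rank_sub_le // => d; apply: contra_neq.
  exact: xy.
exact: yx.
Qed.

End GaloisRank.

Local Open Scope classical_set_scope.

(** * Order and limits of complex numbers *)

Section ComplexOrder.
Variable R : realType.
Notation C := R[i].

Lemma ge0_ReC (x : C) : 0 <= x -> x = (complex.Re x)%:C%C.
Proof. by move=> x0; rewrite RRe_real // ger0_real. Qed.

Lemma Im_subR (z : C) (x : R) : complex.Im (z - x%:C%C) = complex.Im z.
Proof. by case: z => a b /=; rewrite subr0. Qed.

Lemma ler_eps_real (x y : C) : x \is Num.real -> y \is Num.real ->
  (forall e : C, 0 < e -> x <= y + e) -> x <= y.
Proof.
move=> xr yr h; rewrite real_leNgt //; apply/negP => yx.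
have d0 : 0 < (x - y) / 2 by rewrite divr_gt0 ?subr_gt0.
have := h _ d0; rewrite -lerBlDl real_leNgt ?rpredB ?rpred_div ?rpredB ?realn //.
by rewrite ltr_pdivrMr // mulr_natr mulr2n ltrDl subr_gt0 yx.
Qed.

End ComplexOrder.

Section ComplexLimits.
Variable R : realType.
Notation C := R[i].

Lemma cvg_complexP (T : Type) (F : set_system T) {FF : Filter F} (u : T -> C) (v : C) :
  ((fun x => complex.Re (u x)) @ F --> complex.Re v) ->
  ((fun x => complex.Im (u x)) @ F --> complex.Im v) ->
  (u : T -> C^o) @ F --> (v : C^o).
Proof.
move=> /cvgrPdist_le hR /cvgrPdist_le hI; apply/(@cvgrPdist_le C C^o) => e e0.
have e0' : 0 < complex.Re e / 2.
  by rewrite divr_gt0 // -ltcR -(ge0_ReC (ltW e0)).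
near=> x; have h1 : `|complex.Re v - complex.Re (u x)| <= complex.Re e / 2.
  by near: x; apply: hR.
have h2 : `|complex.Im v - complex.Im (u x)| <= complex.Re e / 2.
  by near: x; apply: hI.
have -> : v - u x = (complex.Re v - complex.Re (u x))%:C%C +
    'i%C * (complex.Im v - complex.Im (u x))%:C%C.
  by rewrite !rmorphB /= {1}(complexE v) {1}(complexE (u x)); ring.
apply: le_trans (ler_normD _ _) _; rewrite (ge0_ReC (ltW e0)) normrM.
rewrite !normc_def /= expr0n /= !addr0 expr1n add0r sqrtr1 mul1r !sqrtr_sqr.
by rewrite -rmorphD lecR; lra.
Unshelve. all: by end_near. Qed.

Lemma cvg_complex_sum (T I : Type) (F : set_system T) {FF : Filter F} (r : seq I)
    (f : I -> T -> C) (a : I -> C) :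
  (forall i, (f i : T -> C^o) @ F --> (a i : C^o)) ->
  ((fun t => \sum_(i <- r) f i t) : T -> C^o) @ F --> ((\sum_(i <- r) a i : C) : C^o).
Proof.
move=> fa; elim: r => [|i r IH].
  by rewrite big_nil; under eq_fun do rewrite big_nil; apply: cvg_cst.
rewrite big_cons; under eq_fun do rewrite big_cons.
exact: (@cvgD C C^o T F FF (f i) (fun t => \sum_(j <- r) f j t) (a i)
  (\sum_(j <- r) a j) (fa i) IH).
Qed.

Lemma complex_cauchy_cvg (u : nat -> C) :
  (forall e : C, 0 < e -> exists K, forall k l, (K <= k)%N -> (K <= l)%N -> `|u k - u l| <= e) ->
  exists v : C, (u : nat -> C^o) @ \oo --> (v : C^o).
Proof.
move=> cu.
have part (p : C -> R) : (forall x y, p (x - y) = p x - p y) ->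
    (forall x : C, `|p x|%:C%C <= `|x|) -> cvgn (fun k => p (u k)).
  move=> pB ple; apply/cauchy_cvgP/cauchy_exP => e e0.
  have e2 : 0 < (e / 2)%:C%C :> C by rewrite ltcR divr_gt0.
  have [K hK] := cu _ e2; exists (p (u K)), K => // k /= Kk.
  rewrite /ball /= -pB; apply: (@le_lt_trans _ _ (e / 2)); last by lra.
  by rewrite -lecR; apply: le_trans (ple _) _; apply: hK.
have [a ha] : exists a : R, (fun k => complex.Re (u k)) @ \oo --> a.
  exists (limn (fun k => complex.Re (u k))); apply: part.
    by case=> x1 x2 [y1 y2].
  move=> x; rewrite normc_def lecR -{1}sqrtr_sqr.
  by rewrite ler_wsqrtr // lerDl sqr_ge0.
have [b hb] : exists b : R, (fun k => complex.Im (u k)) @ \oo --> b.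
  exists (limn (fun k => complex.Im (u k))); apply: part.
    by case=> x1 x2 [y1 y2].
  move=> x; rewrite normc_def lecR -{1}sqrtr_sqr.
  by rewrite ler_wsqrtr // lerDr sqr_ge0.
by exists (a +i* b)%C; apply: cvg_complexP.
Qed.

Lemma cvg_le_bound (T : Type) (F : set_system T) {FF : ProperFilter F} (u : T -> C) (v M : C) :
  M \is Num.real -> (u : T -> C^o) @ F --> (v : C^o) ->
  (\forall x \near F, `|u x| <= M) -> `|v| <= M.
Proof.
move=> Mr /(@cvgrPdist_le C C^o) uv uM.
apply: ler_eps_real; rewrite ?normr_real // => e e0.
have /filter_ex[x [h1 h2]] : \forall x \near F, `|v - u x| <= e /\ `|u x| <= M.
  by near=> x; split; near: x => //; apply: uv.
rewrite -[v](subrK (u x)) addrC; apply: le_trans (ler_normD _ _) _.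
exact: lerD.
Unshelve. all: by end_near. Qed.

End ComplexLimits.

Section ComplexNonneg.
Variable R : realType.
Notation C := R[i].

Lemma normc_part_le (x : C) : `|complex.Re x|%:C%C <= `|x| /\ `|complex.Im x|%:C%C <= `|x|.
Proof.
by rewrite normc_def !lecR -2!{1}sqrtr_sqr; split; rewrite ler_wsqrtr // (lerDl, lerDr) sqr_ge0.
Qed.

Lemma cvg_ge0 (T : Type) (F : set_system T) {FF : ProperFilter F} (u : T -> C) (v : C) :
  (u : T -> C^o) @ F --> (v : C^o) -> (forall x, 0 <= u x) -> 0 <= v.
Proof.
move=> /(@cvgrPdist_le C C^o) h u0.
have small (e : R) : 0 < e -> `|complex.Im v| <= e /\ - complex.Re v <= e.
  move=> e0; have e0' : 0 < e%:C%C :> C by rewrite ltcR.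
  have /filter_ex[x hx] := h _ e0'.
  have := u0 x; rewrite lecE => /andP[/eqP im re].
  have [h1 h2] := normc_part_le (v - u x).
  move: (le_trans h1 hx) (le_trans h2 hx); rewrite !lecR {h1 h2 hx}.
  move: im re; case: v (u x) {h} => [v1 v2] [u1 u2] /= -> re.
  rewrite subr0 => hre ->; split=> //.
  by move: hre; rewrite ler_norml => /andP[]; lra.
rewrite lecE /=; apply/andP; split.
  rewrite -normr_le0; apply/ler_addgt0Pr => e e0; rewrite add0r.
  by case: (small e e0).
rewrite -oppr_le0; apply/ler_addgt0Pr => e e0; rewrite add0r.
by case: (small e e0).
Qed.

Lemma complex_archi (z : C) : exists k : nat, `|z| <= k%:R.
Proof.
exists (Num.Def.archi_bound (complex.Re `|z|)).
rewrite (ge0_ReC (normr_ge0 z)) -(rmorph_nat (real_complex R)) lecR.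
by apply/ltW/archi_boundP; have := normr_ge0 z; rewrite lecE => /andP[_].
Qed.

End ComplexNonneg.

(** * The Hamming distance of permutations *)

Section Hamming.
Variable m : nat.
Implicit Types s t u : 'S_m.

Definition hamming s t : nat := #|[set x | s x != t x]%SET|.

Lemma hamming_sym s t : hamming s t = hamming t s.
Proof. by apply: eq_card => x; rewrite !inE eq_sym. Qed.

Lemma hamming_triangle t s u : (hamming s u <= hamming s t + hamming t u)%N.
Proof.
apply: leq_trans (_ : #|[set x | s x != t x]%SET :|: [set x | t x != u x]%SET| <= _)%N.
  apply: subset_leq_card; apply/fintype.subsetP => x; rewrite !inE.
  by apply: contraR; rewrite negb_or !negbK => /andP[/eqP->].
by rewrite cardsU leq_subr.
Qed.

Lemma hamming_mull s t u : hamming (u * s)%g (u * t)%g = hamming s t.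
Proof.
rewrite /hamming -(card_imset (pred_of_set [set x | (u * s)%g x != (u * t)%g x]%SET) (@perm_inj _ u)).
apply: eq_card => x; rewrite !inE; apply/imsetP/idP => [[y]|h].
  by rewrite inE !permM => h ->.
by exists ((u^-1)%g x); rewrite ?inE ?permM permKV.
Qed.

Lemma hamming_mulr s t u : hamming (s * u)%g (t * u)%g = hamming s t.
Proof. by apply: eq_card => x; rewrite !inE !permM (inj_eq perm_inj). Qed.

Lemma hamming_inv s t : hamming s^-1%g t^-1%g = hamming s t.
Proof.
by rewrite -(hamming_mull _ _ s) -[RHS](hamming_mulr _ _ t^-1%g) mulgV mulgV hamming_sym.
Qed.

Lemma nfix_hamming s t : (nfix (s * t^-1)%g + hamming s t = m)%N.
Proof.
rewrite -[RHS]card_ord -(cardsC [set x | s x == t x]%SET); congr (_ + _)%N.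
  apply: eq_card => x; rewrite !inE permM.
  by apply/eqP/eqP => [e|->]; rewrite ?permK // -{2}e permKV.
by apply: eq_card => x; rewrite !inE.
Qed.

Lemma nfix_le_hamming s t : (nfix s <= nfix t + hamming s t)%N.
Proof.
apply: leq_trans (_ : #|[set x | t x == x]%SET :|: [set x | s x != t x]%SET| <= _)%N.
  apply: subset_leq_card; apply/fintype.subsetP => x; rewrite !inE => /eqP sx.
  by rewrite sx eq_sym orbN.
by rewrite cardsU leq_subr.
Qed.

End Hamming.

(** * Traces along a sofic approximation *)

Section SoficTrace.
Variables (R : realType) (G : groupType).
Variables (N : sofic_index R G -> nat) (phi : forall p : sofic_index R G, G -> 'S_(N p)).
Hypothesis hphi : sofic_family phi.
Notation net := (@sofic_net R G).

Lemma N_gt0 p : (0 < N p)%N.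
Proof. by have [[]] := hphi p. Qed.

Lemma near_sofic (S : {fset G}) (e : R) : 0 < e ->
  \forall p \near net, (S `<=` idx_set p)%fset /\ idx_eps p <= e.
Proof.
move=> e0; pose S' := (S `|` [fset (g^-1)%g | g in S])%fset.
have sym : [fset (g^-1)%g | g in S']%fset = S'.
  apply/fsetP => x; apply/imfsetP/idP => [[y /= yS ->]|].
    move: yS; rewrite !in_fsetU => /orP[yS|/imfsetP[z /= zS ->]].
      by apply/orP; right; apply/imfsetP; exists y.
    by rewrite invgK zS.
  rewrite in_fsetU => /orP[xS|/imfsetP[z /= zS ->]].
    exists (x^-1)%g; last by rewrite invgK.
    by rewrite /= in_fsetU; apply/orP; right; apply/imfsetP; exists x.
  by exists z => //=; rewrite in_fsetU zS.
have e01 : 0 < Num.min e 2^-1 < 1.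
  rewrite lt_min e0 invr_gt0 ltr0n /= gt_min; apply/orP; right.
  by rewrite invf_lt1 ?ltr1n.
exists (SoficIndex sym e01) => // q [/= sub le]; split.
  by apply: fsubset_trans sub; apply: fsubsetUl.
by apply: le_trans le _; rewrite ge_min lexx.
Qed.

(** Asymptotically, psi acts as h. These families are closed under products and
    inverses, which encodes that phi is an approximate morphism. *)
Definition asymp (psi : forall p, 'S_(N p)) (h : G) :=
  forall e : R, 0 < e -> \forall p \near net,
    (hamming (psi p) (phi p h))%:R <= e * (N p)%:R.

Lemma asymp_phi h : asymp (phi^~ h) h.
Proof.
move=> e e0; near=> p; rewrite /hamming.
rewrite (_ : [set x | phi p h x != phi p h x]%SET = finset.set0).
  by rewrite cards0 mulr_ge0 ?ler0n ?ltW.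
by apply/setP => x; rewrite !inE eqxx.
Unshelve. all: by end_near. Qed.

Lemma asymp1 : asymp (fun p => 1%g) 1%g.
Proof.
move=> e e0; have h := asymp_phi 1%g e0; near=> p.
have [[_ _ <- _] _] := hphi p; near: p; exact: h.
Unshelve. all: by end_near. Qed.

Lemma asympM psi chi h g : asymp psi h -> asymp chi g ->
  asymp (fun p => psi p * chi p)%g (h * g)%g.
Proof.
move=> ah ag e e0; have e3 : 0 < e / 3 by rewrite divr_gt0.
near=> p.
have [Sp ep] : ([fset h; g] `<=` idx_set p)%fset /\ idx_eps p <= e / 3.
  by near: p; apply: near_sofic.
have h1 : (hamming (psi p) (phi p h))%:R <= e / 3 * (N p)%:R by near: p; apply: ah.
have h2 : (hamming (chi p) (phi p g))%:R <= e / 3 * (N p)%:R by near: p; apply: ag.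
have [[_ mult _ _] _] := hphi p.
have {mult} := mult h g (fsubsetP Sp _ (fset21 _ _)) (fsubsetP Sp _ (fset22 _ _)).
have /(congr1 (fun k => k%:R : R)) := nfix_hamming (phi p h * phi p g)%g (phi p (h * g)%g).
rewrite natrD => eqN hm.
have h3 : (hamming (phi p h * phi p g)%g (phi p (h * g)%g))%:R <= e / 3 * (N p)%:R.
  have : idx_eps p * (N p)%:R <= e / 3 * (N p)%:R by rewrite ler_wpM2r.
  by move: hm; rewrite mulrBl mul1r; lra.
have tri : (hamming (psi p * chi p)%g (phi p (h * g)%g) <=
    hamming (psi p) (phi p h) + (hamming (chi p) (phi p g) +
    hamming (phi p h * phi p g)%g (phi p (h * g)%g)))%N.
  apply: leq_trans (hamming_triangle (phi p h * chi p)%g _ _) _.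
  rewrite hamming_mulr leq_add2l.
  by apply: leq_trans (hamming_triangle (phi p h * phi p g)%g _ _) _; rewrite hamming_mull.
rewrite -(ler_nat R) !natrD in tri; lra.
Unshelve. all: by end_near. Qed.

Lemma asympV psi h : asymp psi h -> asymp (fun p => (psi p)^-1)%g (h^-1)%g.
Proof.
move=> ah e e0; near=> p.
have [Sp _] : ([fset h] `<=` idx_set p)%fset /\ idx_eps p <= 1.
  by near: p; apply: near_sofic.
have [_ ->] := hphi p; last by apply: (fsubsetP Sp); rewrite inE.
by rewrite hamming_inv; near: p; apply: ah.
Unshelve. all: by end_near. Qed.

(** Almost all points are fixed when h = 1, and almost none otherwise by the
    separation clause of a sofic approximation. *)
Lemma nfix_cvg psi h : asymp psi h ->
  (fun p => (nfix (psi p))%:R / (N p)%:R : R[i]^o) @ net --> ((h == 1%g)%:R : R[i]^o).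
Proof.
move=> ah; apply/cvgrPdist_le => eps eps0.
have [e ee] : exists e : R, eps = e%:C%C.
  by exists (complex.Re eps); rewrite RRe_real // gtr0_real.
have e0 : 0 < e by rewrite -ltcR -ee.
have e2 : 0 < e / 2 by rewrite divr_gt0.
near=> p.
have Np : 0 < (N p)%:R :> R by rewrite ltr0n N_gt0.
have h1 : (hamming (psi p) (phi p h))%:R <= e / 2 * (N p)%:R by near: p; apply: ah.
have [Sp ep] : ([fset h] `<=` idx_set p)%fset /\ idx_eps p <= e / 2.
  by near: p; apply: near_sofic.
have -> : (h == 1%g)%:R - (nfix (psi p))%:R / (N p)%:R =
    ((h == 1%g)%:R - (nfix (psi p))%:R / (N p)%:R : R)%:C%C.
  by rewrite rmorphB fmorph_div !rmorph_nat.
rewrite ee normc_def /= expr0n /= addr0 sqrtr_sqr lecR.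
have [[_ _ phi1 fixed] _] := hphi p.
have [h1'|h1'] := eqVneq h 1%g.
  have /(congr1 (fun k => k%:R : R)) := nfix_hamming (psi p) (phi p h).
  rewrite {1}h1' phi1 invg1 mulg1 natrD => eqN.
  have -> : true%:R - (nfix (psi p))%:R / (N p)%:R
     = (hamming (psi p) (phi p h))%:R / (N p)%:R :> R.
    apply/eqP; rewrite subr_eq -mulrDl addrC eqN.
    by rewrite divff // lt0r_neq0.
  rewrite ger0_norm ?divr_ge0 // ler_pdivrMr //.
  by apply: le_trans h1 _; rewrite ler_wpM2r //; lra.
rewrite sub0r normrN ger0_norm ?divr_ge0 // ler_pdivrMr //.
have hS : h \in idx_set p by apply: (fsubsetP Sp); rewrite inE.
have := fixed h hS h1'.
have := nfix_le_hamming (psi p) (phi p h); rewrite -(ler_nat R) natrD.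
have : idx_eps p * (N p)%:R <= e / 2 * (N p)%:R by rewrite ler_wpM2r.
lra.
Unshelve. all: by end_near. Qed.

Variables (n : nat) (J : finType) (D : J -> 'M[R[i]]_n) (h : J -> G).
Variable sg : forall p, J -> 'S_(N p).
Hypothesis sgh : forall j, asymp (sg^~ j) (h j).

(** The coefficient at g of the k-th power of the sum of the D j (h j). *)
Fixpoint conv_pow (k : nat) (g : G) : 'M[R[i]]_n :=
  if k is k'.+1 then \sum_j D j *m conv_pow k' ((h j)^-1 * g)%g
  else (g == 1%g)%:R%:M.

(** Letting the last factor vary makes the induction on k work: one factor of
    the power is moved into it by cyclicity of the trace. *)
Lemma trace_cvg_gen k (X : 'M[R[i]]_n) psi g : asymp psi g ->
  (fun p => \tr (kron_sum D (sg p) ^+ k *m kron_perm X (psi p)) / (N p)%:R : R[i]^o) @ net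
   --> (\tr (conv_pow k (g^-1)%g *m X) : R[i]^o).
Proof.
elim: k X psi g => [|k IH] X psi g ag.
  rewrite /= mul_scalar_mx mxtraceZ mulrC.
  under eq_fun do rewrite expr0 mul1mx mxtrace_kron_perm -mulrA.
  apply: cvgMr; have -> : ((g^-1)%g == 1%g) = (g == 1%g) by rewrite invg_eq1.
  exact: nfix_cvg ag.
have -> : (fun p => \tr (kron_sum D (sg p) ^+ k.+1 *m kron_perm X (psi p)) / (N p)%:R : R[i]^o)
  = (fun p => \sum_j \tr (kron_sum D (sg p) ^+ k *m kron_perm (X *m D j) (psi p * sg p j)%g) / (N p)%:R).
  apply: funext => p; rewrite -mulr_suml; congr (_ / _).
  rewrite exprS -mulmxE -mulmxA mxtrace_mulC -mulmxA mulmx_sumr mulmx_sumr raddf_sum /=.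
  by apply: eq_bigr => j _; rewrite kron_permM.
have -> : \tr (conv_pow k.+1 (g^-1)%g *m X) =
    \sum_j \tr (conv_pow k ((g * h j)^-1)%g *m (X *m D j)).
  rewrite /= mulmx_suml raddf_sum /=; apply: eq_bigr => j _.
  by rewrite invMg -mulmxA mxtrace_mulC -!mulmxA.
apply: cvg_complex_sum => j; apply: IH.
exact: asympM.
Qed.

Lemma trace_cvg k :
  (fun p => \tr (kron_sum D (sg p) ^+ k) / (N p)%:R : R[i]^o) @ net
   --> (\tr (conv_pow k 1%g) : R[i]^o).
Proof.
have := @trace_cvg_gen k 1%:M _ _ asymp1; rewrite invg1 mulmx1.
by under eq_fun do rewrite kron_perm_scalar mulmx1.
Qed.

End SoficTrace.

(** * Unordered sums and l^2 *)

Section UnorderedSums.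
Variables (R : realType) (G : groupType).
Notation C := R[i].
Implicit Types (f : G -> C) (A B : {fset G}) (s e : C).

Definition hassum f s := forall e, 0 < e ->
  exists A, forall B, (A `<=` B)%fset -> `|s - \sum_(g <- B) f g| <= e.

Lemma hassum_sum f s : hassum f s -> summability.sum (f : G -> C^o) = s.
Proof.
move=> fs; apply: (@cvg_lim C^o); first exact: norm_hausdorff.
  exact: summability.totally_filter.
apply/(@cvgrPdist_le C C^o _ _ (summability.totally_filter (I := G))) => e e0.
have [A AB] := fs e e0; exists A => // B /AB; rewrite /summability.partial_sum.
by rewrite -(big_seq_fsetE _ B xpredT f).
Qed.

Lemma hassum_unique f s s' : hassum f s -> hassum f s' -> s = s'.
Proof. by move=> /hassum_sum <- /hassum_sum. Qed.

Lemma hassum_ext f f' s : f =1 f' -> hassum f s -> hassum f' s.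
Proof. by move=> /funext ->. Qed.

Lemma hassumD f f' s s' : hassum f s -> hassum f' s' -> hassum (f \+ f') (s + s').
Proof.
move=> fs fs' e e0; have e2 : 0 < e / 2 by rewrite divr_gt0.
have [A hA] := fs _ e2; have [A' hA'] := fs' _ e2.
exists (A `|` A')%fset => B; rewrite fsubUset => /andP[AB A'B].
rewrite big_split /= opprD addrACA (le_trans (ler_normD _ _)) //.
by rewrite [e]splitr lerD ?hA ?hA'.
Qed.

Lemma hassumZ f s a : hassum f s -> hassum (fun g => a * f g) (a * s).
Proof.
move=> fs e e0; have a1 : 0 < `|a| + 1 by rewrite ltr_wpDl.
have [A hA] := fs _ (divr_gt0 e0 a1); exists A => B /hA h.
rewrite -mulr_sumr -mulrBr normrM; apply: (@le_trans _ _ ((`|a| + 1) * (e / (`|a| + 1)))).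
  by apply: ler_pM => //; rewrite lerDl.
by rewrite mulrCA divff ?mulr1 // lt0r_neq0.
Qed.

Lemma hassum0 : hassum (fun=> 0) 0.
Proof. by move=> e e0; exists fset0 => B _; rewrite big1 ?subrr ?normr0 ?ltW. Qed.

Lemma hassum_bigsum (I : Type) (r : seq I) (f : I -> G -> C) (s : I -> C) :
  (forall i, hassum (f i) (s i)) ->
  hassum (fun g => \sum_(i <- r) f i g) (\sum_(i <- r) s i).
Proof.
move=> fs; elim: r => [|i r IH].
  by rewrite big_nil; apply: hassum_ext hassum0 => g; rewrite big_nil.
rewrite big_cons; apply: hassum_ext (hassumD (fs i) IH) => g.
by rewrite /= big_cons.
Qed.

Lemma hassumB f f' s s' : hassum f s -> hassum f' s' -> hassum (fun g => f g - f' g) (s - s').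
Proof.
move=> fs fs'; rewrite -[- s']mulN1r.
by apply: hassum_ext (hassumD fs (hassumZ (-1) fs')) => g /=; rewrite mulN1r.
Qed.

Lemma hassum_fin f A : (forall g, g \notin A -> f g = 0) -> hassum f (\sum_(g <- A) f g).
Proof.
move=> fA e e0; exists A => B AB; rewrite (big_fset_incl _ AB) ?subrr ?normr0 ?ltW //.
by move=> g _; apply: fA.
Qed.

Lemma hassum_reindex f s (h h' : G -> G) : cancel h h' -> cancel h' h ->
  hassum f s -> hassum (fun g => f (h g)) s.
Proof.
move=> hK h'K fs e e0; have [A hA] := fs e e0.
have inj := can_inj hK.
exists [fset h' g | g in A]%fset => B AB.
have := hA [fset h g | g in B]%fset; rewrite big_imfset /=; last by move=> ? ? _ _; apply: inj.
apply; apply/fsubsetP => g gA; apply/imfsetP; exists (h' g); rewrite ?h'K //=.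
by apply: (fsubsetP AB); apply/imfsetP; exists g.
Qed.

Lemma hassum_norm_le f s M : hassum f s -> M \is Num.real ->
  (forall A, `|\sum_(g <- A) f g| <= M) -> `|s| <= M.
Proof.
move=> fs Mr fM; apply: ler_eps_real; rewrite ?normr_real // => e e0.
have [A hA] := fs e e0; have := hA A (fsubset_refl A) => h.
rewrite -[s](subrK (\sum_(g <- A) f g)) addrC.
by apply: le_trans (ler_normD _ _) _; apply: lerD.
Qed.

Lemma ler_sum_fset f A B : (forall g, 0 <= f g) -> (A `<=` B)%fset ->
  \sum_(g <- A) f g <= \sum_(g <- B) f g.
Proof.
move=> f0 AB; rewrite (big_fsetID _ (mem A) B) /=.
rewrite (_ : [fset x in B | x \in A]%fset = A) ?lerDl ?sumr_ge0 //.
apply/fsetP => x; rewrite !inE /=; apply/andP/idP => [[]//|xA]; split=> //.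
exact: (fsubsetP AB).
Qed.

Lemma hassum_ge_partial f s A : (forall g, 0 <= f g) -> hassum f s ->
  \sum_(g <- A) f g <= s.
Proof.
move=> f0 fs.
have pos B : 0 <= \sum_(g <- B) f g by apply: sumr_ge0.
have close e : 0 < e -> exists2 B, (A `<=` B)%fset & `|s - \sum_(g <- B) f g| <= e.
  move=> e0; have [A' hA'] := fs e e0; exists (A `|` A')%fset; first exact: fsubsetUl.
  by apply: hA'; apply: fsubsetUr.
have s0 : complex.Im s = 0.
  apply/eqP; rewrite -normr_le0; apply/ler_addgt0Pr => e e0; rewrite add0r.
  have [|B _] := close e%:C%C; first by rewrite ltcR.
  rewrite (ge0_ReC (pos B)) => h; rewrite -lecR; apply: le_trans h.
  rewrite normc_def lecR Im_subR.
  apply: le_trans (_ : Num.sqrt (complex.Im s ^+ 2) <= _); first by rewrite sqrtr_sqr.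
  by rewrite ler_wsqrtr // lerDr sqr_ge0.
have sr : s \is Num.real by rewrite (complexE s) s0 rmorph0 mulr0 addr0 complex_real.
apply: ler_eps_real => // [|e e0]; first by apply: ger0_real.
have [B AB h] := close e e0; apply: le_trans (ler_sum_fset f0 AB) _.
rewrite -lerBlDl; apply: le_trans h; rewrite distrC.
by apply: real_ler_norm; rewrite rpredB // ger0_real.
Qed.

Lemma hassum_ge0_bounded f M : (forall g, 0 <= f g) ->
  (forall A, \sum_(g <- A) f g <= M) -> exists s, hassum f s.
Proof.
move=> f0 fM.
pose S := [set x : R | exists A, x = complex.Re (\sum_(g <- A) f g)].
have pos B : 0 <= \sum_(g <- B) f g by apply: sumr_ge0.
have supS : has_sup S.
  split; first by exists 0, fset0; rewrite big_nil.
  exists (complex.Re M) => _ [A ->]; have := fM A; rewrite lecE => /andP[_] //.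
exists (sup S)%:C%C => e e0.
have eE : e = (complex.Re e)%:C%C by apply: ge0_ReC; apply: ltW.
have e0' : 0 < complex.Re e by rewrite -ltcR -eE.
have [_ [A ->] ltA] := sup_adherent e0' supS.
exists A => B AB.
have mono := ler_sum_fset f0 AB.
rewrite (ge0_ReC (pos B)) -rmorphB /= normc_def /= expr0n /= addr0 sqrtr_sqr eE lecR.
have ub : complex.Re (\sum_(g <- B) f g) <= sup S.
  by apply: ub_le_sup; [exact: supS.2 | exists B].
rewrite ger0_norm ?subr_ge0 //.
move: mono; rewrite lecE => /andP[_]; lra.
Qed.

(** Adding h makes the real and the imaginary parts of f nonnegative. *)
Lemma hassum_dominated f (h : G -> C) M : (forall g, `|f g| <= h g) ->
  (forall A, \sum_(g <- A) h g <= M) -> exists2 s, hassum f s & `|s| <= M.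
Proof.
move=> fh hM.
have h0 g : 0 <= h g by apply: le_trans (fh g).
have [sh hsh] := hassum_ge0_bounded h0 hM.
have part (u : G -> C) : (forall g, u g \is Num.real) -> (forall g, `|u g| <= h g) ->
    exists s, hassum u s.
  move=> ur uh; have [|A|s hs] := @hassum_ge0_bounded (fun g => u g + h g) (M + M).
  - by move=> g; rewrite -lerBlDr sub0r; have := uh g; rewrite real_ler_norml // => /andP[].
  - rewrite big_split lerD //= (le_trans _ (hM A)) //; apply: ler_sum => g _.
    by apply: le_trans (uh g); apply: real_ler_norm.
  by exists (s - sh); apply: hassum_ext (hassumB hs hsh) => g; rewrite addrK.
have [s1 h1] : exists s, hassum (fun g => 'Re (f g)) s.
  apply: part => g; first exact: Creal_Re.
  by apply: le_trans (fh g); apply: (leif_normC_Re_Creal _).1.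
have [s2 h2] : exists s, hassum (fun g => 'Im (f g)) s.
  apply: part => g; first exact: Creal_Im.
  by apply: le_trans (fh g); apply: normC_Im_le.
have hf : hassum f (s1 + 'i%R * s2).
  by apply: hassum_ext (hassumD h1 (hassumZ 'i%R h2)) => g /=; rewrite -Crect.
exists (s1 + 'i%R * s2) => //; apply: hassum_norm_le hf _ _.
  by apply: ger0_real; have := hM fset0; rewrite big_nil.
move=> A; apply: le_trans (hM A); apply: le_trans (ler_norm_sum _ _ _) _.
exact: ler_sum.
Qed.

Definition sqbounded f M := forall A, \sum_(g <- A) `|f g| ^+ 2 <= M.

Lemma sqbounded_ge0 f M : sqbounded f M -> 0 <= M.
Proof. by move=> /(_ fset0); rewrite big_nil. Qed.

Lemma l2P f : l2 f <-> exists M, sqbounded f M.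
Proof.
have nE g : `|f g| ^+ 2 = (Normc.normc (f g) ^+ 2)%:C%C by rewrite rmorphXn.
have sE A : \sum_(g <- A) `|f g| ^+ 2 = (\sum_(g <- A) Normc.normc (f g) ^+ 2)%:C%C.
  by rewrite rmorph_sum; apply: eq_bigr => g _; rewrite nE.
rewrite /l2 /=; split=> [fin|[M fM]].
  have fin' : (\esum_(g in [set: G]) (Normc.normc (f g) ^+ 2)%:E)%E \is a fin_num.
    by rewrite ge0_fin_numE // esum_ge0 // => g _; rewrite lee_fin sqr_ge0.
  exists (fine (\esum_(g in [set: G]) (Normc.normc (f g) ^+ 2)%:E)%E)%:C%C => A.
  rewrite sE lecR -lee_fin fineK //; apply: esum_ge.
  exists [set` A]; first by split=> //; exact: finite_fset.
  by rewrite fsbig_finite ?finite_fset //= set_fsetK sumEFin.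
apply: le_lt_trans (ltry (complex.Re M)).
apply: ge_ereal_sup => _ [X [finX _] <-].
rewrite fsbig_finite //= sumEFin lee_fin.
by have := fM (fset_set X); rewrite sE lecE => /andP[_].
Qed.

Lemma sqboundedD f f' M M' : sqbounded f M -> sqbounded f' M' ->
  sqbounded (fun g => f g + f' g) (M *+ 2 + M' *+ 2).
Proof.
move=> fM fM' A.
apply: (@le_trans _ _ (\sum_(g <- A) (`|f g| ^+ 2 *+ 2 + `|f' g| ^+ 2 *+ 2))).
  apply: ler_sum => g _; apply: (@le_trans _ _ ((`|f g| + `|f' g|) ^+ 2)).
    by rewrite lerXn2r ?nnegrE ?addr_ge0 // ler_normD.
  rewrite -subr_ge0 (_ : _ - _ = (`|f g| - `|f' g|) ^+ 2).
    by rewrite real_exprn_even_ge0 // rpredB // normr_real.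
  by move: `|f g| `|f' g| => a b; ring.
by rewrite big_split /= !sumrMnl lerD // lerMn2r /= ?fM ?fM'.
Qed.

(** Cauchy-Schwarz in the form of the inequality between means. *)
Lemma hassum_inner f f' M M' (t : C) : 0 < t -> sqbounded f M -> sqbounded f' M' ->
  exists2 s, hassum (fun g => f g * (f' g)^*) s & `|s| <= t * M + t^-1 * M'.
Proof.
move=> t0 fM fM'.
apply: (@hassum_dominated _ (fun g => t * `|f g| ^+ 2 + t^-1 * `|f' g| ^+ 2)).
  move=> g; rewrite normrM norm_conjC.
  set a := `|f g|; set b := `|f' g|.
  have ab : 0 <= a * b by rewrite mulr_ge0 ?normr_ge0.
  apply: (@le_trans _ _ (a * b *+ 2)); first by rewrite mulr2n lerDl.
  have t0' : t != 0 by rewrite gt_eqF.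
  rewrite -subr_ge0 (_ : _ - _ = t^-1 * (t * a - b) ^+ 2); last first.
    by move: a b {ab} => a b; field.
  rewrite mulr_ge0 ?invr_ge0 ?(ltW t0) // real_exprn_even_ge0 // rpredB //.
    by rewrite rpredM ?normr_real // ger0_real ?ltW.
  exact: normr_real.
by move=> A; rewrite big_split /= -!mulr_sumr; apply: lerD; rewrite ler_pM2l ?invr_gt0.
Qed.

End UnorderedSums.

(** * Convolution operators and their adjoints *)

Lemma big_option (R : Type) (idx : R) (op : Monoid.com_law idx) (T : finType)
    (F : option T -> R) :
  \big[op/idx]_j F j = op (F None) (\big[op/idx]_t F (Some t)).
Proof.
rewrite (bigD1 None) //=; congr (op _ _).
rewrite (reindex_omap Some id) //=; last by case.
by apply: eq_bigl => t; rewrite eqxx.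
Qed.

Lemma sub_mxE (V : zmodType) m n (A B : 'M[V]_(m, n)) i j : (A - B) i j = A i j - B i j.
Proof. by rewrite !mxE. Qed.

Section Convolution.
Variables (R : realType) (G : groupType) (n : nat).
Notation C := R[i].

Definition conv (J : finType) (c : J -> 'M[C]_n) (gg : J -> G) q
    (f : G -> 'M[C]_(n, q)) : G -> 'M[C]_(n, q) :=
  fun g => \sum_b c b *m f ((gg b)^-1 * g)%g.

Definition finsupported q (f : G -> 'M[C]_(n, q)) :=
  exists A : {fset G}, forall g, g \notin A -> f g = 0.

Lemma finsupported_conv (J : finType) (c : J -> 'M[C]_n) (gg : J -> G) q
    (f : G -> 'M[C]_(n, q)) : finsupported f -> finsupported (conv c gg f).
Proof.
move=> [A fA]; exists (\bigcup_(b <- enum J) [fset (gg b * g)%g | g in A])%fset.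
move=> g gA; rewrite /conv big1 // => b _; rewrite fA ?mulmx0 //.
apply: contra gA => gA; apply/bigfcupP; exists b; first by rewrite mem_enum.
by apply/imfsetP; exists ((gg b)^-1 * g)%g => //; rewrite mulKVg.
Qed.

(** Finite support of U lets the sum be split over b; each summand is then
    translated by gg b. *)
Lemma hassum_adjoint (J : finType) (c : J -> 'M[C]_n) (gg : J -> G) q r
    (U : G -> 'M[C]_(n, r)) (f : G -> 'M[C]_(n, q)) i i' s : finsupported U ->
  hassum (fun g => ((U g)^t* *m (\sum_b (c b)^t* *m f (gg b * g)%g)) i i') s ->
  hassum (fun g => ((conv c gg U g)^t* *m f g) i i') s.
Proof.
move=> [A UA]; pose F b g := ((U g)^t* *m (c b)^t* *m f (gg b * g)%g) i i'.
have hF b : hassum (F b) (\sum_(g <- A) F b g).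
  apply: hassum_fin => g gA; rewrite /F UA // trmx0 (map_mx0 Num.conj).
  by rewrite !mul0mx mxE.
move=> hs.
have -> : s = \sum_b \sum_(g <- A) F b g.
  apply: hassum_unique hs _; apply: hassum_ext (hassum_bigsum _ hF) => g.
  rewrite mulmx_sumr summxE; apply: eq_bigr => b _; by rewrite /F mulmxA.
have hF' b : hassum (fun g => F b ((gg b)^-1 * g)%g) (\sum_(g <- A) F b g).
  apply: (hassum_reindex (h' := fun g => gg b * g)%g); last exact: hF.
    by move=> g; rewrite mulKVg.
  by move=> g; rewrite mulKg.
apply: hassum_ext (hassum_bigsum _ hF') => g.
rewrite /conv adj_sum mulmx_suml summxE.
by apply: eq_bigr => b _; rewrite /F adjM mulKVg.
Qed.

End Convolution.

(** * Powers of a Gram operator *)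

Section Gram.
Variables (R : realType) (G : groupType) (n : nat) (J : finType).
Notation C := R[i].
Variables (c : J -> 'M[C]_n) (gg : J -> G) (kap : C).
Hypothesis kap0 : 0 < kap.

(** The letters of S = 1 - kap B^* B, where B has the letters (c, gg). *)
Definition gram_coef (j : option (J * J)) : 'M[C]_n :=
  if j is Some (b, b') then - kap *: ((c b)^t* *m c b') else 1%:M.

Definition gram_elt (j : option (J * J)) : G :=
  if j is Some (b, b') then ((gg b)^-1 * gg b')%g else 1%g.

Local Notation S := (@conv R G n _ gram_coef gram_elt _).
Local Notation W := (conv_pow gram_coef gram_elt).

Lemma gramE q (f : G -> 'M[C]_(n, q)) g :
  S f g = f g - kap *: \sum_b (c b)^t* *m conv c gg f (gg b * g)%g.
Proof.
rewrite /conv big_option /= invg1 mul1g mul1mx; congr (_ + _).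
rewrite -scaleNr scaler_sumr; under [RHS]eq_bigr do rewrite mulmx_sumr scaler_sumr.
rewrite pair_bigA; apply: eq_bigr => -[b b'] _ /=.
by rewrite -scalemxAl mulmxA invMg invgK mulgA.
Qed.

(** Swapping b and b' exchanges each letter with its adjoint. *)
Lemma gram_selfadj q (f : G -> 'M[C]_(n, q)) g :
  \sum_j (gram_coef j)^t* *m f (gram_elt j * g)%g = S f g.
Proof.
pose tau (j : option (J * J)) := if j is Some (b, b') then Some (b', b) else None.
have tauK : involutive tau by case=> [[]|].
rewrite (reindex_inj (inv_inj tauK)) /=; apply: eq_bigr => -[[b b']|] _ /=.
  have -> : (- kap *: ((c b')^t* *m c b))^t* = - kap *: ((c b)^t* *m c b').
    rewrite adjZ adjM trmxCK; congr (_ *: _).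
    by apply/CrealP; rewrite rpredN gtr0_real.
  by rewrite invMg invgK.
by rewrite trmx1 map_mx1 invg1.
Qed.

Lemma finsupported_conv_pow k : finsupported (W k).
Proof.
elim: k => [|k IH]; last exact: finsupported_conv IH.
exists [fset 1%g]%fset => g; rewrite inE => /negPf /= ->.
by apply/matrixP => i j; rewrite !mxE mul0rn.
Qed.

(** The pairing of S^k delta_1 with f is the value of S^k f at 1, since S is
    self-adjoint. *)
Lemma hassum_conv_pow k q (f : G -> 'M[C]_(n, q)) i i' :
  hassum (fun g => ((W k g)^t* *m f g) i i') (iter k S f 1%g i i').
Proof.
elim: k f => [|k IH] f.
  have := @hassum_fin _ _ (fun g => ((W 0 g)^t* *m f g) i i') [fset 1%g]%fset.
  rewrite big_seq_fset1 /= eqxx tr_scalar_mx map_scalar_mx /= rmorph1 mul1mx.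
  apply=> g; rewrite inE => /negPf ->.
  by rewrite tr_scalar_mx map_scalar_mx /= rmorph0 mul_scalar_mx scale0r mxE.
rewrite iterSr; apply: hassum_adjoint (finsupported_conv_pow k) _.
by apply: hassum_ext (IH (S f)) => g; rewrite gram_selfadj.
Qed.

Lemma iter_conv_pow k l : iter k S (W l) = W (k + l).
Proof. by elim: k => //= k ->. Qed.

(** The square of the Hilbert-Schmidt norm. *)
Definition hsq q (X : 'M[C]_(n, q)) : C := \sum_i \sum_j `|X j i| ^+ 2.

Lemma hsq_ge0 q (X : 'M[C]_(n, q)) : 0 <= hsq X.
Proof. by apply: sumr_ge0 => i _; apply: sumr_ge0 => j _; rewrite exprn_ge0. Qed.

Lemma hsq_trace q (X : 'M[C]_(n, q)) : \tr (X^t* *m X) = hsq X.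
Proof.
apply: eq_bigr => i _; rewrite mxE; apply: eq_bigr => j _.
by rewrite !mxE normCK mulrC.
Qed.

Lemma entry_le_hsq q (X : 'M[C]_(n, q)) i j : `|X j i| ^+ 2 <= hsq X.
Proof.
rewrite /hsq (bigD1 i) //= (bigD1 j) //= -addrA lerDl addr_ge0 //.
  by apply: sumr_ge0 => ? _; rewrite exprn_ge0.
by apply: sumr_ge0 => ? _; apply: sumr_ge0 => ? _; rewrite exprn_ge0.
Qed.

Lemma hsqD_le q (X Y : 'M[C]_(n, q)) : hsq (X + Y) <= hsq X *+ 2 + hsq Y *+ 2.
Proof.
rewrite /hsq -!sumrMnl -big_split; apply: ler_sum => i _ /=.
rewrite -!sumrMnl -big_split; apply: ler_sum => j _ /=; rewrite mxE.
apply: (@le_trans _ _ ((`|X j i| + `|Y j i|) ^+ 2)).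
  by rewrite lerXn2r ?nnegrE ?addr_ge0 // ler_normD.
rewrite -subr_ge0 sqr_parallelogram.
by rewrite real_exprn_even_ge0 // rpredB // normr_real.
Qed.

Lemma hassum_trace k (f : G -> 'M[C]_n) :
  hassum (fun g => \tr ((W k g)^t* *m f g)) (\tr (iter k S f 1%g)).
Proof. by apply: hassum_bigsum => i; apply: hassum_conv_pow. Qed.

Lemma hassum_hsq_diff k l :
  hassum (fun g => hsq (W k g - W l g))
   (\tr (W (k + k) 1%g) - \tr (W (k + l) 1%g) *+ 2 + \tr (W (l + l) 1%g)).
Proof.
have h a b : hassum (fun g => \tr ((W a g)^t* *m W b g)) (\tr (W (a + b) 1%g)).
  by rewrite -iter_conv_pow; apply: hassum_trace.
have -> : \tr (W (k + k) 1%g) - \tr (W (k + l) 1%g) *+ 2 + \tr (W (l + l) 1%g) =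
  (\tr (W (k + k) 1%g) - \tr (W (k + l) 1%g)) - (\tr (W (l + k) 1%g) - \tr (W (l + l) 1%g)).
  by rewrite [(l + k)%N]addnC; ring.
apply: hassum_ext (hassumB (hassumB (h k k) (h k l)) (hassumB (h l k) (h l l))) => g.
rewrite -hsq_trace [(_ - _)^T]raddfB /= map_mxB mulmxBl !mulmxBr !raddfB /=.
by [].
Qed.

Lemma hassum_hsq k : hassum (fun g => hsq (W k g)) (\tr (W (k + k) 1%g)).
Proof.
apply: hassum_ext (fun g => hsq_trace (W k g)) _.
by rewrite -iter_conv_pow; apply: hassum_trace.
Qed.

Lemma hassum_hsq_conv k : hassum (fun g => hsq (conv c gg (W k) g))
  (kap^-1 * (\tr (W (k + k) 1%g) - \tr (W (k + k.+1) 1%g))).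
Proof.
have h a b : hassum (fun g => \tr ((W a g)^t* *m W b g)) (\tr (W (a + b) 1%g)).
  by rewrite -iter_conv_pow; apply: hassum_trace.
apply: hassum_ext (fun g => hsq_trace (conv c gg (W k) g)) _.
have -> : kap^-1 * (\tr (W (k + k) 1%g) - \tr (W (k + k.+1) 1%g)) =
  \sum_i kap^-1 * (W (k + k) 1%g i i - W (k + k.+1) 1%g i i).
  by rewrite -mulr_sumr sumrB.
apply: hassum_bigsum => i; apply: hassum_adjoint (finsupported_conv_pow k) _.
rewrite -!iter_conv_pow.
apply: hassum_ext (hassumZ kap^-1 (hassumB (hassum_conv_pow k (W k) i i)
  (hassum_conv_pow k (W k.+1) i i))) => g.
have -> : \sum_b (c b)^t* *m conv c gg (W k) (gg b * g)%g = kap^-1 *: (W k g - W k.+1 g).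
  have : W k.+1 g = W k g - kap *: \sum_b (c b)^t* *m conv c gg (W k) (gg b * g)%g.
    exact: gramE.
  move->; rewrite opprB addrC subrK scalerA mulVf ?scale1r // gt_eqF //.
by rewrite -scalemxAr mulmxBr !mxE.
Qed.

End Gram.

(** * The limit of the powers of a Gram operator *)

Section Projection.
Variables (R : realType) (G : groupType) (n : nat) (J : finType).
Notation C := R[i].
Variables (c : J -> 'M[C]_n) (gg : J -> G) (kap : C).
Hypothesis kap0 : 0 < kap.
Local Notation gc := (gram_coef c kap).
Local Notation ge := (gram_elt gg).
Local Notation S := (@conv R G n _ gc ge _).
Local Notation W := (conv_pow gc ge).

Variables (alpha : nat -> R) (beta : R).
Hypothesis traceW : forall k, \tr (W k 1%g) = (alpha k)%:C%C.
Hypothesis alpha_noninc : {homo alpha : k l / (k <= l)%N >-> l <= k}.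
Hypothesis alpha_cvg : alpha @ \oo --> beta.

Lemma alpha_ge k : beta <= alpha k.
Proof.
rewrite -(cvg_lim (@Rhausdorff R) alpha_cvg).
by apply: nonincreasing_cvgn_ge => //; apply/cvg_ex; exists beta.
Qed.

Lemma alpha_near e : 0 < e -> exists k, alpha k - beta <= e.
Proof.
move=> e0; have /cvgrPdist_le/(_ e e0) := alpha_cvg.
case=> k _ hk; exists k; have := hk k (leqnn k); rewrite distrC /= => h.
by apply: le_trans h; apply: ler_norm.
Qed.

Lemma sum_hsq_diff_le (A : {fset G}) K k l : (K <= k)%N -> (K <= l)%N ->
  \sum_(g <- A) hsq (W k g - W l g) <= ((alpha K - beta) *+ 2)%:C%C.
Proof.
move=> Kk Kl.
have := hassum_ge_partial A _ (hassum_hsq_diff c gg kap0 k l); rewrite !traceW.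
move=> h; apply: le_trans (h _) _ => [g|]; first exact: hsq_ge0.
rewrite -rmorphMn -rmorphB -rmorphD lecR.
have h1 := alpha_noninc (leq_trans Kk (leq_addr k k)).
have h2 := alpha_noninc (leq_trans Kl (leq_addr l l)).
have := alpha_ge (k + l); lra.
Qed.

(** The traces of S^k converge, so by [hassum_hsq_diff] the sequence S^k delta_1
    is Cauchy in l^2, hence entrywise. *)
Lemma conv_pow_cvg g j i : exists v : C, (fun k => W k g j i : C^o) @ \oo --> (v : C^o).
Proof.
apply: complex_cauchy_cvg => e e0.
have e0' : 0 < complex.Re e by rewrite -ltcR -(ge0_ReC (ltW e0)).
have [K hK] := alpha_near (divr_gt0 (exprn_gt0 2 e0') (ltr0n R 2)).
exists K => k l Kk Kl; rewrite -(@ler_pXn2r _ 2) ?nnegrE ?(ltW e0) //.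
have := sum_hsq_diff_le [fset g]%fset Kk Kl; rewrite big_seq_fset1 => h.
have := entry_le_hsq (W k g - W l g) i j; rewrite !mxE => h'.
apply: le_trans h' (le_trans h _).
rewrite (ge0_ReC (ltW e0)) -rmorphXn lecR; lra.
Qed.

Definition proj_mx (g : G) : 'M[C]_n :=
  \matrix_(j, i) xget 0 [set v : C | (fun k => W k g j i : C^o) @ \oo --> (v : C^o)].
Local Notation X := proj_mx.

Lemma proj_mx_cvg g j i : (fun k => W k g j i : C^o) @ \oo --> (X g j i : C^o).
Proof. by rewrite mxE; apply: xgetPex (conv_pow_cvg g j i). Qed.

Lemma sum_hsq_cvg0 (A : {fset G}) :
  (fun k => \sum_(g <- A) hsq (X g - W k g) : C^o) @ \oo --> (0 : C^o).
Proof.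
pose z : C := \sum_(g <- A) \sum_i \sum_j `|X g j i - X g j i| * `|X g j i - X g j i|.
have z0 : z = 0.
  rewrite /z big1 // => g _; rewrite big1 // => i _; rewrite big1 // => j _.
  by rewrite subrr normr0 mul0r.
suff : (fun k => \sum_(g <- A) hsq (X g - W k g) : C^o) @ \oo --> (z : C^o) by rewrite z0.
apply: cvg_complex_sum => g; apply: cvg_complex_sum => i; apply: cvg_complex_sum => j.
under eq_fun do rewrite sub_mxE expr2.
have h : (fun k => X g j i - W k g j i : C^o) @ \oo --> (X g j i - X g j i : C^o).
  by apply: (@cvgB C C^o); [apply: cvg_cst|apply: proj_mx_cvg].
have h' : (fun k => `|X g j i - W k g j i| : C^o) @ \oo --> (`|X g j i - X g j i| : C^o).
  exact: (@cvg_norm C C^o).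
exact: (@cvgM C).
Qed.

(** Let l tend to infinity in [sum_hsq_diff_le]. *)
Lemma sum_hsq_proj_le (A : {fset G}) k :
  \sum_(g <- A) hsq (X g - W k g) <= ((alpha k - beta) *+ 4)%:C%C.
Proof.
apply: ler_eps_real => [||e e0].
- by apply: ger0_real; apply: sumr_ge0 => g _; apply: hsq_ge0.
- by rewrite complex_real.
have e2 : 0 < e / 2 by rewrite divr_gt0.
have /(@cvgrPdist_le C C^o)/(_ _ e2)[K _ hK] := sum_hsq_cvg0 A.
have := hK _ (leq_maxl K k); rewrite /= sub0r normrN ger0_norm; last first.
  by apply: sumr_ge0 => g _; apply: hsq_ge0.
set l := maxn K k => hl.
have hkl := sum_hsq_diff_le A (leq_maxr K k) (leqnn k).
apply: (@le_trans _ _ (\sum_(g <- A) (hsq (X g - W l g) *+ 2 + hsq (W l g - W k g) *+ 2))).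
  apply: ler_sum => g _; apply: le_trans (hsqD_le _ _).
  by rewrite addrA subrK.
rewrite big_split /= !sumrMnl addrC; apply: lerD.
  by rewrite -[4%N]/(2 * 2)%N mulrnA rmorphMn lerMn2r.
by rewrite [e]splitr -mulr2n lerMn2r.
Qed.

Lemma sum_hsq_le (A : {fset G}) k :
  \sum_(g <- A) hsq (X g) <= ((alpha k - beta) *+ 8 + alpha k *+ 2)%:C%C.
Proof.
have h1 := sum_hsq_proj_le A k.
have h2 : \sum_(g <- A) hsq (W k g) <= (alpha k)%:C%C.
  apply: le_trans (hassum_ge_partial A _ (hassum_hsq c gg kap0 k)) _ => [g|].
    exact: hsq_ge0.
  by rewrite traceW lecR alpha_noninc // leq_addr.
apply: (@le_trans _ _ (\sum_(g <- A) (hsq (X g - W k g) *+ 2 + hsq (W k g) *+ 2))).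
  by apply: ler_sum => g _; apply: le_trans (hsqD_le _ _); rewrite subrK.
rewrite big_split /= !sumrMnl rmorphD; apply: lerD.
  by rewrite -[8%N]/(4 * 2)%N mulrnA rmorphMn lerMn2r.
by rewrite rmorphMn lerMn2r.
Qed.

(** The norm of B S^k delta_1 is controlled by the decrease of the traces from
    2k to 2k + 1, which tends to 0. *)
Lemma conv_proj_mx g : conv c gg X g = 0.
Proof.
apply/matrixP => j i; rewrite [RHS]mxE.
have h1 : (fun k => conv c gg (W k) g j i : C^o) @ \oo --> (conv c gg X g j i : C^o).
  rewrite /conv summxE; under eq_fun do rewrite summxE.
  apply: cvg_complex_sum => b; rewrite mxE; under eq_fun do rewrite mxE.
  apply: cvg_complex_sum => l; apply: (@cvgM C); first exact: cvg_cst.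
  exact: proj_mx_cvg.
apply/eqP; rewrite -normr_le0; apply: ler_eps_real; rewrite ?normr_real // => e e0.
rewrite add0r; apply: cvg_le_bound h1 _; first exact: gtr0_real.
have e0' : 0 < complex.Re e by rewrite -ltcR -(ge0_ReC (ltW e0)).
have kE := ge0_ReC (ltW kap0).
have kap0' : 0 < complex.Re kap by rewrite -ltcR -kE.
have [K hK] := alpha_near (mulr_gt0 kap0' (exprn_gt0 2 e0')).
exists K => // k /= Kk; rewrite -(@ler_pXn2r _ 2) ?nnegrE ?(ltW e0) //.
apply: le_trans (entry_le_hsq _ i j) _.
have := hassum_ge_partial [fset g]%fset _ (hassum_hsq_conv c gg kap0 k).
rewrite big_seq_fset1 => h; apply: le_trans (h _) _ => [g'|]; first exact: hsq_ge0.
rewrite !traceW ler_pdivrMl // (ge0_ReC (ltW e0)) {1}kE -rmorphXn -rmorphB -rmorphM lecR.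
apply: le_trans hK.
have h1' := alpha_noninc (leq_trans Kk (leq_addr k k)).
by have := alpha_ge (k + k.+1); lra.
Qed.

Lemma proj_mx0_if : beta = 0 -> forall g, X g = 0.
Proof.
move=> b0 g.
have h : hsq (X g) <= 0.
  apply: ler_eps_real => [||e e0]; rewrite ?real0 ?add0r //.
    by apply: ger0_real; apply: hsq_ge0.
  have e0' : 0 < complex.Re e by rewrite -ltcR -(ge0_ReC (ltW e0)).
  have [k hk] := alpha_near (divr_gt0 e0' (ltr0n R 10)).
  have := sum_hsq_le [fset g]%fset k; rewrite big_seq_fset1 => h.
  apply: le_trans h _; rewrite (ge0_ReC (ltW e0)) lecR; lra.
apply/matrixP => j i; rewrite [RHS]mxE; apply/eqP.
by rewrite -normr_le0 -(@ler_pXn2r _ 2) ?nnegrE // expr0n /= (le_trans (entry_le_hsq _ i j)).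
Qed.

Lemma trace_proj_mx : \tr (X 1%g) = beta%:C%C.
Proof.
have h1 : (fun k => \tr (W k 1%g) : C^o) @ \oo --> (\tr (X 1%g) : C^o).
  by apply: cvg_complex_sum => i; apply: proj_mx_cvg.
have h2 : (fun k => \tr (W k 1%g) : C^o) @ \oo --> (beta%:C%C : C^o).
  under eq_fun do rewrite traceW.
  by apply: cvg_complexP => /=; [exact: alpha_cvg | exact: cvg_cst].
by apply: cvg_unique h1 h2; exact: norm_hausdorff.
Qed.

End Projection.

(** * The projection onto the kernel and its dimension *)

Section Kernel.
Variables (R : realType) (G : groupType) (n : nat) (J : finType).
Notation C := R[i].
Notation vec := ('I_n -> G -> C).
Variables (c : J -> 'M[C]_n) (gg : J -> G).

Definition colf (w : vec) (g : G) : 'cV[C]_n := \col_j w j g.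

Definition conv_ker : set vec := [set w | l2n w /\ forall g, conv c gg (colf w) g = 0].

Lemma hassum_conj (f : G -> C) s : hassum f s -> hassum (fun g => (f g)^*) s^*.
Proof.
move=> fs e e0; have [A hA] := fs e e0; exists A => B /hA.
by rewrite -rmorph_sum -rmorphB norm_conjC.
Qed.

Lemma innernP (x y : vec) : l2n x -> l2n y ->
  hassum (fun g => \sum_j x j g * (y j g)^*) (innern x y).
Proof.
move=> lx ly; apply: hassum_bigsum => j.
have [M hM] := (l2P _).1 (lx j); have [M' hM'] := (l2P _).1 (ly j).
have [s hs _] := hassum_inner ltr01 hM hM'.
by rewrite /inner (hassum_sum hs).
Qed.

(** The parameter t absorbs the failure of homogeneity of the inequality between
    means; it is chosen large when M is small. *)
Lemma hassum_inner_norm (x y : vec) (M M' t s : C) : 0 < t ->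
  (forall j, sqbounded (x j) M) -> (forall j, sqbounded (y j) M') ->
  hassum (fun g => \sum_j x j g * (y j g)^*) s ->
  `|s| <= n%:R * (t * M + t^-1 * M').
Proof.
move=> t0 xM yM hs.
have /fin_all_exists2[s' hs' bs'] : forall j, exists2 s', hassum (fun g => x j g * (y j g)^*) s' &
    `|s'| <= t * M + t^-1 * M'.
  by move=> j; apply: hassum_inner.
rewrite (hassum_unique hs (hassum_bigsum _ hs')).
apply: le_trans (ler_norm_sum _ _ _) _; apply: le_trans (ler_sum _ (fun j _ => bs' j)) _.
by rewrite sumr_const card_ord mulr_natl.
Qed.

Lemma l2_bound (w : vec) : l2n w -> exists2 M, 0 <= M & forall j, sqbounded (w j) M.
Proof.
move=> lw; have /fin_all_exists[M hM] : forall j, exists M, sqbounded (w j) M.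
  by move=> j; apply/l2P.
exists (\sum_j M j) => [|j A].
  by apply: sumr_ge0 => j _; apply: sqbounded_ge0 (hM j).
apply: le_trans (hM j A) _; rewrite (bigD1 j) //= lerDl.
by apply: sumr_ge0 => k _; apply: sqbounded_ge0 (hM k).
Qed.

Lemma l2nB (w w' : vec) : l2n w -> l2n w' -> l2n (w - w').
Proof.
move=> lw lw' j; apply/l2P.
have [M hM] := (l2P _).1 (lw j); have [M' hM'] := (l2P _).1 (lw' j).
exists (M *+ 2 + M' *+ 2); apply: (@sqboundedD _ _ (w j) (fun g => - w' j g)) => //.
by move=> A; under eq_bigr do rewrite normrN.
Qed.

Lemma conv_kerB (w w' : vec) : conv_ker w -> conv_ker w' -> conv_ker (w - w').
Proof.
move=> [lw kw] [lw' kw']; split; first exact: l2nB.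
move=> g; rewrite -[RHS]subr0 -{1}(kw g) -(kw' g) -sumrB; apply: eq_bigr => b _.
by rewrite -mulmxBr; congr (_ *m _); apply/colP => j; rewrite !mxE.
Qed.

Lemma conv_ker_shift (w : vec) h : conv_ker w -> conv_ker (fun j g => w j (g * h)%g).
Proof.
move=> [lw kw]; split.
  move=> j; apply/l2P; have [M hM] := (l2P _).1 (lw j); exists M => A.
  have := hM [fset (g * h)%g | g in A]%fset.
  by rewrite big_imfset //= => x y _ _; apply: mulIg.
move=> g; rewrite -(kw (g * h)%g); apply: eq_bigr => b _; congr (_ *m _).
by apply/colP => j; rewrite !mxE mulgA.
Qed.

Variables (kap : C).
Hypothesis kap0 : 0 < kap.
Local Notation gc := (gram_coef c kap).
Local Notation ge := (gram_elt gg).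
Local Notation S := (@conv R G n _ gc ge _).
Local Notation W := (conv_pow gc ge).

Lemma gram_fixed (w : vec) : conv_ker w -> S (colf w) = colf w.
Proof.
move=> [_ kw]; apply: funext => g; rewrite gramE // big1 ?scaler0 ?subr0 // => b _.
by rewrite kw mulmx0.
Qed.

Lemma hassum_conv_pow_ker (w : vec) k i : conv_ker w ->
  hassum (fun g => \sum_j W k g j i * (w j g)^*) (w i 1%g)^*.
Proof.
move=> kw; have := hassum_conj (hassum_conv_pow c gg kap0 k (colf w) i 0).
have -> : iter k S (colf w) = colf w.
  by elim: k => //= k ->; apply: gram_fixed.
rewrite mxE; apply: hassum_ext => g; rewrite mxE rmorph_sum; apply: eq_bigr => j _.
by rewrite !mxE rmorphM /= conjCK.
Qed.

Variables (alpha : nat -> R) (beta : R).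
Hypothesis traceW : forall k, \tr (W k 1%g) = (alpha k)%:C%C.
Hypothesis alpha_noninc : {homo alpha : k l / (k <= l)%N >-> l <= k}.
Hypothesis alpha_cvg : alpha @ \oo --> beta.
Local Notation X := (proj_mx c gg kap).

Definition proj_col (i : 'I_n) : vec := fun j g => X g j i.

Definition basis_vec (i : 'I_n) : vec := fun k => if k == i then delta R 1%g else 0.

Lemma basis_vecE i j g : basis_vec i j g = W 0 g j i.
Proof.
rewrite /basis_vec /= mxE /delta; case: eqP => _; first by rewrite mulr1n.
by rewrite mulr0n.
Qed.

Lemma proj_col_bound i : exists M, forall j, sqbounded (proj_col i j) M.
Proof.
exists ((alpha 0 - beta) *+ 8 + alpha 0 *+ 2)%:C%C => j A.
apply: le_trans (sum_hsq_le kap0 traceW alpha_noninc alpha_cvg A 0).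
by apply: ler_sum => g _; apply: entry_le_hsq.
Qed.

Lemma proj_col_ker i : conv_ker (proj_col i).
Proof.
have [M hM] := proj_col_bound i.
split; first by move=> j; apply/l2P; exists M.
move=> g; have := conv_proj_mx kap0 traceW alpha_noninc alpha_cvg g.
move=> /(congr1 (col i)); rewrite raddf0 => <-; rewrite raddf_sum /=.
apply: eq_bigr => b _; rewrite colE -mulmxA -colE; congr (_ *m _).
Qed.

Lemma l2n_basis_vec i : l2n (basis_vec i).
Proof.
move=> j; apply/l2P; exists 1 => A; apply: (@le_trans _ _ (\sum_(g <- A) (g == 1%g)%:R)).
  apply: ler_sum => g _; rewrite /basis_vec /delta; case: eqP => _ /=.
    by case: eqP => _; rewrite ?normr1 ?normr0 ?expr1n ?expr0n.
  by rewrite normr0 expr0n /= ler0n.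
have [A1|A1] := boolP (1%g \in A).
  rewrite (big_fsetD1 1%g A1) /= eqxx big1_fset ?addr0 // => g.
  by rewrite !inE => /andP[/negPf->].
rewrite big1_fset ?ler01 // => g gA _.
by case: eqP => // g1; rewrite g1 (negPf A1) in gA.
Qed.

Lemma small_norm_eq0 (s : C) (K : C) : 0 <= K ->
  (forall d : R, 0 < d -> `|s| <= K * d%:C%C) -> s = 0.
Proof.
move=> K0 h; apply/eqP; rewrite -normr_le0; apply: ler_eps_real; rewrite ?normr_real // => e e0.
rewrite add0r; have K1 : 0 < K + 1 by rewrite ltr_wpDl.
have d0 : 0 < e / (K + 1) by rewrite divr_gt0.
have d0' : 0 < complex.Re (e / (K + 1)) by rewrite -ltcR -(ge0_ReC (ltW d0)).
apply: le_trans (h _ d0') _; rewrite -(ge0_ReC (ltW d0)) mulrCA -[leRHS]mulr1.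
by rewrite ler_pM2l // ler_pdivrMr // mul1r lerDl.
Qed.

(** For w in the kernel, S w = w, so the pairing of S^k delta_1 with w does not
    depend on k; pass to the limit. *)
Lemma proj_col_orth i w : conv_ker w -> innern (basis_vec i - proj_col i) w = 0.
Proof.
move=> kw; have [lw _] := kw; have [lp _] := proj_col_ker i.
have hs := innernP (l2nB (l2n_basis_vec i) lp) lw.
set s := innern _ _ in hs *.
have [M M0 hM] := l2_bound lw.
apply: (@small_norm_eq0 _ (n%:R * (1 + M))); first by rewrite mulr_ge0 ?addr_ge0.
move=> d d0; have [k hk] := alpha_near alpha_cvg (divr_gt0 (exprn_gt0 2 d0) (ltr0n R 4)).
have hk' : hassum (fun g => \sum_j (W k g j i - X g j i) * (w j g)^*) s.
  have h := hassumB (hassum_conv_pow_ker 0 i kw) (hassum_conv_pow_ker k i kw).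
  rewrite subrr in h; have := hassumB hs h; rewrite subr0; apply: hassum_ext => g.
  rewrite -!sumrB; apply: eq_bigr => j _; rewrite -!mulrBl; congr (_ * _).
  by rewrite -[(_ - _) j g]/(basis_vec i j g - proj_col i j g) basis_vecE /proj_col; ring.
have bd (j : 'I_n) : sqbounded (fun g => W k g j i - X g j i) (d ^+ 2)%:C%C.
  move=> A; apply: (@le_trans _ _ (\sum_(g <- A) hsq (X g - W k g))).
    apply: ler_sum => g _; apply: le_trans (entry_le_hsq _ i j).
    by rewrite sub_mxE distrC.
  apply: le_trans (sum_hsq_proj_le kap0 traceW alpha_noninc alpha_cvg A k) _.
  rewrite lecR; lra.
have dC : 0 < (d^-1)%:C%C :> C by rewrite ltcR invr_gt0.
have := @hassum_inner_norm (fun j g => W k g j i - X g j i) w _ _ _ s dC bd hM hk'.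
move=> h; apply: le_trans h _; rewrite -mulrA ler_wpM2l //.
rewrite -rmorphM -fmorphV /= invrK expr2 mulKf ?gt_eqF //.
by rewrite mulrDl mul1r mulrC.
Qed.

(** Two candidates differ by an element of the kernel that is orthogonal to
    itself. *)
Lemma orth_proj_basis i : orth_proj conv_ker (basis_vec i) = proj_col i.
Proof.
apply: xget_unique; first by split; [exact: proj_col_ker | exact: proj_col_orth].
move=> v [kv ov].
pose d := proj_col i - v.
have kd : conv_ker d := conv_kerB (proj_col_ker i) kv.
have [[ld _] [lv _] [lp _]] := And3 kd kv (proj_col_ker i).
have le := l2n_basis_vec i.
have h := hassumB (innernP (l2nB le lv) ld) (innernP (l2nB le lp) ld).
rewrite ov // proj_col_orth // subrr in h.
have hd : hassum (fun g => hsq (colf d g)) 0.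
  apply: hassum_ext h => g; rewrite -sumrB /hsq big_ord1; apply: eq_bigr => j _.
  rewrite mxE normCK -mulrBl; congr (_ * _); rewrite /d.
  rewrite -[(basis_vec i - v) j g]/(basis_vec i j g - v j g).
  rewrite -[(basis_vec i - proj_col i) j g]/(basis_vec i j g - proj_col i j g).
  rewrite -[(proj_col i - v) j g]/(proj_col i j g - v j g); ring.
apply: funext => j; apply: funext => g; apply/eqP; rewrite eq_sym -subr_eq0.
have := hassum_ge_partial [fset g]%fset (fun g => hsq_ge0 (colf d g)) hd.
rewrite big_seq_fset1 => h0; have := entry_le_hsq (colf d g) 0 j; rewrite mxE.
move=> h1; have := le_trans h1 h0; rewrite real_exprn_even_le0 ?normr_real //=.
by rewrite normr_eq0.
Qed.

Lemma vN_dim_conv_ker : vN_dim conv_ker = beta%:C%C.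
Proof.
rewrite -(trace_proj_mx kap0 traceW alpha_noninc alpha_cvg); apply: eq_bigr => i _.
rewrite /vN_trace /op_entry -/(basis_vec i) orth_proj_basis.
apply: hassum_sum.
have := @hassum_fin _ _ (fun g => proj_col i i g * (delta R 1%g g)^*) [fset 1%g]%fset.
rewrite big_seq_fset1 /delta eqxx rmorph1 mulr1; apply=> g.
by rewrite inE => /negPf ->; rewrite rmorph0 mulr0.
Qed.

(** A zero trace makes the projections of all basis vectors at 1 vanish, so every
    element of the kernel vanishes at 1; the kernel is invariant under
    translations. *)
Lemma conv_ker_eq0 : beta = 0 -> forall w, conv_ker w -> w = 0.
Proof.
move=> b0; suff h1 w i : conv_ker w -> w i 1%g = 0.
  move=> w kw; apply: funext => i; apply: funext => g.
  by have := h1 _ i (conv_ker_shift g kw); rewrite mul1g.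
move=> kw; have X0 := proj_mx0_if kap0 traceW alpha_noninc alpha_cvg b0.
have orth := proj_col_orth i kw; have [lw _] := kw.
have h := innernP (l2nB (l2n_basis_vec i) (proj_col_ker i).1) lw; rewrite orth in h.
apply/eqP; rewrite -conjC_eq0; apply/eqP.
apply: hassum_unique (hassum_conv_pow_ker 0 i kw) _.
apply: hassum_ext h => g; apply: eq_bigr => j _; congr (_ * _).
rewrite -[(_ - _) j g]/(basis_vec i j g - proj_col i j g) basis_vecE /proj_col X0.
by rewrite [X in _ - X]mxE subr0.
Qed.

Lemma beta_eq0 : (forall w, conv_ker w -> w = 0) -> beta = 0.
Proof.
move=> k0; apply: (@complexI R).
rewrite -(trace_proj_mx kap0 traceW alpha_noninc alpha_cvg) rmorph0.
rewrite /mxtrace big1 // => i _.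
by rewrite -[X _ i i]/(proj_col i i 1%g) (k0 _ (proj_col_ker i)).
Qed.

End Kernel.

(** * The approximation formula *)

Definition gram_perm (J : finType) m (sg : J -> 'S_m) (j : option (J * J)) : 'S_m :=
  if j is Some (b, b') then ((sg b)^-1 * sg b')%g else 1%g.

Section Approximation.
Variables (R : realType) (G : groupType).
Notation C := R[i].
Variables (n : nat) (A : 'M[group_ring R G]_n).
Hypothesis algA : forall i j g, algebraic_number (A i j g).
Variables (N : sofic_index R G -> nat) (phi : forall p : sofic_index R G, G -> 'S_(N p)).
Hypothesis hphi : sofic_family phi.
Notation net := (@sofic_net R G).

Definition support : {fset G} :=
  (\bigcup_(x <- enum {: 'I_n * 'I_n}) finsupp (A x.1 x.2))%fset.

Lemma finsupp_sub i j : (finsupp (A i j) `<=` support)%fset.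
Proof.
apply/fsubsetP => g gA; apply/bigfcupP; exists (i, j) => //.
by rewrite mem_enum.
Qed.

Lemma big_support (V : nmodType) i j (f : G -> V) :
  (forall g, A i j g = 0 -> f g = 0) ->
  \sum_(g <- finsupp (A i j)) f g = \sum_(b : support) f (val b).
Proof.
move=> f0; rewrite (big_fset_incl _ (finsupp_sub i j)).
  by rewrite (big_seq_fsetE _ support xpredT f).
by move=> g _; rewrite memNfinsupp => /eqP/f0.
Qed.

Definition coefA (b : support) : 'M[C]_n := \matrix_(i, j) A i j (val b).

Lemma matrix_permE p : matrix_perm (phi p) A = kron_sum coefA (fun b => phi p (val b)).
Proof.
rewrite /kron_sum -mxblock_sum; apply: eq_mxblock => i j.
rewrite /group_ring_perm big_support => [|g ->]; last by rewrite scale0r.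
by apply: eq_bigr => b _; rewrite mxE.
Qed.

Variable lam : C.

(** Writes lam - A as a sum of monomials; None is the scalar term, at the neutral
    element. *)
Definition coefB (b : option support) : 'M[C]_n :=
  if b is Some b' then - coefA b' else lam%:M.

Definition eltB (b : option support) : G := if b is Some b' then val b' else 1%g.

Definition permB p (b : option support) : 'S_(N p) :=
  if b is Some b' then phi p (val b') else 1%g.

Notation Bp p := (lam%:M - matrix_perm (phi p) A).

Lemma kron_sumB p : kron_sum coefB (permB p) = Bp p.
Proof.
rewrite matrix_permE /kron_sum big_option /= kron_perm_scalar; congr (_ + _).
rewrite -sumrN; apply: eq_bigr => b _.
by rewrite -scaleN1r kron_permZ scaleN1r.
Qed.

Lemma matrix_convE x g :
  \col_j matrix_conv A x j g = conv coefA val (colf x) g.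
Proof.
apply/colP => j; rewrite mxE /matrix_conv /left_conv summxE.
under [RHS]eq_bigr do rewrite mxE.
rewrite exchange_big fct_sumE; apply: eq_bigr => l _ /=.
rewrite (@big_support _ j l (fun h => A j l h * x l (h^-1 * g)%g)) => [|h ->].
  by apply: eq_bigr => b _; rewrite !mxE.
by rewrite mul0r.
Qed.

Lemma conv_coefB x g :
  conv coefB eltB (colf x) g = \col_j (lam *: x - matrix_conv A x) j g.
Proof.
have -> : \col_j (lam *: x - matrix_conv A x) j g
    = lam *: colf x g - \col_j matrix_conv A x j g.
  by apply/colP => j; rewrite !mxE.
rewrite matrix_convE /conv big_option /= invg1 mul1g mul_scalar_mx; congr (_ + _).
by rewrite -sumrN; apply: eq_bigr => b _; rewrite mulNmx.
Qed.

Lemma eigenspaceE : l2_eigenspace A lam = conv_ker coefB eltB.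
Proof.
apply/seteqP; split=> x [lx ex]; split=> //.
  by move=> g; rewrite conv_coefB ex; apply/colP => j; rewrite !mxE.
apply: funext => j; apply: funext => g.
by have /(congr1 (fun v : 'cV_n => v j 0)) := ex g; rewrite conv_coefB !mxE.
Qed.

Lemma asymp_permB b : asymp phi (permB^~ b) (eltB b).
Proof. by case: b => [b|]; [exact: asymp_phi | exact: asymp1]. Qed.

Lemma asymp_gram j : asymp phi (fun p => gram_perm (permB p) j) (gram_elt eltB j).
Proof.
case: j => [[b b']|]; last exact: asymp1.
by apply: asympM => //; [apply: asympV => //|]; apply: asymp_permB.
Qed.

(** Bounds the eigenvalues of phi_p(B)^* phi_p(B) for all p; the summand 1 makes it
    invertible. *)
Definition gram_bound : C := coef_norm coefB * coef_norm coefB + 1.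
Notation K := gram_bound.
Definition kap : C := K^-1.

Lemma gram_bound_gt0 : 0 < K.
Proof. by rewrite ltr_wpDl // mulr_ge0 ?coef_norm_ge0. Qed.

Lemma kap_gt0 : 0 < kap.
Proof. by rewrite invr_gt0 gram_bound_gt0. Qed.

Lemma gram_kron p : kron_sum (gram_coef coefB kap) (gram_perm (permB p)) =
  1%:M - kap *: ((Bp p)^t* *m Bp p).
Proof.
rewrite -kron_sumB kron_sum_adj /kron_sum big_option /= kron_perm_scalar; congr (_ + _).
rewrite mulmx_suml -scaleNr scaler_sumr.
under [RHS]eq_bigr do rewrite mulmx_sumr scaler_sumr.
rewrite pair_bigA; apply: eq_bigr => -[b b'] _ /=.
by rewrite kron_permM kron_permZ.
Qed.

Lemma gram_eig_le p P d i : diagonalizes P d ((Bp p)^t* *m Bp p) ->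
  (forall i, 0 <= d 0 i) -> d 0 i <= K.
Proof.
move=> dB d0; apply: diagonalizes_le dB _ d0.
apply: (@rowsum_le_trans _ _ _ _ (coef_norm coefB * coef_norm coefB)).
  by rewrite lerDl.
apply: rowsum_leM; first exact: coef_norm_ge0.
  by rewrite -kron_sumB kron_sum_adj -coef_norm_adj; apply: rowsum_kron_sum.
by rewrite -kron_sumB; apply: rowsum_kron_sum.
Qed.

Notation trS k p := (\tr (kron_sum (gram_coef coefB kap) (gram_perm (permB p)) ^+ k) / (N p)%:R : C).
Notation W := (conv_pow (gram_coef coefB kap) (gram_elt eltB)).

Lemma trS_cvg k : (fun p => trS k p : C^o) @ net --> (\tr (W k 1%g) : C^o).
Proof. by apply: (trace_cvg hphi); apply: asymp_gram. Qed.

Lemma trSE p P d k : diagonalizes P d ((Bp p)^t* *m Bp p) ->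
  trS k p = (\sum_i (1 - kap * d 0 i) ^+ k) / (N p)%:R.
Proof. by move=> dB; rewrite gram_kron (diagonalizes_trX _ _ dB). Qed.

Lemma gram_eig01 p P d i : diagonalizes P d ((Bp p)^t* *m Bp p) ->
  (forall i, 0 <= d 0 i) -> 0 <= 1 - kap * d 0 i <= 1.
Proof.
move=> dB d0; rewrite subr_ge0 gerBl mulr_ge0 ?(ltW kap_gt0) //.
by rewrite mulrC ler_pdivrMr ?gram_bound_gt0 // mul1r (gram_eig_le _ dB).
Qed.

Lemma trS_ge0 k p : 0 <= trS k p.
Proof.
have [P [d [dB d0]]] := diagonalize_gram (Bp p).
rewrite (trSE _ dB) divr_ge0 // sumr_ge0 // => i _.
by rewrite exprn_ge0 //; have /andP[] := gram_eig01 i dB d0.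
Qed.

Lemma trS_decr k p : trS k.+1 p <= trS k p.
Proof.
have [P [d [dB d0]]] := diagonalize_gram (Bp p).
rewrite !(trSE _ dB) ler_wpM2r ?invr_ge0 //; apply: ler_sum => i _.
have /andP[h1 h2] := gram_eig01 i dB d0.
by rewrite exprS ler_piMl // exprn_ge0.
Qed.

Definition alpha k : R := complex.Re (\tr (W k 1%g)).

(** The traces of S^k are limits of nonnegative numbers. *)
Lemma alphaE k : \tr (W k 1%g) = (alpha k)%:C%C.
Proof. by apply: ge0_ReC; apply: (cvg_ge0 (@trS_cvg k)) => p; apply: trS_ge0. Qed.

Lemma alpha_ge0 k : 0 <= alpha k.
Proof. by rewrite -lecR -alphaE; apply: (cvg_ge0 (@trS_cvg k)) => p; apply: trS_ge0. Qed.

Lemma alpha_decr : {homo alpha : k l / (k <= l)%N >-> l <= k}.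
Proof.
apply/nonincreasing_seqP => k; rewrite -lecR -!alphaE -subr_ge0.
have h : (fun p => (trS k p - trS k.+1 p : C) : C^o) @ net -->
    ((\tr (W k 1%g) - \tr (W k.+1 1%g) : C) : C^o).
  exact: (@cvgB C C^o _ _ _ _ _ _ _ (@trS_cvg k) (@trS_cvg k.+1)).
by apply: (cvg_ge0 h) => p; rewrite subr_ge0 trS_decr.
Qed.

Definition beta := limn alpha.

Lemma alpha_cvg : alpha @ \oo --> beta.
Proof.
apply: nonincreasing_is_cvgn; first exact: alpha_decr.
by exists 0 => _ [k _ <-]; apply: alpha_ge0.
Qed.

Lemma vN_dimE : vN_dim (l2_eigenspace A lam) = beta%:C%C.
Proof.
rewrite eigenspaceE.
apply: (vN_dim_conv_ker kap_gt0 (alpha := alpha)).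
- exact: alphaE.
- exact: alpha_decr.
- exact: alpha_cvg.
Qed.

Lemma not_eigenvalue_vN_dim : vN_dim (l2_eigenspace A lam) = 0 <-> ~ is_eigenvalue A lam.
Proof.
rewrite vN_dimE; split=> [/(@complexI R _ 0) b0 [x]|h].
  rewrite eigenspaceE => kx /eqP; apply.
  by apply: (conv_ker_eq0 kap_gt0 alphaE _ _ b0 kx); [exact: alpha_decr | exact: alpha_cvg].
rewrite (beta_eq0 kap_gt0 alphaE (@alpha_decr) (@alpha_cvg)) // => w kw.
by apply: contrapT => /eqP w0; apply: h; exists w; rewrite ?eigenspaceE.
Qed.

Lemma few_small_eigenvalues : exists E : nat, forall t : nat, exists2 delta : C, 0 < delta &
  forall p P d, diagonalizes P d ((Bp p)^t* *m Bp p) -> (forall i, 0 <= d 0 i) ->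
    (t * #|[pred i | (0 < d 0 i <= delta)%R]| <= E * N p)%N.
Proof.
have [al|tr] := EM (algebraic_number lam).
  have [|E hE] := @few_small_eigenvalues_algebraic C n _ coefB.
    case=> [b|] i j; rewrite !mxE; first exact/algebraic_opp/algA.
    by case: (i == j) => //; apply: algebraic0.
  exists E => t; have [delta d0 h] := hE t; exists delta => // p P d.
  by rewrite -kron_sumB; apply: h.
exists (2 * n)%N => t.
have [|delta d0 h] := @few_small_eigenvalues_transcendental C n _ coefA lam (@complex_archi R) _ tr t.
  by move=> b i j; rewrite mxE; apply: algA.
exists delta => // p P d; rewrite matrix_permE => dB dd0.
apply: leq_trans (h _ _ _ _ dB dd0); rewrite leq_mul2l; apply/orP; right.
by apply: subset_leq_card; apply/fintype.subsetP => i; rewrite !inE => /andP[].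
Qed.

Lemma dim_kerE p P d : diagonalizes P d ((Bp p)^t* *m Bp p) ->
  dim_ker (Bp p) = #|[pred i | d 0 i == 0]|.
Proof.
by move=> dB; rewrite -(diagonalizes_corank dB) mxrank_gram /dim_ker dim_lker_mulmx.
Qed.

Lemma card_sum (T : finType) (Q : pred T) : #|[pred i | Q i]|%:R = \sum_i (Q i)%:R :> C.
Proof.
rewrite -sum1_card natr_sum big_mkcond; apply: eq_bigr => i _.
by rewrite inE; case: (Q i).
Qed.

Lemma dim_ker_le_trS k p : (dim_ker (Bp p))%:R / (N p)%:R <= trS k p.
Proof.
have [P [d [dB d0]]] := diagonalize_gram (Bp p).
rewrite (dim_kerE dB) (trSE _ dB) ler_wpM2r ?invr_ge0 // card_sum.
apply: ler_sum => i _; case: eqP => [->|_]; first by rewrite mulr0 subr0 expr1n.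
by rewrite exprn_ge0 //; have /andP[] := gram_eig01 i dB d0.
Qed.

(** Eigenvalues of phi_p(B)^* phi_p(B) are split into zero, at most delta, and
    larger; those contribute to the trace of S_p^k at most 1, 1 and
    (1 - kap delta)^k. *)
Lemma trS_le_dim_ker k p delta t E : (0 < t)%N -> 0 < delta -> kap * delta <= 1 ->
  (forall P d, diagonalizes P d ((Bp p)^t* *m Bp p) -> (forall i, 0 <= d 0 i) ->
    (t * #|[pred i | (0 < d 0 i <= delta)%R]| <= E * N p)%N) ->
  trS k p <= (dim_ker (Bp p))%:R / (N p)%:R + E%:R / t%:R + n%:R * (1 - kap * delta) ^+ k.
Proof.
move=> t0 delta0 kd few; have [P [d [dB d0]]] := diagonalize_gram (Bp p).
have Np : 0 < (N p)%:R :> C by rewrite ltr0n (N_gt0 hphi).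
have tC : 0 < t%:R :> C by rewrite ltr0n.
rewrite (trSE _ dB) ler_pdivrMr // (dim_kerE dB) !mulrDl divfK ?gt_eqF //.
have r0 : 0 <= (1 - kap * delta) ^+ k by rewrite exprn_ge0 // subr_ge0.
pose major : C := \sum_i ((d 0 i == 0)%R%:R + (0 < d 0 i <= delta)%R%:R + (1 - kap * delta) ^+ k).
apply: (@le_trans _ _ major).
  apply: ler_sum => i _; have /andP[h0 h1] := gram_eig01 i dB d0.
  have le1 : (1 - kap * d 0 i) ^+ k <= 1 by rewrite exprn_ile1.
  have [di|di] := eqVneq (d 0 i) 0.
    by apply: le_trans le1 _; rewrite -addrA lerDl addr_ge0.
  have dpos : 0 < d 0 i by rewrite lt_def di d0.
  rewrite dpos /= add0r; have [dd|dd] := boolP (d 0 i <= delta).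
    by apply: le_trans le1 _; rewrite lerDl.
  rewrite add0r; apply: lerXn2r; rewrite ?nnegrE //; first by rewrite subr_ge0.
  rewrite lerD2l lerN2 ler_pM2l ?kap_gt0 //.
  by apply: ltW; rewrite real_ltNge ?ger0_real // ltW.
rewrite /major !big_split /= -!card_sum -addrA -[leRHS]addrA lerD2l; apply: lerD.
  rewrite mulrAC ler_pdivlMr // mulrC -!natrM ler_nat; exact: few dB d0.
have mulrnM (x : C) (a b : nat) : x *+ (a * b)%N = a%:R * x * b%:R.
  by rewrite mulrnA [a%:R * x]mulr_natl mulr_natr.
by rewrite sumr_const card_ord sum_nat_const card_ord mulrnM.
Qed.

Lemma dim_ker_cvg :
  (fun p => (dim_ker (Bp p))%:R / (N p)%:R : C^o) @ net --> (vN_dim (l2_eigenspace A lam) : C^o).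
Proof.
rewrite vN_dimE; apply/(@cvgrPdist_le C C^o) => e e0.
have eE := ge0_ReC (ltW e0); set er := complex.Re e in eE.
have er0 : 0 < er by rewrite -ltcR -eE.
have er4 : 0 < er / 4 by rewrite divr_gt0.
have [E hE] := few_small_eigenvalues.
pose t := (Num.Def.archi_bound (E%:R / (er / 4))).+1.
have tle : E%:R / t%:R <= er / 4 :> R.
  rewrite ler_pdivrMr ?ltr0n // mulrC -ler_pdivrMr //; apply: ltW.
  apply: lt_le_trans (archi_boundP _) _; first by rewrite divr_ge0 // ltW.
  by rewrite ler_nat.
have [delta' delta0' few'] := hE t.
have kd0 : 0 < 1 + kap * delta' by rewrite addr_gt0 // mulr_gt0 // kap_gt0.
(* Shrinks delta' so that kap * delta < 1. *)
pose delta := delta' / (1 + kap * delta').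
have delta0 : 0 < delta by rewrite divr_gt0.
have dle : delta <= delta' by rewrite ler_pdivrMr // ler_peMr ?(ltW delta0') // lerDl mulr_ge0 ?ltW ?kap_gt0.
have few p P d : diagonalizes P d ((Bp p)^t* *m Bp p) -> (forall i, 0 <= d 0 i) ->
    (t * #|[pred i | (0 < d 0 i <= delta)%R]| <= E * N p)%N.
  move=> dB d0; apply: leq_trans (few' p P d dB d0); rewrite leq_mul2l /=.
  apply: subset_leq_card; apply/fintype.subsetP => i; rewrite !inE => /andP[-> h] /=.
  exact: le_trans dle.
have kd : kap * delta < 1 by rewrite mulrA ltr_pdivrMr // mul1r ltrDr.
have kd' : 0 < kap * delta by rewrite mulr_gt0 ?kap_gt0.
have xE : 1 - kap * delta = (complex.Re (1 - kap * delta))%:C%C.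
  by apply: ge0_ReC; rewrite subr_ge0 ltW.
set x := complex.Re _ in xE.
have x0 : 0 <= x by rewrite -lecR -xE subr_ge0 ltW.
have x1 : x < 1 by rewrite -ltcR -xE gtrBl.
have hx : (fun k => n%:R * x ^+ k) @ \oo --> n%:R * (0 : R).
  by apply: cvgM; [exact: cvg_cst | apply: cvg_expr; rewrite ger0_norm].
have [k [hk1 hk2]] : exists k, n%:R * x ^+ k <= er / 4 /\ alpha k - beta <= er / 4.
  have /cvgrPdist_le/(_ _ er4) h1 := hx.
  have ac : alpha @ \oo --> beta by exact: alpha_cvg.
  have /cvgrPdist_le/(_ _ er4) h2 := ac.
  have [[k1 _ K1] [k2 _ K2]] := (h1, h2); exists (maxn k1 k2).
  have hk1 := K1 _ (leq_maxl k1 k2); have hk2 := K2 _ (leq_maxr k1 k2); split.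
    by move: hk1; rewrite /= mulr0 sub0r normrN; apply: le_trans; apply: ler_norm.
  by move: hk2; rewrite /= distrC; apply: le_trans; apply: ler_norm.
have hb : beta <= alpha k by apply: alpha_ge; [exact: alpha_decr | exact: alpha_cvg].
have er4C : 0 < (er / 4)%:C%C :> C by rewrite ltcR.
have tc : (fun p => trS k p : C^o) @ net --> (\tr (W k 1%g) : C^o) by exact: trS_cvg.
have /(@cvgrPdist_le C C^o)/(_ _ er4C) := tc.
apply: filterS => p; rewrite alphaE => hp.
have uE := ge0_ReC (trS_ge0 k p); set u := complex.Re _ in uE.
have low := dim_ker_le_trS k p.
have up := trS_le_dim_ker k (ltn0Sn _) delta0 (ltW kd) (few p).
have dE : (dim_ker (Bp p))%:R / (N p)%:R = ((dim_ker (Bp p))%:R / (N p)%:R : R)%:C%C :> C.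
  by rewrite fmorph_div !rmorph_nat.
rewrite -/t uE dE -(rmorph_nat (real_complex R) E) -(rmorph_nat (real_complex R) t)
  -(rmorph_nat (real_complex R) n) xE -rmorphXn -fmorph_div -rmorphM -!rmorphD lecR in up.
rewrite uE dE lecR in low.
move: hp; rewrite uE -rmorphB normc_def /= expr0n /= addr0 sqrtr_sqr lecR.
rewrite dE -rmorphB normc_def /= expr0n /= addr0 sqrtr_sqr eE lecR.
rewrite !ler_norml => /andP[h1 h2]; apply/andP; split; lra.
Qed.

End Approximation.

(** * Arithmetic of eigenvalues *)

Section Eigenvalues.
Variables (R : realType) (G : groupType).
Notation C := R[i].
Variables (n : nat) (A : 'M[group_ring R G]_n).
Hypothesis algA : forall i j g, algebraic_number (A i j g).
Variables (N : sofic_index R G -> nat) (phi : forall p : sofic_index R G, G -> 'S_(N p)).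
Hypothesis hphi : sofic_family phi.

Definition normalized_dim_ker (lam : C) (p : sofic_index R G) : C^o :=
  (dim_ker (lam%:M - matrix_perm (phi p) A))%:R / (N p)%:R.

Lemma normalized_dim_ker_cvg lam :
  normalized_dim_ker lam @ @sofic_net R G --> (vN_dim (l2_eigenspace A lam) : C^o).
Proof. exact: dim_ker_cvg. Qed.

Lemma vN_dim_eq0 lam : (forall p, dim_ker (lam%:M - matrix_perm (phi p) A) = 0%N) ->
  vN_dim (l2_eigenspace A lam) = 0.
Proof.
move=> d0; have h := @normalized_dim_ker_cvg lam.
have h0 : normalized_dim_ker lam @ @sofic_net R G --> (0 : C^o).
  rewrite (_ : normalized_dim_ker lam = fun=> 0); first exact: cvg_cst.
  by apply: funext => p; rewrite /normalized_dim_ker d0 mul0r.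
exact: (cvg_unique (@norm_hausdorff C C^o) h h0).
Qed.

Lemma vN_dim_congr lam mu : (forall p, dim_ker (lam%:M - matrix_perm (phi p) A)
    = dim_ker (mu%:M - matrix_perm (phi p) A)) ->
  vN_dim (l2_eigenspace A lam) = vN_dim (l2_eigenspace A mu).
Proof.
move=> dlm; have h := @normalized_dim_ker_cvg lam.
have h' := @normalized_dim_ker_cvg mu.
have e : normalized_dim_ker lam = normalized_dim_ker mu.
  by apply: funext => p; rewrite /normalized_dim_ker dlm.
rewrite e in h; exact: (cvg_unique (@norm_hausdorff C C^o) h h').
Qed.

Lemma integral_eigenvalue_of_entries (B : comNzRingType) (f : {rmorphism B -> C}) lam :
  (forall i j g, integralOver f (A i j g)) -> is_eigenvalue A lam -> integralOver f lam.
Proof.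
move=> intA; apply: contraPP => nint; apply/not_eigenvalue_vN_dim => //.
apply: vN_dim_eq0 => p; apply/eqP; rewrite /dim_ker dim_lker_mulmx subn_eq0 leqNgt.
apply/negP => rk; apply: nint; apply: integral_eigenvalue rk => i j.
rewrite mxE /group_ring_perm summxE; under eq_bigr do rewrite !mxE.
exact: integral_nat_combination.
Qed.

Lemma matrix_perm_rational p : (forall i j g, rational_number (A i j g)) ->
  exists M : 'M[rat]_(\sum_(i < n) N p), matrix_perm (phi p) A = map_mx ratr M.
Proof.
move=> ratA; rewrite matrix_permE.
have /fin_all_exists[q qE] : forall x : support A * ('I_n * 'I_n),
    exists q : rat, A x.2.1 x.2.2 (val x.1) = ratr q.
  by move=> x; apply: ratA.
exists (kron_sum (fun b => \matrix_(i, j) q (b, (i, j))) (fun b => phi p (val b))).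
rewrite map_kron_sum; apply: eq_kron_sum => b.
by apply/matrixP => i j; rewrite !mxE; exact: (qE (b, (i, j))).
Qed.

Lemma dim_ker_galois p lam mu : (forall i j g, rational_number (A i j g)) ->
  galois_conjugate lam mu ->
  dim_ker (lam%:M - matrix_perm (phi p) A) = dim_ker (mu%:M - matrix_perm (phi p) A).
Proof.
move=> /(matrix_perm_rational p)[M ->] [q [qm ql qmin] qmu].
by rewrite /dim_ker !dim_lker_mulmx (rank_galois M qm ql qmin qmu).
Qed.

End Eigenvalues.

Theorem theorem4p3 (R : realType) (G : groupType) (hG : sofic R G)
    (n : nat) (hn : (1 <= n)%N) (A : 'M[group_ring R G]_n)
    (hA : forall (i j : 'I_n) (g : G), algebraic_number (A i j g))
    (N : sofic_index R G -> nat)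
    (phi : forall p : sofic_index R G, G -> 'S_(N p))
    (hphi : sofic_family phi) :
  [/\ forall lam : R[i], is_eigenvalue A lam -> algebraic_number lam,
      (forall (i j : 'I_n) (g : G), rational_number (A i j g)) ->
        forall lam : R[i], is_eigenvalue A lam ->
        forall mu : R[i], galois_conjugate lam mu ->
          is_eigenvalue A mu /\
          vN_dim (l2_eigenspace A mu) = vN_dim (l2_eigenspace A lam),
      (forall (i j : 'I_n) (g : G), algebraic_integer (A i j g)) ->
        forall lam : R[i], is_eigenvalue A lam -> algebraic_integer lam &
      forall lam : R[i],
        (fun p => (dim_ker (lam%:M - matrix_perm (phi p) A))%:R / (N p)%:R : R[i]^o)
          @ @sofic_net R G --> (vN_dim (l2_eigenspace A lam) : R[i]^o)].
Proof.
split.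
- move=> lam; rewrite /algebraic_number => ev; apply/integral_algebraic.
  apply: (integral_eigenvalue_of_entries hA hphi) ev => i j g.
  exact/integral_algebraic/hA.
- move=> ratA lam ev mu conj.
  have dims : vN_dim (l2_eigenspace A mu) = vN_dim (l2_eigenspace A lam).
    by apply: (vN_dim_congr hA hphi) => p; rewrite (dim_ker_galois phi p ratA conj).
  have dim0 x := @not_eigenvalue_vN_dim _ _ _ A _ _ hphi x.
  by split=> //; apply: contrapT => /dim0; rewrite dims => /dim0; apply.
- by move=> intA lam; apply: (integral_eigenvalue_of_entries hA hphi).
- by move=> lam; apply: dim_ker_cvg.
Qed.
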